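(* Let $\Xi\subset\mathbb{R}^{2n}$ be an open domain (with the standard symplectic structure). Then the central extension of $\mathrm{SSymp}^\sim(\Xi)$ by $\mathbb{R}$ defined by the cocycle $C$ (pulled back from $\mathrm{SSymp}(\Xi)$ to its universal covering group) is trivial.
   Context: $\mathrm{Symp}(\Xi)$ is the group of $C^\infty$-smooth compactly supported symplectomorphisms of $\Xi$ with its natural ($C^\infty$) topology; $\mathrm{SSymp}(\Xi)$ is its connected component of the identity; $\mathrm{SSymp}^\sim(\Xi)$ is the universal covering group of $\mathrm{SSymp}(\Xi)$. The cocycle $C$: for $q_1,q_2\in\mathrm{Symp}(\Xi)$, $C(q_1,q_2)=\int_\Xi c\bigl(q_1'(q_2(m)),q_2'(m)\bigr)\,dm$, where $q'(x)$ is the Jacobi matrix of $q$ at $x$ and $c$ is the Berezin cocycle on $\mathrm{Sp}(2n,\mathbb{R})=\{g: g^tKg=K\}$, $K=\begin{pmatrix}0&1\\-1&0\end{pmatrix}$, defined as follows. Let $J=\frac1{\sqrt2}\begin{pmatrix}1&i\\i&1\end{pmatrix}$; for $g\in\mathrm{Sp}(2n,\mathbb{R})$, $J^{-1}gJ=\begin{pmatrix}\Phi&\Psi\\ \overline\Psi&\overline\Phi\end{pmatrix}$, $\Phi=\Phi(g)$. Then $c(g_1,g_2)=\mathrm{Im}\,\mathrm{tr}\ln[\Phi(g_1)^{-1}\Phi(g_1g_2)\Phi(g_2)^{-1}]$, where the matrix in brackets has the form $1+Z$ with $\|Z\|<1$ and $\ln(1+Z)=\sum_{k\ge1}(-1)^{k+1}Z^k/k$.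 The extension of a group $G$ defined by an $\mathbb{R}$-valued 2-cocycle $C$ is trivial if there is a function $\gamma:G\to\mathbb{R}$ with $C(g_1,g_2)=\gamma(g_1)+\gamma(g_2)-\gamma(g_1g_2)$ for all $g_1,g_2\in G$. *)

(* Defs.v *)
From HB Require Import structures.
From mathcomp Require Import all_boot all_order all_algebra.
From mathcomp Require Import all_classical all_reals all_analysis.
From mathcomp Require Import complex.

Set Implicit Arguments.
Unset Strict Implicit.
Unset Printing Implicit Defensive.

Import Order.TTheory GRing.Theory Num.Theory.
Import numFieldNormedType.Exports.

Local Open Scope classical_set_scope.
Local Open Scope ring_scope.

(* R[i] viewed through its numClosedFieldType structure, so that it (and the
   matrices over it) inherit the norm topology of numFieldNormedType. *)
Definition cplx (R : realType) : numClosedFieldType := R[i].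

Definition of_real (R : realType) (x : R) : cplx R := real_complex R x.

Definition Im_part (R : realType) (z : cplx R) : R := complex.Im (z : R[i]).

Definition imag_unit (R : realType) : cplx R := Complex 0 1.

Definition symp_form (R : realType) (n : nat) : 'M[R]_(n + n) :=
  block_mx 0 1%:M (- 1%:M) 0.

Definition Jmx (R : realType) (n : nat) : 'M[cplx R]_(n + n) :=
  (of_real (Num.sqrt 2))^-1 *:
    block_mx 1%:M (imag_unit R)%:M (imag_unit R)%:M 1%:M.

Definition Phi (R : realType) (n : nat) (g : 'M[R]_(n + n)) : 'M[cplx R]_n :=
  ulsubmx (invmx (Jmx R n) *m map_mx (@of_real R) g *m Jmx R n).

(* ln W = \sum_(k >= 1) (-1)^(k+1) Z^k / k with Z = W - 1; the index is
   shifted by one. *)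
Definition mxln (R : realType) (n : nat) (W : 'M[cplx R]_n) : 'M[cplx R]_n :=
  limn (series (fun k : nat =>
    ((-1) ^+ k / k.+1%:R) *: ((W - 1%:M) ^+ k.+1 : 'M[cplx R]_n))).

Definition berezin (R : realType) (n : nat) (g1 g2 : 'M[R]_(n + n)) : R :=
  Im_part (\tr (mxln (invmx (Phi g1) *m Phi (g1 *m g2) *m invmx (Phi g2)))).

Section LebesgueN.
Context {R : realType}.
Local Notation mR := (measurableTypeR R).

Definition tcons (N : nat) (x : mR * N.-tuple mR) : N.+1.-tuple mR :=
  [tuple of x.1 :: x.2].

Lemma measurable_tcons N : measurable_fun setT (@tcons N).
Proof. by apply: measurable_cons. Qed.

Section step.
Variable N : nat.
Variable mu : {sigma_finite_measure set (N.-tuple mR) -> \bar R}.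

Definition lebesgueS : set (N.+1.-tuple mR) -> \bar R :=
  pushforward (lebesgue_measure \x mu)%E (@tcons N).

Let preimage_tcons A : measurable A -> measurable (@tcons N @^-1` A).
Proof. by move=> mA; rewrite -[X in measurable X]setTI; exact: measurable_tcons. Qed.

Let lebesgueS0 : lebesgueS set0 = 0%E.
Proof. by rewrite /lebesgueS /pushforward preimage_set0 measure0. Qed.

Let lebesgueS_ge0 A : (0 <= lebesgueS A)%E.
Proof. by rewrite /lebesgueS /pushforward; exact: measure_ge0. Qed.

Let lebesgueS_sigma_additive : semi_sigma_additive lebesgueS.
Proof.
move=> F mF tF mUF; rewrite /lebesgueS /pushforward preimage_bigcup.
apply: measure_semi_sigma_additive.
- by move=> k; exact: preimage_tcons.
- apply/trivIsetP => i j _ _ ij; rewrite -preimage_setI.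
  by move/trivIsetP : tF => ->//; rewrite preimage_set0.
- by rewrite -preimage_bigcup; exact: preimage_tcons.
Qed.

HB.instance Definition _ := isMeasure.Build _ _ _ lebesgueS
  lebesgueS0 lebesgueS_ge0 lebesgueS_sigma_additive.

Let lebesgueS_sigma_finite : sigma_finite setT lebesgueS.
Proof.
have /sigma_finiteP[F [FT ndF Foo]] :=
  sigma_finiteT (@lebesgue_measure R : {sigma_finite_measure set mR -> \bar R}).
have /sigma_finiteP[G [GT ndG Goo]] := sigma_finiteT mu.
pose u (t : N.+1.-tuple mR) : mR * N.-tuple mR := (thead t, [tuple of behead t]).
have mu_ : measurable_fun setT u.
  apply: measurable_fun_pair; first exact: measurable_tnth.
  exact: measurable_behead.
have uK : cancel (@tcons N) u.
  by move=> [x t]; rewrite /u /tcons theadE/=; congr pair; apply/val_inj.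
exists (fun k => u @^-1` (F k `*` G k)).
  rewrite -preimage_bigcup; apply/esym; rewrite -subTset => t _ /=.
  have [i _ Fi] : (\bigcup_i F i) (u t).1 by rewrite -FT.
  have [j _ Gj] : (\bigcup_i G i) (u t).2 by rewrite -GT.
  exists (maxn i j) => //; split.
    by move: Fi; exact/subsetPset/ndF/leq_maxl.
  by move: Gj; exact/subsetPset/ndG/leq_maxr.
move=> k; have [mF Fk] := Foo k; have [mG Gk] := Goo k; split.
  by rewrite -[X in measurable X]setTI; apply: mu_ => //; exact: measurableX.
rewrite /lebesgueS /pushforward -comp_preimage (_ : u \o _ = id); last exact/funext.
by rewrite preimage_id product_measure1E// lte_mul_pinfty// ge0_fin_numE.
Qed.

HB.instance Definition _ := Measure_isSigmaFinite.Build _ _ _ lebesgueS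
  lebesgueS_sigma_finite.

End step.

Fixpoint lebesgueN (N : nat) :
    {sigma_finite_measure set (N.-tuple mR) -> \bar R} :=
  if N is N'.+1 then lebesgueS (lebesgueN N') else \d_[tuple].

Definition vec_of_tuple (N : nat) (t : N.-tuple mR) : 'rV[R]_N :=
  \row_i (tnth t i : R).

Definition integralN (N : nat) (D : set 'rV[R]_N) (f : 'rV[R]_N -> R) : R :=
  Rintegral (lebesgueN N) (@vec_of_tuple N @^-1` D) (f \o @vec_of_tuple N).

End LebesgueN.

Section Symp.
Context {R : realType}.

Definition partials (N : nat) (V : normedModType R) (s : seq 'I_N)
    (f : 'rV[R]_N -> V) : 'rV[R]_N -> V :=
  foldr (fun i g x => 'D_(delta_mx 0 i) g x) f s.

Definition smooth_on (N : nat) (V : normedModType R) (A : set 'rV[R]_N)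
    (f : 'rV[R]_N -> V) : Prop :=
  forall (s : seq 'I_N) (x : 'rV[R]_N), A x -> differentiable (partials s f) x.

(* The library's jacobian acts on row vectors from the right, hence the
   transpose: (jacobi_mx q x) i j = d q_i / d x_j. *)
Definition jacobi_mx (N : nat) (q : 'rV[R]_N -> 'rV[R]_N) (x : 'rV[R]_N) :
  'M[R]_N := (jacobian q x)^T.

Variable n : nat.
Local Notation V := 'rV[R]_(n + n).

(* A symplectomorphism of Xi is represented by its extension by the identity
   to the whole of R^(2n). *)
Record is_symp (Xi : set V) (q : V -> V) : Prop := IsSymp {
  symp_diffeo : exists r : V -> V,
    [/\ {homo q : x / Xi x >-> Xi x}, {homo r : x / Xi x >-> Xi x},
        (forall x, Xi x -> r (q x) = x), (forall x, Xi x -> q (r x) = x) &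
        smooth_on Xi q /\ smooth_on Xi r];
  symp_supp : exists K : set V,
    [/\ compact K, K `<=` Xi & forall x, ~ K x -> q x = x];
  symp_preserves : forall x, Xi x ->
    (jacobi_mx q x)^T *m symp_form R n *m jacobi_mx q x = symp_form R n }.

Record symp (Xi : set V) := Symp {
  symp_fun :> V -> V;
  symp_funP : is_symp Xi symp_fun }.

Lemma sympP Xi (q p : symp Xi) : q =1 p -> q = p.
Proof.
case: q p => [q hq] [p hp] /= /funext qp; subst p.
by rewrite (Prop_irrelevance hq hp).
Qed.

HB.instance Definition _ Xi := gen_eqMixin (symp Xi).
HB.instance Definition _ Xi := gen_choiceMixin (symp Xi).

(* The C^infty topology on compactly supported maps is that of the space of
   test functions (Schwartz): a basic neighbourhood of q controls at x the
   partial derivatives of order <= m x up to e x, where on every compact subset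
   of Xi the order m is bounded and the tolerance e is bounded away from 0. *)
Definition gauge (Xi : set V) (m : V -> nat) (e : V -> R) : Prop :=
  forall K : set V, compact K -> K `<=` Xi ->
    exists (M : nat) (d : R),
      0 < d /\ forall x, K x -> (m x <= M)%N /\ d <= e x.

Definition symp_near (Xi : set V) (m : V -> nat) (e : V -> R) (q : symp Xi) :
    set (symp Xi) :=
  [set p | forall x, Xi x -> forall s : seq 'I_(n + n), (size s <= m x)%N ->
    `|partials s p x - partials s q x| < e x].

Definition symp_nbhs (Xi : set V) (q : symp Xi) : set_system (symp Xi) :=
  [set A | exists m e, gauge Xi m e /\ symp_near m e q `<=` A].

HB.instance Definition _ Xi := hasNbhs.Build (symp Xi) (@symp_nbhs Xi).

Lemma gauge_gt0 Xi m e x : gauge Xi m e -> Xi x -> 0 < e x.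
Proof.
move=> /(_ [set x] (@compact_set1 _ x)) g Xx.
have [_ ->//|M [d [d0 /(_ x erefl) [_]]]] := g.
exact: lt_le_trans.
Qed.

Let symp_filter Xi (q : symp Xi) : ProperFilter (nbhs q).
Proof.
apply: Build_ProperFilter_ex.
  move=> A [m [e [g sA]]]; exists q; apply: sA => x Xx s _.
  by rewrite subrr normr0; exact: gauge_gt0 g Xx.
split.
- exists (fun=> 0%N), (fun=> 1); split=> // K _ _.
  by exists 0%N, 1.
- move=> A B [m [e [g sA]]] [m' [e' [g' sB]]].
  exists (fun x => maxn (m x) (m' x)), (fun x => Num.min (e x) (e' x)); split.
    move=> K cK KX; have [M [d [d0 Md]]] := g K cK KX.
    have [M' [d' [d'0 Md']]] := g' K cK KX.
    exists (maxn M M'), (Num.min d d'); split; first by rewrite lt_min d0.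
    move=> x Kx; have [h1 h2] := Md x Kx; have [h1' h2'] := Md' x Kx.
    split; first by rewrite geq_max !leq_max h1 h1' orbT.
    by rewrite le_min !ge_min h2 h2' orbT.
  move=> p pm; split; [apply: sA|apply: sB] => x Xx s sm.
    have := pm x Xx s; rewrite leq_max sm => /(_ isT).
    by rewrite lt_min => /andP[].
  have := pm x Xx s; rewrite leq_max sm orbT => /(_ isT).
  by rewrite lt_min => /andP[].
- move=> A B AB [m [e [g sA]]]; exists m, e; split=> //.
  exact: subset_trans AB.
Qed.

Let symp_nbhs_singleton Xi (q : symp Xi) A : nbhs q A -> A q.
Proof.
move=> [m [e [g sA]]]; apply: sA => x Xx s _.
by rewrite subrr normr0; exact: gauge_gt0 g Xx.
Qed.

Let symp_nbhs_nbhs Xi (q : symp Xi) A : nbhs q A -> nbhs q (nbhs^~ A).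
Proof.
move=> [m [e [g sA]]].
have g2 : gauge Xi m (fun x => e x / 2).
  move=> K cK KX; have [M [d [d0 Md]]] := g K cK KX.
  exists M, (d / 2); split; first by rewrite divr_gt0.
  by move=> x /Md[? ?]; rewrite ler_pM2r ?invr_gt0.
exists m, (fun x => e x / 2); split=> // p qp.
exists m, (fun x => e x / 2); split=> // r pr; apply: sA => x Xx s sm.
rewrite (splitr (e x)) -(subrKA (partials s p x)).
by rewrite (le_lt_trans (ler_normD _ _))// ltrD//; [exact: pr|exact: qp].
Qed.

HB.instance Definition _ Xi := Nbhs_isNbhsTopological.Build (symp Xi)
  (@symp_filter Xi) (@symp_nbhs_singleton Xi) (@symp_nbhs_nbhs Xi).

Lemma partials_id (s : seq 'I_(n + n)) :
  partials s (@id V) = id \/ exists c : V, partials s (@id V) = cst c.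
Proof.
elim: s => [|i s [/= ->|[c /= ->]]]; first by left.
  by right; exists (delta_mx 0 i); apply/funext => x; rewrite derive_id.
by right; exists 0; apply/funext => x; rewrite derive_cst.
Qed.

Lemma smooth_id (Xi : set V) : smooth_on Xi (@id V).
Proof.
by move=> s x _; have [->|[c ->]] := partials_id s; apply: ex_diff.
Qed.

Lemma jacobi_id (x : V) : jacobi_mx id x = 1%:M.
Proof.
rewrite /jacobi_mx /jacobian diff_val.
by apply/matrixP => i j; rewrite !mxE.
Qed.

Lemma is_symp_id (Xi : set V) : is_symp Xi id.
Proof.
split.
- exists id; split=> //; split; exact: smooth_id.
- by exists set0; split=> //; exact: compact0.
- by move=> x _; rewrite jacobi_id trmx1 mul1mx mulmx1.
Qed.

Definition symp_id (Xi : set V) : symp Xi := Symp (is_symp_id Xi).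

Definition SSymp (Xi : set V) : set (symp Xi) :=
  connected_component setT (symp_id Xi).

Definition symp_cocycle (Xi : set V) (q1 q2 : symp Xi) : R :=
  integralN Xi (fun m => berezin (jacobi_mx q1 (q2 m)) (jacobi_mx q2 m)).

End Symp.

Arguments SSymp {R n} Xi _.

HB.mixin Record isTopologicalGroup G of Group G & Topological G := {
  mulg_continuous : continuous (fun x : G * G => (x.1 * x.2)%g);
  invg_continuous : continuous (fun x : G => (x^-1)%g) }.

#[short(type="topologicalGroupType")]
HB.structure Definition TopologicalGroup :=
  {G of isTopologicalGroup G & Group G & Topological G}.

Definition is_path (R : realType) (T : topologicalType) (f : R -> T) (a b : T)
    : Prop :=
  [/\ {within `[0, 1], continuous f}, f 0 = a & f 1 = b].

Definition simply_connected (R : realType) (T : topologicalType) : Prop :=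
  (forall a b : T, exists f : R -> T, is_path f a b) /\
  (forall (a : T) (f : R -> T), is_path f a a ->
     exists H : R * R -> T,
       [/\ {within `[0, 1] `*` `[0, 1], continuous H},
           (forall t, t \in `[0, 1] -> H (t, 0) = f t /\ H (t, 1) = a) &
           (forall s, s \in `[0, 1] -> H (0, s) = a /\ H (1, s) = a)]).

Definition evenly_covered (E B : topologicalType) (p : E -> B) (U : set B)
    : Prop :=
  exists (I : Type) (W : I -> set E),
    [/\ (forall i, open (W i)), trivIset setT W, p @^-1` U = \bigcup_i W i &
        forall i, set_bij (W i) U p /\
          (forall O : set E, O `<=` W i -> open O -> open (p @` O))].

Definition covering_map (E B : topologicalType) (p : E -> B) : Prop :=
  [/\ continuous p, range p = setT &
      forall b : B, exists U : set B, open_nbhs b U /\ evenly_covered p U].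

(* A universal covering group is unique up to isomorphism over SSymp Xi; it is
   characterised here rather than constructed.  SSymp Xi carries the subspace
   topology, and its group law is composition of maps. *)
Definition universal_covering_group (R : realType) (n : nat)
    (Xi : set 'rV[R]_(n + n)) (G : topologicalGroupType) (p : G -> SSymp Xi)
    : Prop :=
  [/\ simply_connected R G, covering_map p &
      forall g h : G, set_val (p (g * h)%g) = set_val (p g) \o set_val (p h)
        :> ('rV[R]_(n + n) -> 'rV[R]_(n + n))].

Definition trivial_extension (R : realType) (G : groupType) (C : G -> G -> R)
    : Prop :=
  exists gamma : G -> R, forall g1 g2 : G,
    C g1 g2 = gamma g1 + gamma g2 - gamma (g1 * g2)%g.

(* Main.v *)
Require Import Defs.
From HB Require Import structures.
From mathcomp Require Import all_boot all_order all_fingroup all_algebra.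
From mathcomp Require Import all_classical all_reals all_analysis.
From mathcomp Require Import complex spectral sesquilinear.
From mathcomp Require Import ring lra measurable_realfun.

(* The integrand of C is the Berezin cocycle of the Jacobi matrices, which satisfies the
   cocycle identity along paths in Sp(2n, R) that start at 1; since symplectomorphisms in
   the identity component preserve volume, C is a 2-cocycle on the covering group.  Near
   the identity of Sp(2n, R) the Berezin cocycle is the coboundary of - arg det Phi, so that
   u |-> - \int arg det Phi(u'(m)) dm trivializes C near 1.  On a simply connected
   group a cocycle that is trivial near 1 is trivial: summing the local primitive along
   fine subdivisions of a path from 1 to g gives a value independent of the path. *)

Set Implicit Arguments.
Unset Strict Implicit.
Unset Printing Implicit Defensive.

Import Order.TTheory GRing.Theory Num.Theory.
Import numFieldNormedType.Exports.

Local Open Scope classical_set_scope.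
Local Open Scope ring_scope.

(** * Cocycles on simply connected groups *)

(** The obstacle is that a value of c is known algebraically only as an argument of det Phi(g1 g2) /
    (det Phi(g1) det Phi(g2)), so identities between values of c come for free only modulo 2 pi.
    Continuity of c along paths from 1 removes this ambiguity. That continuity needs the bound on Z
    to be uniform, so the inequality norm of Z below 1 is made quantitative: the bound depends on g1
    only through the size of Phi(g1), hence is locally uniform. Invariance of integrals under a
    symplectomorphism phi is obtained without inverting any map. A Jacobian determinant is a
    divergence, so the integral of the determinant of x |-> (B_i(phi_i(x))) depends only on the
    values far away. As det phi' = 1, this determinant is the product of the b_i(phi_i), where b_i
    is the derivative of B_i. Logistic functions b_i that tend to indicators of half-lines then give
    the measure of preimages of orthants, and thus of all measurable sets. *)

Section Paths.
Context {R : realType}.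

(** Composing with [clamp] turns a path that is continuous only within [0, 1] into a continuous
    function on R with the same endpoints; this spares subspace topologies later. *)
Definition clamp (t : R) : R := Num.max 0 (Num.min 1 t).

Lemma continuous_clamp : continuous clamp.
Proof.
move=> t; apply: continuous_max; first exact: cvg_cst.
by apply: continuous_min; [exact: cvg_cst|exact: cvg_id].
Qed.

Lemma clamp_in t : clamp t \in `[0, 1].
Proof.
rewrite in_itv/= /clamp le_max lexx/= ge_max ler01/=.
by rewrite ge_min lexx.
Qed.

Lemma clampE t : 0 <= t <= 1 -> clamp t = t.
Proof. by move=> /andP[t0 t1]; rewrite /clamp min_r// max_r. Qed.

Lemma clamp_le0 t : t <= 0 -> clamp t = 0.
Proof. by move=> t0; rewrite /clamp min_r ?(le_trans t0)// max_l. Qed.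

Lemma clamp_ge1 t : 1 <= t -> clamp t = 1.
Proof. by move=> t0; rewrite /clamp min_l// max_r. Qed.

Variable G : topologicalGroupType.

Lemma continuous_mulg (T : topologicalType) (f g : T -> G) :
  continuous f -> continuous g -> continuous (fun t => f t * g t)%g.
Proof.
move=> cf cg t.
apply: (@continuous_comp _ _ _ (fun t => (f t, g t)) (fun x : G * G => (x.1 * x.2)%g)).
  by apply: cvg_pair; [exact: cf|exact: cg].
exact: mulg_continuous.
Qed.

Lemma near_div (K : set_system G) (a : G) (W : set G) : Filter K -> K --> a ->
  nbhs 1%g W -> \forall x & y \near K, W (x^-1 * y)%g.
Proof.
move=> FK Ka W1.
have h : (fun z : G * G => (z.1^-1 * z.2)%g) @ (nbhs a, nbhs a) --> 1%g.
  rewrite -(mulVg a).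
  apply: (@cvg_comp _ _ _ (fun z : G * G => (z.1^-1, z.2)%g) (fun x : G * G => (x.1 * x.2)%g) _ (nbhs (a^-1, a)%g)).
    apply: cvg_pair; last exact: cvg_snd.
    by apply: cvg_comp; [exact: cvg_fst|exact: invg_continuous].
  exact: (@mulg_continuous G (a^-1, a)%g).
have [[A B] /= [A1 B1] AB] := h _ W1.
by exists (A, B); [split; exact: Ka|move=> z /AB].
Qed.

(** Heine-Cantor for the left uniformity of G, which is expressed through x^-1 y because G carries
    only a topology. *)
Lemma compact_unif_div (X : pseudoMetricType R) (K : set X) (f : X -> G)
    (W : set G) : compact K -> {within K, continuous f} -> nbhs 1%g W ->
  exists2 d : R, 0 < d & forall x y, K x -> K y -> ball x d y ->
    W ((f x)^-1 * f y)%g.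
Proof.
move=> cK cf W1.
move/compact_near_coveringP : cK => /(_ R 0^'+
  (fun d x => K x -> forall y, K y -> ball x d y -> W ((f x)^-1 * f y)%g)) cK.
have {}cK : 0^'+ (fun d => K `<=` fun x => K x -> forall y, K y -> ball x d y ->
    W ((f x)^-1 * f y)%g).
  apply: cK => x Kx.
  have fx : f @ (within K (nbhs x)) --> f x.
    by move/subspace_continuousP : cf => /(_ _ Kx).
  have /= [[A B] /= [WA WB] AB] := near_div _ fx W1.
  have /nbhs_ballP[e /= e0 eAB] : nbhs x (fun z => K z -> A (f z) /\ B (f z)).
    have {}WA : nbhs x (fun z => K z -> A (f z)) := WA.
    have {}WB : nbhs x (fun z => K z -> B (f z)) := WB.
    by near=> z => Kz; split; [apply: (near WA z)|apply: (near WB z)].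
  exists (ball x (e / 2), [set d | d <= e / 2]) => /=; first split.
  - by apply: nbhsx_ballx; rewrite divr_gt0.
  - by apply: nbhs_right_le; rewrite divr_gt0.
  - move=> [z d] /= [xz de] Kz y Ky zy; apply: (AB (f z, f y)); split=> /=.
      suff /eAB/(_ Kz)[] : ball x e z by [].
      apply: le_ball xz.
      by move: e0; lra.
    suff /eAB/(_ Ky)[] : ball x e y by [].
    by rewrite (splitr e); apply: (ball_triangle xz); exact: le_ball zy.
have [d [d0 dW]] : exists d : R, 0 < d /\ K `<=` fun x => K x ->
    forall y, K y -> ball x d y -> W ((f x)^-1 * f y)%g.
  apply: (@filter_ex _ (0^'+ : set_system R)).
  by apply: filterI => //; exact: nbhs_right_gt.
by exists d => // x y Kx Ky xy; exact: dW.
Unshelve. all: by end_near.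
Qed.

Lemma is_path_clamp (f : R -> G) a b : is_path f a b ->
  [/\ continuous (f \o clamp), (f \o clamp) 0 = a & (f \o clamp) 1 = b].
Proof.
move=> [cf f0 f1]; split => /=; last 2 first.
- by rewrite clamp_le0.
- by rewrite clamp_ge1.
move=> t; apply: cvg_comp; last first.
  move/subspace_continuousP : cf; apply; exact: clamp_in.
move=> A /= WA.
have {}WA : nbhs t (fun s => `[0, 1]%classic (clamp s) -> A (clamp s)) :=
  @continuous_clamp t _ WA.
by apply: filterS WA => s /(_ (clamp_in s)).
Qed.

Lemma path_compact_fine (f : R -> G) (W : set G) : continuous f -> nbhs 1%g W ->
  exists2 d : R, 0 < d & forall x y, x \in `[0, 1] -> y \in `[0, 1] ->
    `|x - y| < d -> W ((f x)^-1 * f y)%g.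
Proof.
move=> cf W1.
have [|d d0 dW] := @compact_unif_div R^o `[0, 1]%classic f W (@segment_compact _ _ _) _ W1.
  exact: continuous_subspaceT.
by exists d.
Qed.
End Paths.

(** * Integration of a closed 1-cochain on nearby pairs along paths *)

Section Cochain.
Context {R : realType} {G : topologicalGroupType}.
Variables (V : set G) (w : G -> G -> R).
Hypothesis V1 : nbhs 1%g V.
Hypothesis Vsym : forall g, V g -> V g^-1%g.
Let near_by (a b : G) := V (a^-1 * b)%g.
Hypothesis w_closed : forall a b c, near_by a b -> near_by b c -> near_by a c ->
  w a b + w b c = w a c.

Let nearxx a : near_by a a.
Proof. by rewrite /near_by mulVg; exact: nbhs_singleton. Qed.

Let near_sym a b : near_by a b -> near_by b a.
Proof. by move=> /Vsym; rewrite /near_by invgM invgK. Qed.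

Let wxx a : w a a = 0.
Proof. by have := @w_closed a a a (nearxx a) (nearxx a) (nearxx a); lra. Qed.

Let w_anti a b : near_by a b -> w b a = - w a b.
Proof.
by move=> ab; have := @w_closed a b a ab (near_sym ab) (nearxx a); rewrite wxx; lra.
Qed.

(** A discrete line integral of the cochain w along f; for closed w its values are compared once
    consecutive sample points are close. *)
Definition path_sum (f : R -> G) (N : nat) : R :=
  \sum_(i < N) w (f (i%:R / N%:R)) (f (i.+1%:R / N%:R)).

(** Discrete Stokes: each cell is cut by its diagonal into two triangles, where [w_closed] applies,
    so adjacent rows differ only by their vertical edges. These telescope to the two sides, on which
    h is constant. *)
Lemma grid_sum (h : nat -> nat -> G) (N : nat) (a : G) :
  (forall i j i' j', (i <= i' <= i.+1)%N -> (j <= j' <= j.+1)%N ->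
     (i' <= N)%N -> (j' <= N)%N -> near_by (h i j) (h i' j')) ->
  (forall j, (j <= N)%N -> h 0%N j = a /\ h N j = a) ->
  (forall i, (i <= N)%N -> h i N = a) ->
  \sum_(i < N) w (h i 0%N) (h i.+1 0%N) = 0.
Proof.
move=> hnear hside htop.
suff row j : (j <= N)%N ->
    \sum_(i < N) w (h i 0%N) (h i.+1 0%N) = \sum_(i < N) w (h i j) (h i.+1 j).
  rewrite (row N)// big1// => i _.
  by rewrite !htop ?wxx// ltnW.
elim: j => // j IH jN; rewrite IH; last exact: ltnW.
apply/eqP; rewrite -subr_eq0 -sumrB; apply/eqP.
transitivity (\sum_(0 <= i < N) (w (h i j) (h i j.+1) - w (h i.+1 j) (h i.+1 j.+1))).
  rewrite big_mkord; apply: eq_bigr => i _.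
  have iN := ltn_ord i.
  have e1 : w (h i j) (h i.+1 j) + w (h i.+1 j) (h i.+1 j.+1) = w (h i j) (h i.+1 j.+1).
    by apply: w_closed; apply: hnear; rewrite ?leqnn ?leqnSn// ltnW.
  have e2 : w (h i j) (h i j.+1) + w (h i j.+1) (h i.+1 j.+1) = w (h i j) (h i.+1 j.+1).
    by apply: w_closed; apply: hnear; rewrite ?leqnn ?leqnSn// ltnW.
  lra.
transitivity (- \sum_(0 <= i < N) (w (h i.+1 j) (h i.+1 j.+1) - w (h i j) (h i j.+1))).
  by rewrite -sumrN; apply: eq_bigr => i _; rewrite opprB.
rewrite (telescope_sumr (fun i => w (h i j) (h i j.+1)))//.
have [-> ->] := hside j (ltnW jN); have [-> ->] := hside j.+1 jN.
by rewrite wxx subrr oppr0.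
Qed.

Hypothesis scG : simply_connected R G.

Lemma near_ord_fine (d : R) (N i i' : nat) : d^-1 < N%:R -> 0 < d ->
  (i <= i' <= i.+1)%N -> `|i%:R / N%:R - i'%:R / N%:R| < d.
Proof.
move=> dN d0 /andP[ii' i'i].
have N0 : 0 < N%:R :> R by apply: lt_trans dN; rewrite invr_gt0.
rewrite distrC -mulrBl normrM ger0_norm ?subr_ge0 ?ler_nat//.
rewrite ger0_norm ?invr_ge0 ?ler0n// ltr_pdivrMr//.
apply: (@le_lt_trans _ _ 1).
  by rewrite lerBlDr addrC natr1 ler_nat.
by rewrite -ltr_pdivrMl// mulr1.
Qed.

Lemma ratio_in (N i : nat) : (i <= N)%N -> (i%:R / N%:R : R) \in `[0, 1].
Proof.
move=> iN; rewrite in_itv/= divr_ge0//=.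
have [->|N0] := posnP N; first by rewrite invr0 mulr0.
by rewrite ler_pdivrMr ?ltr0n// mul1r ler_nat.
Qed.

Definition for_large (P : nat -> Prop) := exists N0, forall N, (N0 < N)%N -> P N.

Lemma for_large_gt (x : R) : for_large (fun N => x < N%:R).
Proof.
exists (Num.truncn `|x|) => N h; apply: le_lt_trans (ler_norm _) _.
by rewrite (lt_le_trans (truncnS_gt _))// ler_nat.
Qed.

Lemma for_large_fine (f : R -> G) : continuous f ->
  for_large (fun N => forall i i', (i <= N)%N -> (i' <= N)%N -> (i <= i' <= i.+1)%N ->
    near_by (f (i%:R / N%:R)) (f (i'%:R / N%:R))).
Proof.
move=> cf; have [d d0 dV] := path_compact_fine cf V1.
have [N0 h] := for_large_gt d^-1; exists N0 => N /h dN i i' iN i'N ii'.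
by apply: dV; rewrite ?ratio_in//; exact: near_ord_fine.
Qed.

(** A null-homotopy of the loop, sampled on a grid finer than its modulus of uniform continuity,
    satisfies the hypotheses of [grid_sum]. *)
Lemma loop_sum (f : R -> G) (a : G) : continuous f -> f 0 = a -> f 1 = a ->
  for_large (fun N => path_sum f N = 0).
Proof.
move=> cf f0 f1.
have [|H [cH H1 H2]] := scG.2 a f; first by split=> //; exact: continuous_subspaceT.
have [|d d0 dV] := @compact_unif_div R G (R^o * R^o)%type (`[0, 1]%classic `*` `[0, 1]%classic) H V _ cH V1.
  by apply: compact_setX; exact: segment_compact.
have [N0 h] := for_large_gt d^-1; exists N0 => N N0N; have dN := h _ N0N.
have N_gt0 : (0 < N)%N by apply: leq_ltn_trans N0N.
have NN : N%:R / N%:R = 1 :> R by rewrite divff// pnatr_eq0 -lt0n.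
have z01 : (0 : R) \in `[0, 1] by rewrite in_itv/= lexx ler01.
rewrite -(@grid_sum (fun i j => H (i%:R / N%:R, j%:R / N%:R)) N a).
- apply: eq_bigr => i _; rewrite !mul0r.
  have [-> _] := H1 (i%:R / N%:R) (ratio_in (ltnW (ltn_ord i))).
  by have [-> _] := H1 (i.+1%:R / N%:R) (ratio_in (ltn_ord i)).
- move=> i j i' j' ii' jj' i'N j'N.
  have iN : (i <= N)%N by case/andP: ii' => /leq_trans + _; exact.
  have jN : (j <= N)%N by case/andP: jj' => /leq_trans + _; exact.
  apply: dV; rewrite /= ?ratio_in//; split => /=; exact: near_ord_fine.
- by move=> j jN; rewrite mul0r NN; exact: H2 (ratio_in jN).
- by move=> i iN; rewrite NN; have [] := H1 _ (ratio_in iN).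
Qed.

Definition rev_path (f : R -> G) (t : R) := f (1 - t).

(** Concatenation written with the group law: when f1 1 = f2 0, on each half one outer factor
    cancels against the inverse of f1 1. Continuity is then that of a product, with no gluing. *)
Definition concat (f1 f2 : R -> G) (t : R) : G :=
  (f1 (clamp (t *+ 2)%R) * (f1 1%R)^-1 * f2 (clamp (t *+ 2 - 1)%R))%g.

Lemma continuous_concat f1 f2 : continuous f1 -> continuous f2 ->
  continuous (concat f1 f2).
Proof.
move=> c1 c2; apply: continuous_mulg; first apply: continuous_mulg.
- move=> t; apply: cvg_comp; last exact: c1.
  apply: cvg_comp; last exact: continuous_clamp.
  by apply: cvgMn; exact: cvg_id.
- by move=> t; exact: cvg_cst.
- move=> t; apply: cvg_comp; last exact: c2.
  apply: cvg_comp; last exact: continuous_clamp.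
  by apply: cvgB; [apply: cvgMn; exact: cvg_id|exact: cvg_cst].
Qed.

Lemma continuous_rev f : continuous f -> continuous (rev_path f).
Proof.
move=> cf t; apply: cvg_comp; last exact: cf.
by apply: cvgB; [exact: cvg_cst|exact: cvg_id].
Qed.

Lemma concat_lo f1 f2 t : f1 1 = f2 0 -> 0 <= t <= 1 / 2 ->
  concat f1 f2 t = f1 (t *+ 2).
Proof.
move=> f12 /andP[t0 t1]; rewrite /concat (@clamp_le0 _ (_ - _)); last lra.
rewrite -f12 mulgVK clampE//; lra.
Qed.

Lemma concat_hi f1 f2 t : f1 1 = f2 0 -> 1 / 2 <= t <= 1 ->
  concat f1 f2 t = f2 (t *+ 2 - 1).
Proof.
move=> f12 /andP[t0 t1]; rewrite /concat (@clamp_ge1 _ (_ *+ _)); last lra.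
rewrite mulgV mul1g clampE//; lra.
Qed.

Lemma path_sum_concat f1 f2 N : f1 1 = f2 0 ->
  path_sum (concat f1 f2) (N + N) = path_sum f1 N + path_sum f2 N.
Proof.
move=> f12; have [->|N0] := posnP N; first by rewrite /path_sum !big_ord0 addr0.
have N0' : 0 < N%:R :> R by rewrite ltr0n.
have NE : (N + N)%:R = N%:R *+ 2 :> R by rewrite natrD.
have dbl (i : nat) : i%:R / (N + N)%:R *+ 2 = i%:R / N%:R :> R.
  by rewrite NE -[N%:R *+ 2]mulr_natr invfM -[LHS]mulr_natr -!mulrA mulVf ?mulr1// pnatr_eq0.
have lo (i : nat) : (i <= N)%N -> concat f1 f2 (i%:R / (N + N)%:R) = f1 (i%:R / N%:R).
  move=> iN; rewrite concat_lo// ?dbl// divr_ge0//= ler_pdivrMr ?NE; last first.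
    by rewrite -NE ltr0n addn_gt0 N0.
  rewrite -[N%:R *+ 2]mulr_natl mulrA mul1r mulVf// mul1r ler_nat//.
have hi (i : nat) : (i <= N)%N ->
    concat f1 f2 ((N + i)%:R / (N + N)%:R) = f2 (i%:R / N%:R).
  move=> iN; have := ratio_in iN; rewrite in_itv/= => i01.
  have dE : (N + i)%:R / (N + N)%:R *+ 2 = 1 + i%:R / N%:R :> R.
    by rewrite dbl natrD mulrDl divff ?gt_eqF.
  rewrite concat_hi//; first by rewrite dE addrAC subrr add0r.
  lra.
rewrite /path_sum big_split_ord/=; congr (_ + _); apply: eq_bigr => i _.
  by rewrite !lo// ltnW.
by rewrite -addnS !hi// ltnW.
Qed.

Lemma path_sum_rev f : continuous f ->
  for_large (fun N => path_sum (rev_path f) N = - path_sum f N).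
Proof.
move=> cf; have [N0 h] := for_large_fine cf; exists N0 => N N0N; have {}h := h N N0N.
have N_gt0 : (0 < N)%N by apply: leq_ltn_trans N0N.
rewrite /path_sum (reindex_inj rev_ord_inj)/= -sumrN; apply: eq_bigr => i _.
have iN := ltn_ord i.
have e (k : nat) : (k <= N)%N -> rev_path f ((N - k)%:R / N%:R) = f (k%:R / N%:R).
  move=> kN; rewrite /rev_path natrB// mulrBl divff ?pnatr_eq0 -?lt0n//.
  by rewrite opprB addrCA subrr addr0.
rewrite e// -subSn// subSS e; last exact: ltnW.
by rewrite w_anti//; apply: h => //; [exact: ltnW|rewrite leqnSn leqnn].
Qed.

Lemma path_sum_homotopic (f1 f2 : R -> G) : continuous f1 -> continuous f2 ->
  f1 0 = f2 0 -> f1 1 = f2 1 -> for_large (fun N => path_sum f1 N = path_sum f2 N).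
Proof.
move=> c1 c2 e0 e1.
have r0 : f1 1 = rev_path f2 0 by rewrite /rev_path subr0.
have cl := continuous_concat c1 (continuous_rev c2).
have [||N0 h] := @loop_sum _ (f1 0) cl.
- by rewrite concat_lo ?mul0rn//; lra.
- rewrite concat_hi//; last lra.
  by rewrite /rev_path e0; congr f2; lra.
have [N1 h1] := path_sum_rev c2.
exists (maxn N0 N1) => N; rewrite gtn_max => /andP[a b].
(* With 2N steps the sample points of the concatenation are those of the two paths with N steps
   each. *)
have := h (N + N)%N (leq_trans a (leq_addr _ _)).
by rewrite path_sum_concat// h1// => /eqP; rewrite subr_eq0 => /eqP.
Qed.

Lemma path_sum_cst (a : G) N : path_sum (fun=> a) N = 0.
Proof. by rewrite /path_sum big1. Qed.

(** The path f followed by a constant path has the endpoints of f, and its sum with 2N steps is the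
    sum of f with N steps. *)
Lemma path_sum_double (f : R -> G) : continuous f ->
  for_large (fun N => path_sum f (N + N) = path_sum f N).
Proof.
move=> cf.
have cc : continuous (fun _ : R => f 1) by move=> t; exact: cvg_cst.
have [||N0 h] := path_sum_homotopic (continuous_concat cf cc) cf.
- by rewrite concat_lo ?mul0rn//; lra.
- by rewrite concat_hi//; lra.
exists N0 => N NN; rewrite -h; last exact: leq_trans NN (leq_addr _ _).
by rewrite path_sum_concat// path_sum_cst addr0.
Qed.

(** The integral of w along f as an eventually constant value, so no limit of reals is taken. Powers
    of two are used because [path_sum_double] compares N with 2N only. *)
Definition path_lim (f : R -> G) (r : R) :=
  exists K, forall k, (K <= k)%N -> path_sum f (2 ^ k) = r.

Lemma for_large_pow (P : nat -> Prop) : for_large P -> exists K, forall k, (K <= k)%N -> P (2 ^ k)%N.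
Proof.
move=> [N h]; exists N => k Nk; apply: h.
exact: leq_ltn_trans Nk (ltn_expl _ _).
Qed.

Lemma path_lim_ex (f : R -> G) : continuous f -> exists r, path_lim f r.
Proof.
move=> /path_sum_double/for_large_pow[K h]; exists (path_sum f (2 ^ K)), K => k.
move=> /subnK <-; elim: (k - K)%N => // m IH.
by rewrite addSn expnS mul2n -addnn h ?IH// leq_addl.
Qed.

Lemma path_lim_uniq (f1 f2 : R -> G) r1 r2 : continuous f1 -> continuous f2 ->
  f1 0 = f2 0 -> f1 1 = f2 1 -> path_lim f1 r1 -> path_lim f2 r2 -> r1 = r2.
Proof.
move=> c1 c2 e0 e1 [K1 h1] [K2 h2].
have [K h] := for_large_pow (path_sum_homotopic c1 c2 e0 e1).
pose k := (maxn K (maxn K1 K2)).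
rewrite -(h1 k) -?(h2 k) ?h// /k !leq_max !leqnn ?orbT//.
Qed.

Lemma path_lim_concat f1 f2 r1 r2 : f1 1 = f2 0 ->
  path_lim f1 r1 -> path_lim f2 r2 -> path_lim (concat f1 f2) (r1 + r2).
Proof.
move=> e [K1 h1] [K2 h2]; exists (maxn K1 K2).+1 => -[//|k].
rewrite ltnS geq_max => /andP[/h1 <- /h2 <-].
by rewrite expnS mul2n -addnn path_sum_concat.
Qed.

Definition joined (u : G) := exists f : R -> G,
  [/\ continuous f, f 0 = 1%g, f 1 = u & forall t, V (f t)].

(** As f stays in V, every point g f(t) is close to g itself, and [w_closed] merges the steps one by
    one into the single edge from g to g f(1). *)
Lemma path_lim_joined (f : R -> G) g : continuous f -> f 0 = 1%g -> (forall t, V (f t)) ->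
  path_lim (fun t => g * f t)%g (w g (g * f 1%R)%g).
Proof.
move=> cf f0 Vf; have [K h] := for_large_pow (for_large_fine cf); exists K => k Kk.
have {}h := h k Kk.
set N := (2 ^ k)%N in h *; have N0 : (0 < N)%N by rewrite expn_gt0.
have NN : N%:R / N%:R = 1 :> R by rewrite divff// pnatr_eq0 -lt0n.
rewrite /path_sum -[in RHS]NN.
suff e j : (j <= N)%N ->
    \sum_(i < j) w (g * f (i%:R / N%:R)%R)%g (g * f (i.+1%:R / N%:R)%R)%g =
    w g (g * f (j%:R / N%:R)%R)%g by exact: e.
elim: j => [|j IH] jN; first by rewrite big_ord0 mul0r f0 mulg1 wxx.
rewrite big_ord_recr/= IH; last exact: ltnW.
have nb a b : near_by a b -> near_by (g * a)%g (g * b)%g.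
  by rewrite /near_by invgM -mulgA mulKg.
apply: w_closed.
- by rewrite /near_by mulKg.
- by apply: nb; apply: h; rewrite ?leqnSn ?leqnn// ltnW.
- by rewrite /near_by mulKg.
Qed.

(** gamma g is the integral of w along a chosen path from 1 to g. Extending this path by g f, with f
    in V, adds one value of w, and [path_lim_uniq] makes the choice of path irrelevant. *)
Lemma cochain_primitive : exists gamma : G -> R, gamma 1%g = 0 /\
  forall g u, joined u -> gamma (g * u)%g = gamma g + w g (g * u)%g.
Proof.
have pathP g : exists f : R -> G, [/\ continuous f, f 0 = 1%g & f 1 = g].
  have [f /is_path_clamp pf] := scG.1 1%g g.
  by exists (f \o clamp).
have [F FP] := choice pathP.
have limP g : exists r, path_lim (F g) r by have [cF _ _] := FP g; exact: path_lim_ex.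
have [gamma gP] := choice limP.
exists gamma; split.
  have [c1 e0 e1] := FP 1%g.
  have cc : continuous (fun _ : R => 1%g : G) by move=> t; exact: cvg_cst.
  apply: (path_lim_uniq c1 cc) => //; by exists 0%N => k _; exact: path_sum_cst.
move=> g u [f [cf f0 f1 Vf]]; rewrite -f1.
have [c1 e0 e1] := FP g; have [c2 e0' e1'] := FP (g * f 1%R)%g.
have cgf : continuous (fun t => g * f t)%g.
  by apply: continuous_mulg => // t; exact: cvg_cst.
have join : F g 1 = (g * f 0%R)%g by rewrite e1 f0 mulg1.
apply: (path_lim_uniq c2 (continuous_concat c1 cgf)) => //.
- by rewrite concat_lo ?mul0rn ?e0//; lra.
- by rewrite concat_hi// ?e1'; last lra; congr (_ * f _)%g; lra.
- exact: path_lim_concat (gP g) (path_lim_joined _ _ _ _).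
Qed.

(** Induction along a path from 1 to g: it is cut so finely that each increment is joined to 1
    inside V by the corresponding piece of the path. *)
Lemma joined_generates (P : G -> Prop) : P 1%g ->
  (forall g u, P g -> joined u -> P (g * u)%g) -> forall g, P g.
Proof.
move=> P1 PM g.
have [f /is_path_clamp[cf f0 f1]] := scG.1 1%g g.
set p := f \o clamp in cf f0 f1.
have [d d0 dV] := path_compact_fine cf V1.
have [N0 h] := for_large_gt d^-1.
pose N := N0.+1; have dN := h N (ltnSn _).
have NN : N%:R / N%:R = 1 :> R by rewrite divff// pnatr_eq0.
suff H i : (i <= N)%N -> P (p (i%:R / N%:R)) by rewrite -f1 -NN; exact: H.
elim: i => [|i IH] iN; first by rewrite mul0r f0.
rewrite -[p (i.+1%:R / _)](mulVKg (p (i%:R / N%:R))).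
apply: PM; first by apply: IH; exact: ltnW.
set x := i%:R / N%:R; set y := i.+1%:R / N%:R.
have xI : x \in `[0, 1] by apply: ratio_in; exact: ltnW.
have yI : y \in `[0, 1] by exact: ratio_in.
have xy : `|x - y| < d by apply: near_ord_fine; rewrite ?leqnSn ?leqnn.
exists (fun t => (p x)^-1 * p (x + clamp t * (y - x))%R)%g; split.
- apply: continuous_mulg; first by move=> t; exact: cvg_cst.
  move=> t; apply: cvg_comp; last exact: cf.
  apply: cvgD; first exact: cvg_cst.
  by apply: cvgM; [exact: continuous_clamp|exact: cvg_cst].
- by rewrite clamp_le0// mul0r addr0 mulVg.
- by rewrite clamp_ge1// mul1r addrC subrK.
- move=> t; have := @clamp_in R t; rewrite in_itv/= => /andP[c0 c1].
  move: xI yI; rewrite !in_itv/= => /andP[x0 x1] /andP[y0 y1].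
  apply: dV; rewrite ?in_itv/= ?x0 ?x1//.
    by apply/andP; split; nra.
  rewrite opprD addrA subrr sub0r normrN normrM (distrC y).
  by apply: le_lt_trans xy; rewrite (ger0_norm c0) ler_piMl.
Qed.
End Cochain.
Arguments joined R {G}.

(** A primitive gamma of C would satisfy gamma(a u) - gamma(a) = gamma(u) - C(a, u). Putting c0(u)
    for gamma(u) on the right prescribes the increments of gamma over nearby pairs; the cochain w of
    these increments is closed by the cocycle identity and the local hypothesis. *)
Theorem trivial_of_local (R : realType) (G : topologicalGroupType)
    (C : G -> G -> R) (U : set G) (c0 : G -> R) :
  simply_connected R G -> nbhs 1%g U ->
  (forall g h k, C g h + C (g * h)%g k = C g (h * k)%g + C h k) ->
  (forall u v, U u -> U v -> U (u * v)%g -> C u v = c0 u + c0 v - c0 (u * v)%g) ->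
  trivial_extension C.
Proof.
move=> scG U1 cocycle local.
pose V : set G := U `&` [set g | U g^-1%g].
have V1 : nbhs 1%g V.
  apply: filterI => //; rewrite -invg1 in U1.
  exact: (@invg_continuous G 1%g _ U1).
have Vsym g : V g -> V g^-1%g by move=> [a b]; split=> //=; rewrite invgK.
pose w a b := - C a (a^-1 * b)%g + c0 (a^-1 * b)%g.
have wcl a b c : V (a^-1 * b)%g -> V (b^-1 * c)%g -> V (a^-1 * c)%g ->
    w a b + w b c = w a c.
  move=> [ab _] [bc _] [ac _]; rewrite /w.
  have e : (a^-1 * c = (a^-1 * b) * (b^-1 * c))%g by rewrite -mulgA mulVKg.
  rewrite e in ac *; move: (local _ _ ab bc ac) (cocycle a (a^-1 * b)%g (b^-1 * c)%g).
  by rewrite mulVKg; lra.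
have [gamma [gamma1 gammaM]] := cochain_primitive V1 Vsym wcl scG.
(* The defect D is again a cocycle. It equals C(1, 1) when its second argument is joined to 1, hence
   always by [joined_generates]; since C is not normalised, this constant is finally added to
   gamma. *)
pose D g h := C g h - gamma g - gamma h + gamma (g * h)%g.
have Dcoc g h k : D g h + D (g * h)%g k = D g (h * k)%g + D h k.
  by rewrite /D; have := cocycle g h k; rewrite mulgA; lra.
have Du g u : joined R V u -> D g u = C 1%g 1%g.
  move=> Ju; have := gammaM 1%g u Ju; rewrite /D (gammaM g)// gamma1 /w !mulKg mul1g.
  have : C 1%g u = C 1%g 1%g by have := cocycle 1%g 1%g u; rewrite !mul1g; lra.
  lra.
have D1 g : D g 1%g = C 1%g 1%g.
  apply: Du; exists (fun=> 1%g); split=> //; first by move=> t; exact: cvg_cst.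
  by move=> _; exact: nbhs_singleton.
have DE h : forall g, D g h = C 1%g 1%g.
  move: h; apply: (joined_generates V1 scG) => // h u IH Ju g.
  by have := Dcoc g h u; rewrite IH (Du _ u Ju) (Du _ u Ju); lra.
exists (fun g => gamma g + C 1%g 1%g) => g h.
by have := DE h g; rewrite /D; lra.
Qed.

(** * Berezin's cocycle *)

Local Open Scope sesquilinear_scope.

(** * Hermitian norms and contractions on row vectors *)

Section Hermitian.
Variable C : numClosedFieldType.

Local Notation "''[' u , v ]" := (dotmx u v) : ring_scope.
Local Notation "''[' u ]" := '[u, u]%R : ring_scope.

Lemma dotmx_ge0 n (v : 'rV[C]_n) : 0 <= '[v].
Proof. exact: (dnorm_ge0 (@dotmx C n)). Qed.

Lemma dotmx_CS n (u v : 'rV[C]_n) : `|'[u, v]| ^+ 2 <= '[u] * '[v].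
Proof. by case: (CauchySchwarz (@dotmx C n) u v). Qed.

Lemma trmxC_mul m n p (A : 'M[C]_(m, n)) (B : 'M[C]_(n, p)) :
  (A *m B)^t* = B^t* *m A^t*.
Proof. by rewrite trmx_mul map_mxM. Qed.

Lemma trmxC_inv n (A : 'M[C]_n) : (invmx A)^t* = invmx (A^t*).
Proof. by rewrite trmx_inv map_invmx. Qed.

Lemma dotmx_adj m n (u : 'rV[C]_m) (v : 'rV[C]_n) (A : 'M[C]_(m, n)) :
  '[u *m A, v] = '[u, v *m A^t*].
Proof. by rewrite !dotmxE trmxC_mul trmxCK mulmxA. Qed.

Lemma dotmx_sum n (v : 'rV[C]_n) : '[v] = \sum_i `|v 0 i| ^+ 2.
Proof.
by rewrite dotmxE mxE; apply: eq_bigr => i _; rewrite !mxE normCK.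
Qed.

Definition frob2 m n (A : 'M[C]_(m, n)) : C := \sum_j \sum_i `|A i j| ^+ 2.

Lemma dotmx_frob m n (v : 'rV[C]_m) (A : 'M[C]_(m, n)) :
  '[v *m A] <= frob2 A * '[v].
Proof.
rewrite dotmx_sum /frob2 mulr_suml; apply: ler_sum => j _.
have -> : (v *m A) 0 j = '[v, (col j A)^t*].
  by rewrite dotmxE trmxCK !mxE; apply: eq_bigr => i _; rewrite !mxE.
apply: le_trans (dotmx_CS _ _) _; rewrite mulrC ler_wpM2r ?dotmx_ge0//.
by rewrite dotmx_sum; apply: ler_sum => i _; rewrite !mxE norm_conjC.
Qed.

(** Cauchy-Schwarz for the product of v with v A A^*, which is the squared norm of v A, followed by
    division by that squared norm. *)
Lemma contraction_adj m n (A : 'M[C]_(m, n)) :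
  (forall w, '[w *m A^t*] <= '[w]) -> forall v, '[v *m A] <= '[v].
Proof.
move=> h v; have [->|nz] := eqVneq ('[v *m A]) 0; first exact: dotmx_ge0.
have p : 0 < '[v *m A] by rewrite lt_neqAle eq_sym nz dotmx_ge0.
rewrite -(ler_pM2r p).
have e : '[v *m A] = '[v, v *m A *m A^t*] by rewrite dotmx_adj.
have cs := dotmx_CS v (v *m A *m A^t*).
rewrite -e (ger0_norm (dotmx_ge0 _)) expr2 in cs.
by apply: le_trans cs _; rewrite ler_wpM2l ?dotmx_ge0.
Qed.

End Hermitian.

(** * Block form of symplectic matrices over an abstract complex field *)

Section Phi.
Variables (R : realType) (C : numClosedFieldType) (phi : {rmorphism R -> C}).
Variable ii : C.
Hypothesis conj_phi : forall x, (phi x)^* = phi x.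
Hypothesis conj_ii : ii^* = - ii.
Hypothesis ii2 : ii * ii = -1.
Local Notation "''[' u , v ]" := (dotmx u v) : ring_scope.
Local Notation "''[' u ]" := '[u, u]%R : ring_scope.

Variable n : nat.

Definition gen_J : 'M[C]_(n + n) :=
  (phi (Num.sqrt 2))^-1 *: block_mx 1%:M ii%:M ii%:M 1%:M.
Definition gen_conj (g : 'M[R]_(n + n)) : 'M[C]_(n + n) :=
  invmx gen_J *m map_mx phi g *m gen_J.
Definition gen_Phi (g : 'M[R]_(n + n)) : 'M[C]_n := ulsubmx (gen_conj g).
Definition gen_Psi (g : 'M[R]_(n + n)) : 'M[C]_n := ursubmx (gen_conj g).
Definition gen_Om (g : 'M[R]_(n + n)) : 'M[C]_n := dlsubmx (gen_conj g).

Definition symplectic (g : 'M[R]_(n + n)) :=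
  g^T *m symp_form R n *m g = symp_form R n.

Definition Dmx : 'M[C]_(n + n) := block_mx 1%:M 0 0 (- 1%:M).

Local Notation c0 := ((phi (Num.sqrt 2))^-1).

Lemma c0_sqr : c0 * c0 = 2^-1.
Proof. by rewrite -invfM -rmorphM -expr2 sqr_sqrtr// rmorph_nat. Qed.

Lemma gen_J_adj : gen_J^t* = c0 *: block_mx 1%:M (- ii)%:M (- ii)%:M 1%:M.
Proof.
rewrite /gen_J linearZ/= map_mxZ; congr (_ *: _).
  by rewrite fmorphV /= conj_phi.
rewrite tr_block_mx map_block_mx !tr_scalar_mx !map_scalar_mx.
by rewrite /= conj_ii rmorph1.
Qed.

Lemma half2 : 2^-1 * (1 + 1) = 1 :> C.
Proof. by rewrite mulVf// (pnatr_eq0 C 2). Qed.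

Lemma half2D (x : C) : 2^-1 * (x + x) = x.
Proof. by rewrite -[x in LHS]mul1r -mulrDl mulrA half2 mul1r. Qed.

Lemma gen_J_unitary : gen_J \is unitarymx.
Proof.
apply/unitarymxP; rewrite gen_J_adj /gen_J -scalemxAl -scalemxAr scalerA c0_sqr.
rewrite mulmx_block !mul1mx !mulmx1 -!scalar_mxM !mulrN ii2 opprK.
rewrite -!raddfD/= addNr subrr raddf0 -[1 + 1]mulr1 -!scalar_mx_block.
by rewrite scale_scalar_mx mulr1 half2.
Qed.

(** Conjugation by J thus carries Sp(2n, R) into the pseudo-unitary group U(n, n) of the form [Dmx];
    the relations between the blocks come from there. *)
Lemma gen_J_symp_form :
  gen_J^t* *m map_mx phi (symp_form R n) *m gen_J = ii *: Dmx.
Proof.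
have -> : map_mx phi (symp_form R n) = block_mx 0 1%:M (- 1%:M) 0.
  by rewrite /symp_form map_block_mx !raddf0 map_mxN map_mx1.
rewrite gen_J_adj /gen_J -!scalemxAl -scalemxAr scalerA c0_sqr.
rewrite !mulmx_block !(mul1mx, mulmx1, mulmx0, mul0mx, add0r, addr0).
rewrite !mulmxN !(mul1mx, mulmx1) -!raddfN/= !opprK -!scalar_mxM -!raddfD/=.
rewrite !mulNr !mul1r ii2 !opprK addNr raddf0 scale_block_mx !scaler0.
rewrite /Dmx scale_block_mx !scaler0 scalerN !scale_scalar_mx -raddfN/=.
by congr (block_mx _%:M _ _ _%:M); rewrite mulr1 half2D.
Qed.

Lemma Dmx2 : Dmx *m Dmx = 1%:M.
Proof.
rewrite /Dmx mulmx_block !(mulmx0, mul0mx, addr0, add0r) mulmx1 mulmxN mulmx1.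
by rewrite opprK -scalar_mx_block.
Qed.

Lemma gen_conjM g1 g2 : gen_conj (g1 *m g2) = gen_conj g1 *m gen_conj g2.
Proof.
have Ju : gen_J \in unitmx by apply: unitarymx_unit; exact: gen_J_unitary.
by rewrite /gen_conj map_mxM -!mulmxA; congr (_ *m (_ *m _)); rewrite mulKVmx.
Qed.

Lemma gen_PhiM g1 g2 :
  gen_Phi (g1 *m g2) = gen_Phi g1 *m gen_Phi g2 + gen_Psi g1 *m gen_Om g2.
Proof.
rewrite /gen_Phi gen_conjM -[gen_conj g1]submxK -[gen_conj g2]submxK.
by rewrite mulmx_block !block_mxKul.
Qed.

Lemma gen_conj_adj g : symplectic g ->
  (gen_conj g)^t* *m Dmx *m gen_conj g = Dmx.
Proof.
move=> sg; have ii0 : ii != 0.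
  by apply: contra_eq_neq ii2 => ->; rewrite mul0r eq_sym oppr_eq0 oner_eq0.
have JU := gen_J_unitary.
apply: (scalerI ii0); rewrite scalemxAl scalemxAr -gen_J_symp_form.
rewrite /gen_conj invmx_unitary// !trmxC_mul trmxCK -!mulmxA.
rewrite !(mulmxA gen_J) (unitarymxP JU) !mul1mx.
congr (_ *m _); rewrite !mulmxA; congr (_ *m _).
rewrite -[symp_form R n in RHS]sg !map_mxM.
congr (_ *m _ *m _); apply/matrixP => i j; by rewrite !mxE conj_phi.
Qed.

(** U(n, n) is closed under adjoints: h^* is a left inverse of D h D, hence also a right inverse. *)
Lemma gen_conj_adjr g : symplectic g ->
  gen_conj g *m Dmx *m (gen_conj g)^t* = Dmx.
Proof.
move=> /gen_conj_adj; move: (gen_conj g) => h e.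
have : h^t* *m (Dmx *m h *m Dmx) = 1%:M.
  by rewrite !mulmxA e Dmx2.
move=> /mulmx1C; rewrite -!mulmxA => /(congr1 (mulmx Dmx)).
by rewrite (mulmxA Dmx Dmx) Dmx2 mul1mx mulmx1.
Qed.

Lemma gen_Phi_row g : symplectic g ->
  gen_Phi g *m (gen_Phi g)^t* = 1%:M + gen_Psi g *m (gen_Psi g)^t*.
Proof.
move=> /gen_conj_adjr; rewrite -{1 2}[gen_conj g]submxK.
rewrite tr_block_mx map_block_mx /Dmx !mulmx_block.
rewrite !(mulmx0, mul0mx, mulmx1, addr0, add0r) mulmxN mulmx1.
by move=> /eq_block_mx[+ _ _ _]; rewrite mulNmx => <-; rewrite subrK.
Qed.

Lemma gen_Phi_col g : symplectic g ->
  (gen_Phi g)^t* *m gen_Phi g = 1%:M + (gen_Om g)^t* *m gen_Om g.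
Proof.
move=> /gen_conj_adj; rewrite -{1 2}[gen_conj g]submxK.
rewrite tr_block_mx map_block_mx /Dmx !mulmx_block.
rewrite !(mulmx0, mul0mx, mulmx1, addr0, add0r) mulmxN mulmx1.
by move=> /eq_block_mx[+ _ _ _]; rewrite mulNmx => <-; rewrite subrK.
Qed.

Lemma gen_Phi_row_norm g (y : 'rV[C]_n) : symplectic g ->
  '[y *m gen_Phi g] = '[y] + '[y *m gen_Psi g].
Proof.
move=> /gen_Phi_row e; rewrite !dotmxE !trmxC_mul !mulmxA.
rewrite -(mulmxA y) e mulmxDr mulmx1 mulmxDl mxE; congr (_ + _).
by rewrite !mulmxA.
Qed.

Lemma gen_Phi_col_norm g (y : 'rV[C]_n) : symplectic g ->
  '[y *m (gen_Phi g)^t*] = '[y] + '[y *m (gen_Om g)^t*].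
Proof.
move=> /gen_Phi_col e; rewrite !dotmxE !trmxC_mul !trmxCK !mulmxA.
rewrite -(mulmxA y) e mulmxDr mulmx1 mulmxDl mxE; congr (_ + _).
by rewrite !mulmxA.
Qed.

Lemma gen_Phi_unit g : symplectic g -> gen_Phi g \in unitmx.
Proof.
move=> sg; rewrite -row_free_unit; apply: inj_row_free => v v0.
have := gen_Phi_row_norm v sg.
rewrite v0 dotmxE mul0mx mxE => /esym/eqP; rewrite paddr_eq0 ?dotmx_ge0//.
by move=> /andP[+ _]; rewrite (dnorm_eq0 (@dotmx C n)) => /eqP.
Qed.

Definition gen_Z g1 g2 :=
  invmx (gen_Phi g1) *m gen_Psi g1 *m (gen_Om g2 *m invmx (gen_Phi g2)).

Lemma gen_W g1 g2 : symplectic g1 -> symplectic g2 ->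
  invmx (gen_Phi g1) *m gen_Phi (g1 *m g2) *m invmx (gen_Phi g2) =
  1%:M + gen_Z g1 g2.
Proof.
move=> s1 s2; rewrite gen_PhiM mulmxDr mulmxDl mulKmx ?gen_Phi_unit//.
by rewrite mulmxV ?gen_Phi_unit// /gen_Z !mulmxA.
Qed.

(** The right factor Om Phi^-1 of Z is a contraction because its adjoint is one, by
    [gen_Phi_col_norm]. For the left factor write v = y Phi(g1): then y Psi(g1) has squared norm
    |v|^2 - |y|^2, and |v|^2 <= M |y|^2. The bound depends on g1 only through M and not on g2, which
    later gives uniform convergence. *)
Lemma gen_Z_contraction g1 g2 (M : C) : symplectic g1 -> symplectic g2 ->
  frob2 (gen_Phi g1) <= M -> 1 <= M ->
  forall v, '[v *m gen_Z g1 g2] <= (1 - M^-1) * '[v].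
Proof.
move=> s1 s2 hM M1 v; have u1 := gen_Phi_unit s1; have u2 := gen_Phi_unit s2.
have M0 : 0 < M by apply: lt_le_trans M1.
rewrite /gen_Z mulmxA; apply: le_trans (contraction_adj _ _) _.
  move=> w; rewrite trmxC_mul trmxC_inv.
  have uP : (gen_Phi g2)^t* \in unitmx by rewrite map_unitmx unitmx_tr.
  rewrite -[w in leRHS](mulmxKV uP) mulmxA gen_Phi_col_norm//.
  by rewrite lerDr dotmx_ge0.
rewrite mulmxA; set y := v *m invmx (gen_Phi g1).
have vE : v = y *m gen_Phi g1 by rewrite mulmxKV.
have h := gen_Phi_row_norm y s1; rewrite -vE in h.
have -> : '[y *m gen_Psi g1] = '[v] - '[y] by rewrite h addrAC subrr add0r.
rewrite mulrBl mul1r lerD2l lerN2 ler_pdivrMl// [in leLHS]vE.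
by apply: le_trans (dotmx_frob _ _) _; rewrite ler_wpM2r ?dotmx_ge0.
Qed.

Lemma contraction_entry m (Z : 'M[C]_m) (r : C) : 0 <= r ->
  (forall v, '[v *m Z] <= r * '[v]) ->
  forall k i j, `|(Z ^+ k : 'M[C]_m) i j| ^+ 2 <= r ^+ k.
Proof.
move=> r0 h k i j; set A := (Z ^+ k : 'M[C]_m).
have hk (v : 'rV_m) : '[v *m A] <= r ^+ k * '[v].
  rewrite /A; elim: k {A} => [|k IH]; first by rewrite expr0 mulmx1 mul1r.
  rewrite exprSr [_ * Z]/(_ *m Z) mulmxA (le_trans (h _))// exprS -mulrA.
  by rewrite ler_wpM2l.
have := hk (delta_mx 0 i).
have -> : '[delta_mx 0 i : 'rV[C]_m] = 1.
  rewrite dotmx_sum (bigD1 i)//= big1 ?addr0; last first.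
    by move=> l /negbTE li; rewrite mxE li andbF normr0 expr0n.
  by rewrite mxE !eqxx/= normr1 expr1n.
rewrite -rowE dotmx_sum mulr1; apply: le_trans.
rewrite (bigD1 j)//= mxE lerDl; apply: sumr_ge0 => l _.
exact: exprn_ge0.
Qed.

End Phi.

(** * Eigenvalues of a contraction *)

Section Eigen.
Variable C : numClosedFieldType.
Local Notation "''[' u , v ]" := (dotmx u v) : ring_scope.
Local Notation "''[' u ]" := '[u, u]%R : ring_scope.

Lemma mul_mxE m (A B : 'M[C]_m) : A * B = A *m B. Proof. by []. Qed.

Lemma trig_exp m (T : 'M[C]_m) : is_trig_mx T ->
  forall k, is_trig_mx (T ^+ k : 'M[C]_m) /\ forall i, (T ^+ k : 'M[C]_m) i i = T i i ^+ k.
Proof.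
move=> /is_trig_mxP tT; elim=> [|k [/is_trig_mxP IH IHd]].
  by rewrite expr0; split=> [|i]; [exact: scalar_mx_is_trig|rewrite mxE eqxx].
rewrite exprS mul_mxE; split.
  apply/is_trig_mxP => i j ij; rewrite mxE big1// => l _.
  have [il|li] := ltnP i l; first by rewrite tT// mul0r.
  by rewrite IH ?mulr0//; exact: leq_ltn_trans ij.
move=> i; rewrite mxE (bigD1 i)//= big1 ?addr0 ?IHd ?exprS// => l li.
have [il|il] := ltnP i l; first by rewrite tT// mul0r.
by rewrite IH ?mulr0// ltn_neqAle il andbT.
Qed.

(** In a unitary triangularisation the diagonal entries are Rayleigh quotients of Z, so they inherit
    the bound. Traces of powers and the determinant then reduce the matrix logarithm to scalar
    ones. *)
Lemma schur_eigen m (Z : 'M[C]_m) (r : C) : 0 <= r ->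
  (forall v, '[v *m Z] <= r * '[v]) ->
  exists l : 'I_m -> C, [/\ forall i, `|l i| ^+ 2 <= r,
    forall k, \tr (Z ^+ k : 'M[C]_m) = \sum_i l i ^+ k &
    \det (1%:M + Z) = \prod_i (1 + l i)].
Proof.
move=> r0 hZ; have [m0|m0] := posnP m.
  move: Z hZ; rewrite m0 => Z _; exists (fun=> 0); split.
  - by case.
  - by move=> k; rewrite /mxtrace !big_ord0.
  - by rewrite det_mx00 big_ord0.
have [P PU] := Schur Z m0; rewrite /similar_to/= conjymx// => tT.
set T := P *m Z *m P^t* in tT.
have PP : P^t* *m P = 1%:M by apply: mulmx1C; exact/unitarymxP.
have TE k : (T ^+ k : 'M[C]_m) = P *m (Z ^+ k : 'M[C]_m) *m P^t*.
  elim: k => [|k IH]; first by rewrite !expr0 mulmx1; apply/esym/unitarymxP.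
  rewrite !exprSr IH !mul_mxE /T !mulmxA -(mulmxA _ (P^t*) P) PP mulmx1.
  by rewrite -!mulmxA.
exists (fun i => T i i); split.
- move=> i; have -> : T i i = '[row i P *m Z, row i P].
    rewrite dotmxE -row_mul /T !mxE; apply: eq_bigr => j _.
    by rewrite !mxE.
  have nP : '[row i P] = 1 by have /row_unitarymxP/(_ i i) := PU; rewrite eqxx.
  apply: le_trans (dotmx_CS _ _) _; rewrite nP mulr1.
  by apply: le_trans (hZ _) _; rewrite nP mulr1.
- move=> k; have [_ d] := trig_exp tT k.
  transitivity (\tr (T ^+ k : 'M[C]_m)).
    by rewrite TE mxtrace_mulC mulmxA PP mul1mx.
  by apply: eq_bigr => i _; exact: d.
- have -> : \det (1%:M + Z) = \det (1%:M + T).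
    have -> : 1%:M + T = P *m (1%:M + Z) *m P^t*.
      by rewrite mulmxDr mulmx1 mulmxDl; congr (_ + _); apply/esym/unitarymxP.
    by rewrite !det_mulmx mulrAC -det_mulmx (unitarymxP PU) det1 mul1r.
  rewrite det_trig; first by apply: eq_bigr => i _; rewrite !mxE eqxx.
  apply/is_trig_mxP => i j ij; move/is_trig_mxP : tT => /(_ _ _ ij).
  rewrite !mxE => ->; rewrite addr0; case: eqVneq => // e.
  by rewrite e ltnn in ij.
Qed.
End Eigen.

(** * The scalar logarithm and arguments of complex numbers *)

Section Scalar.
Variable R : realType.
Local Notation C := (cplx R).

Implicit Types z w : C.

HB.instance Definition _ := GRing.isZmodMorphism.Build R C (@of_real R)
  (@real_complex_is_additive R).

Lemma of_real_is_monoid_morphism : GRing.monoid_morphism (@of_real R).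
Proof. by have [hM h1] := @real_complex_is_multiplicative R; split. Qed.

HB.instance Definition _ := GRing.isMonoidMorphism.Build R C (@of_real R)
  of_real_is_monoid_morphism.

Definition Re_part (z : C) : R := complex.Re (z : R[i]).
(** The modulus as a real number; the norm of [cplx R] takes its values in [cplx R] itself. *)
Definition cabs (z : C) : R := Normc.normc (z : R[i]).

Lemma norm_cabs (z : C) : `|z| = of_real (cabs z). Proof. by []. Qed.

Lemma cabs_ge0 z : 0 <= cabs z.
Proof. by case: z => a b; exact: sqrtr_ge0. Qed.

Lemma cabsM z w : cabs (z * w) = cabs z * cabs w.
Proof. exact: Normc.normcM. Qed.

Lemma cabsD z w : cabs (z + w) <= cabs z + cabs w.
Proof. exact: le_normcD. Qed.

Lemma cabsN z : cabs (- z) = cabs z.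
Proof. exact: normcN. Qed.

Lemma cabs1 : cabs 1 = 1.
Proof. exact: Normc.normc1. Qed.

Lemma cabsV z : cabs z^-1 = (cabs z)^-1.
Proof. exact: Normc.normcV. Qed.

Lemma cabsX z k : cabs (z ^+ k) = cabs z ^+ k.
Proof. by elim: k => [|k IH]; rewrite ?expr0 ?cabs1// !exprS cabsM IH. Qed.

Lemma cabs_of_real x : cabs (of_real x) = `|x|.
Proof. by rewrite /cabs /= expr0n addr0 sqrtr_sqr. Qed.

Lemma Im_le_cabs z : `|Im_part z| <= cabs z.
Proof.
by case: z => a b; rewrite /Im_part /cabs /= -sqrtr_sqr ler_wsqrtr// lerDr sqr_ge0.
Qed.

Lemma Re_le_cabs z : `|Re_part z| <= cabs z.
Proof.
by case: z => a b; rewrite /Re_part /cabs /= -sqrtr_sqr ler_wsqrtr// lerDl sqr_ge0.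
Qed.

Lemma Im_partD z w : Im_part (z + w) = Im_part z + Im_part w.
Proof. by case: z w => a b [c d]. Qed.

Lemma Re_partD z w : Re_part (z + w) = Re_part z + Re_part w.
Proof. by case: z w => a b [c d]. Qed.

Lemma Im_partB z w : Im_part (z - w) = Im_part z - Im_part w.
Proof. by case: z w => a b [c d]. Qed.

Lemma Re_partB z w : Re_part (z - w) = Re_part z - Re_part w.
Proof. by case: z w => a b [c d]. Qed.

Lemma Im_part_sum I (s : seq I) (P : pred I) (f : I -> C) :
  Im_part (\sum_(i <- s | P i) f i) = \sum_(i <- s | P i) Im_part (f i).
Proof. exact: (big_morph _ Im_partD erefl). Qed.

Lemma Im_part_scale x z : Im_part (of_real x * z) = x * Im_part z.
Proof. by case: z => a b; rewrite /Im_part /= mul0r addr0. Qed.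

Lemma complex_parts z : z = of_real (Re_part z) + imag_unit R * of_real (Im_part z).
Proof. exact: (complexE z). Qed.

Lemma sum_geom (q : C) N : (1 - q) * (\sum_(k < N) q ^+ k) = 1 - q ^+ N.
Proof. by rewrite -opprB -[RHS]opprB subrX1 mulNr. Qed.

(** With q = - s z the two terms are the imaginary parts of z times a partial geometric sum in q and
    of z / (1 - q); they differ by the imaginary part of z q^N / (1 - q). These are the derivatives
    in s of the two terms of [log_partial] taken at s z. *)
Lemma Im_geom (z : C) (s rho : R) N : cabs z <= rho -> rho < 1 -> 0 <= s <= 1 ->
  `|\sum_(k < N) ((-1) ^+ k * Im_part (z ^+ k.+1)) * s ^+ k -
    Im_part z / ((1 + s * Re_part z) ^+ 2 + (s * Im_part z) ^+ 2)|
  <= rho ^+ N.+1 / (1 - rho).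
Proof.
move=> zr r1 /andP[s0 s1].
set q := - (of_real s * z).
have cq : cabs q <= rho.
  rewrite /q cabsN cabsM cabs_of_real ger0_norm//.
  by apply: le_trans zr; rewrite ler_piMl ?cabs_ge0.
have c1q : 1 - rho <= cabs (1 - q).
  rewrite lerBlDr -[X in X <= _]cabs1 -{1}(subrK q 1).
  by apply: le_trans (cabsD _ _) _; rewrite lerD2l.
have q1 : 1 - q != 0.
  apply/eqP => e; move: c1q; rewrite e (_ : 0 = of_real 0)// cabs_of_real normr0.
  by rewrite subr_le0 leNgt r1.
have SE : \sum_(k < N) ((-1) ^+ k * Im_part (z ^+ k.+1)) * s ^+ k =
    Im_part (z * \sum_(k < N) q ^+ k).
  rewrite mulr_sumr Im_part_sum; apply: eq_bigr => k _.
  have -> : q ^+ k = of_real ((-1) ^+ k * s ^+ k) * z ^+ k.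
    by rewrite /q -[- _]mulN1r !exprMn rmorphM !rmorphXn rmorphN1 mulrA.
  by rewrite mulrCA Im_part_scale -exprS; ring.
have dE : Im_part z / ((1 + s * Re_part z) ^+ 2 + (s * Im_part z) ^+ 2) =
    Im_part (z * (1 - q)^-1).
  rewrite /q opprK; case: (z) => a b; rewrite /Im_part /Re_part /=.
  rewrite !mul0r !subr0 !addr0 add0r.
  ring.
rewrite SE dE -Im_partB -mulrBr.
have -> : \sum_(k < N) q ^+ k - (1 - q)^-1 = - (q ^+ N / (1 - q)).
  apply: (mulfI q1); rewrite mulrBr sum_geom divff// mulrN mulrCA divff// mulr1.
  by rewrite addrAC subrr add0r.
apply: le_trans (Im_le_cabs _) _.
rewrite cabsM cabsN cabsM cabsV cabsX exprS -mulrA.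
have r0 : 0 <= rho by apply: le_trans zr; exact: cabs_ge0.
apply: ler_pM => //; rewrite ?cabs_ge0//.
  by rewrite divr_ge0 ?exprn_ge0 ?cabs_ge0.
apply: ler_pM; rewrite ?exprn_ge0 ?invr_ge0 ?cabs_ge0//.
  by rewrite lerXn2r ?nnegrE ?cabs_ge0.
by rewrite lef_pV2// posrE ?subr_gt0//; apply: lt_le_trans c1q; rewrite subr_gt0.
Qed.

Lemma is_derive_aff (a b s : R) : is_derive s (1 : R) (fun t : R => a + t * b) b.
Proof.
have -> : (fun t : R => a + t * b) = cst a + b \*: id.
  by apply/funext => t; rewrite fctE mulrC.
by apply: is_derive_eq; rewrite add0r /GRing.scale/= mulr1.
Qed.

(** Replace z by s z: at s = 0 both terms vanish, [Im_geom] bounds the difference of their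
    derivatives in s, and the mean value theorem on [0, 1] concludes. The [atan] is the principal
    argument of 1 + z, whose real part is positive. *)
Lemma log_partial (z : C) (rho : R) N : cabs z <= rho -> rho < 1 ->
  `|\sum_(k < N) (-1) ^+ k / k.+1%:R * Im_part (z ^+ k.+1) -
    atan (Im_part z / (1 + Re_part z))| <= rho ^+ N.+1 / (1 - rho).
Proof.
move=> zr r1; set x := Re_part z; set y := Im_part z.
have x1 : `|x| < 1 by apply: le_lt_trans r1; apply: le_trans zr; exact: Re_le_cabs.
pose f (k : nat) (s : R) := (-1) ^+ k / k.+1%:R * Im_part (z ^+ k.+1) * s ^+ k.+1.
pose df (k : nat) (s : R) := ((-1) ^+ k * Im_part (z ^+ k.+1)) * s ^+ k.
pose A (s : R) := atan (s * y / (1 + s * x)).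
pose dA (s : R) := y / ((1 + s * x) ^+ 2 + (s * y) ^+ 2).
have pos (s : R) : 0 <= s <= 1 -> 0 < 1 + s * x.
  move=> /andP[s0 s1]; move: x1; rewrite ltr_norml => /andP[h _].
  have [x0|x0] := leP 0 x; first by have := mulr_ge0 s0 x0; lra.
  have s1' : 0 <= 1 - s by lra.
  have x0' : 0 <= - x by lra.
  by have := mulr_ge0 s1' x0'; lra.
have dfE (k : nat) (s : R) : is_derive s (1 : R) (f k) (df k s).
  have h : is_derive s (1 : R) (fun s : R => s ^+ k.+1) (k.+1%:R * s ^+ k).
    have -> : (fun s : R => s ^+ k.+1) = (@id R) ^+ k.+1.
      by apply/funext => t; rewrite exprfctE.
    by apply: is_derive_eq; rewrite /GRing.scale/= mulr1.
  pose c := (-1) ^+ k / k.+1%:R * Im_part (z ^+ k.+1).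
  have -> : f k = c \*: (fun s : R => s ^+ k.+1) by apply/funext => t.
  apply: is_derive_eq; rewrite /df /c /GRing.scale/=.
  by field; rewrite addrC natr1 pnatr_eq0.
have dAE (s : R) : 0 <= s <= 1 -> is_derive s (1 : R) A (dA s).
  move=> /pos p.
  have h1 := is_derive_aff 0 y s; have h2 := is_derive_aff 1 x s.
  have h3 := is_deriveM h1 (@is_deriveV R (fun t => 1 + t * x) s x 1 (lt0r_neq0 p) h2).
  have -> : A = atan \o ((fun t => 0 + t * y) * (fun t => (1 + t * x)^-1)).
    by apply/funext => t; rewrite /A /= mulrfctE add0r.
  apply: is_derive_eq.
  rewrite /dA /GRing.scale/= mulrfctE !add0r.
  have p2 : (1 + s * x) ^+ 2 + (s * y) ^+ 2 != 0.
    by rewrite gt_eqF// ltr_pwDl ?sqr_ge0// exprn_gt0.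
  by field; rewrite p2 gt_eqF.
pose G s := \sum_(k < N) f k s - A s.
pose dG s := \sum_(k < N) df k s - dA s.
have dGE (s : R) : 0 <= s <= 1 -> is_derive s (1 : R) G (dG s).
  move=> s01.
  have -> : G = (\sum_(k < N) f k) - A by apply/funext => t; rewrite /G fctE fct_sumE.
  by have hA := dAE s s01; exact: is_deriveB.
have [||c c01 cE] := @MVT_segment R G dG 0 1 ler01.
- by move=> s; rewrite in_itv/= => /andP[/ltW s0 /ltW s1]; apply: dGE; rewrite s0.
- apply: derivable_within_continuous => s; rewrite in_itv/= => s01.
  by have [] := dGE s s01.
rewrite in_itv/= in c01.
have G0 : G 0 = 0.
  by rewrite /G /A mul0r mul0r atan0 subr0 big1// => k _; rewrite /f expr0n mulr0.
have G1 : G 1 = \sum_(k < N) (-1) ^+ k / k.+1%:R * Im_part (z ^+ k.+1) - atan (y / (1 + x)).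
  by rewrite /G /A !mul1r; congr (_ - _); apply: eq_bigr => k _; rewrite /f expr1n mulr1.
rewrite -G1 -[G 1]subr0 -G0 cE subr0 mulr1.
exact: Im_geom.
Qed.

Definition cis (a : R) : C := Complex (cos a) (sin a).

Lemma cisD a b : cis (a + b) = cis a * cis b.
Proof. by apply/eqP; rewrite eq_complex /= cosD sinD eqxx /= addrC mulrC eqxx. Qed.

(** Being an argument is a relation, so that no branch is chosen and products cause no jumps;
    [argp_cos] expresses uniqueness modulo 2 pi. *)
Definition argp z (a : R) := exists2 m : R, 0 < m & z = of_real m * cis a.

Lemma argpM z w a b : argp z a -> argp w b -> argp (z * w) (a + b).
Proof.
move=> [m m0 ->] [k k0 ->]; exists (m * k); first exact: mulr_gt0.
by rewrite rmorphM cisD mulrACA.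
Qed.

Lemma argp1 : argp 1 0.
Proof.
exists 1 => //; rewrite /cis cos0 sin0 rmorph1 mul1r.
by apply/eqP; rewrite eq_complex /= !eqxx.
Qed.

Lemma cis_neq0 a : cis a != 0.
Proof.
rewrite eq_complex /=; apply/negP => /andP[/eqP c /eqP d].
by have := cos2Dsin2 a; rewrite c d expr0n addr0 => /eqP; rewrite eq_sym oner_eq0.
Qed.

Lemma argp_neq0 z a : argp z a -> z != 0.
Proof.
move=> [m m0 ->]; rewrite mulf_neq0 ?cis_neq0//.
by rewrite fmorph_eq0 gt_eqF.
Qed.

Lemma argpV z a : argp z a -> argp z^-1 (- a).
Proof.
move=> [m m0 ->]; exists m^-1; first by rewrite invr_gt0.
rewrite invfM fmorphV; congr (_ * _).
apply: (mulfI (cis_neq0 a)); rewrite divff ?cis_neq0// -cisD subrr /cis cos0 sin0.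
by apply/eqP; rewrite eq_complex /= !eqxx.
Qed.

Lemma argp_cos z a b : argp z a -> argp z b -> cos (a - b) = 1.
Proof.
move=> ha hb; have := argpM ha (argpV hb); rewrite divff ?(argp_neq0 ha)//.
move=> [m m0 /eqP]; rewrite eq_complex /= !mul0r subr0 addr0 => /andP[/eqP hc /eqP hs].
have s0 : sin (a - b) = 0.
  by apply/eqP; move/esym/eqP: hs; rewrite mulf_eq0 gt_eqF.
have := cos2Dsin2 (a - b); rewrite s0 expr0n addr0 => /eqP.
rewrite sqrf_eq1 => /orP[/eqP//|/eqP e].
by move: hc m0; rewrite e mulrN1 => h; rewrite -oppr_lt0 -h ltr10.
Qed.

Lemma argp_prod I (s : seq I) (P : pred I) (f : I -> C) (a : I -> R) :
  (forall i, P i -> argp (f i) (a i)) ->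
  argp (\prod_(i <- s | P i) f i) (\sum_(i <- s | P i) a i).
Proof.
move=> h; elim: s => [|i s IH]; first by rewrite !big_nil; exact: argp1.
by rewrite !big_cons; case: ifP => // Pi; apply: argpM => //; exact: h.
Qed.

Lemma argp_atan z : 0 < Re_part z -> argp z (atan (Im_part z / Re_part z)).
Proof.
move=> p; set t := _ / _; set al := atan t.
have [/andP[l u] tE] := atan_def t.
have c0 : 0 < cos al by apply: cos_gt0_pihalf; rewrite l.
have sE : sin al = t * cos al by rewrite -[in RHS]tE -/al /tan divfK// gt_eqF.
exists (Re_part z / cos al); first exact: divr_gt0.
apply/eqP; rewrite eq_complex /= sE !mul0r subr0 addr0.
rewrite /Re_part/= in p *.
apply/andP; split; apply/eqP; rewrite /t /Im_part /Re_part; field.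
  by rewrite gt_eqF.
by rewrite !gt_eqF.
Qed.

Lemma argp_1D z : cabs z < 1 -> argp (1 + z) (atan (Im_part z / (1 + Re_part z))).
Proof.
move=> z1; have := @argp_atan (1 + z).
rewrite Re_partD Im_partD (_ : Re_part 1 = 1)// (_ : Im_part 1 = 0)// add0r.
apply.
have := le_lt_trans (Re_le_cabs z) z1; rewrite ltr_norml => /andP[h _]; lra.
Qed.

Lemma cos_eq1_small (a : R) : cos a = 1 -> `|a| < pi *+ 2 -> a = 0.
Proof.
wlog a0 : a / 0 <= a => [h c n|].
  have [/h|/ltW] := leP 0 a; first exact.
  rewrite -oppr_ge0 => /h; rewrite cosN normrN => /(_ c n)/eqP.
  by rewrite oppr_eq0 => /eqP.
move=> c; rewrite ger0_norm// => ap; apply/eqP/negPn/negP => an0.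
have agt : 0 < a by rewrite lt_neqAle eq_sym an0.
have s : 0 < sin (a / 2) by apply: sin_gt0_pi; rewrite divr_gt0//= ltr_pdivrMr// mulr_natr.
have := cosD (a / 2) (a / 2); rewrite -splitr c -!expr2 cos2sin2 => e.
have : sin (a / 2) ^+ 2 = 0 by lra.
by move/eqP; rewrite sqrf_eq0 gt_eqF.
Qed.
End Scalar.

(** * Entrywise convergence of matrices *)

Section MatrixCvg.
Context {T : Type} {F : set_system T} {FF : Filter F}.

Lemma cvg_mx (U : topologicalType) m n (f : T -> 'M[U]_(m, n)) (l : 'M[U]_(m, n)) :
  (forall i j, (fun t => f t i j) @ F --> l i j) -> f @ F --> l.
Proof.
move=> h A [P Pl PA]; apply: (@filterS _ _ _ _ _ PA) => /=.
have : \forall t \near F, forall i j, P i j (f t i j).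
  by apply: filter_forall => i; apply: filter_forall => j; exact: h.
exact.
Qed.

Variable K : numFieldType.

Definition mcvg m n (f : T -> 'M[K]_(m, n)) (l : 'M[K]_(m, n)) :=
  forall i j, (fun t => f t i j) @ F --> l i j.

Lemma cvg_mcvg m n (f : T -> 'M[K]_(m, n)) (l : 'M[K]_(m, n)) :
  f @ F --> l -> mcvg f l.
Proof.
move=> h i j; apply: (@cvg_comp _ _ _ f (fun M : 'M[K]_(m, n) => M i j) _ _ _ h).
exact: coord_continuous.
Qed.

Lemma cvg_fsum I (s : seq I) (P : pred I) (f : I -> T -> K) (l : I -> K) :
  (forall i, P i -> f i @ F --> l i) ->
  (fun t => \sum_(i <- s | P i) f i t) @ F --> \sum_(i <- s | P i) l i.
Proof. by move=> h; apply: cvg_big => //; exact: add_continuous. Qed.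

Lemma cvg_fprod I (s : seq I) (P : pred I) (f : I -> T -> K) (l : I -> K) :
  (forall i, P i -> f i @ F --> l i) ->
  (fun t => \prod_(i <- s | P i) f i t) @ F --> \prod_(i <- s | P i) l i.
Proof. by move=> h; apply: cvg_big => //; exact: mul_continuous. Qed.

Lemma mcvg_cst m n (A : 'M[K]_(m, n)) : mcvg (fun=> A) A.
Proof. by move=> i j; exact: cvg_cst. Qed.

Lemma mcvg_mul m n p (f : T -> 'M[K]_(m, n)) (g : T -> 'M[K]_(n, p)) a b :
  mcvg f a -> mcvg g b -> mcvg (fun t => f t *m g t) (a *m b).
Proof.
move=> fa gb i j; rewrite mxE; under eq_fun do rewrite mxE.
by apply: cvg_fsum => k _; apply: cvgM; [exact: fa|exact: gb].
Qed.

Lemma cvg_det n (f : T -> 'M[K]_n) a :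
  mcvg f a -> (fun t => \det (f t)) @ F --> \det a.
Proof.
move=> fa; apply: cvg_fsum => s _; apply: cvgM; first exact: cvg_cst.
by apply: cvg_fprod => i _; exact: fa.
Qed.

Lemma mcvg_exp n (f : T -> 'M[K]_n) a k :
  mcvg f a -> mcvg (fun t => f t ^+ k) (a ^+ k).
Proof.
move=> fa; elim: k => [|k IH]; first exact: mcvg_cst.
by rewrite exprS; under eq_fun do rewrite exprS; exact: mcvg_mul.
Qed.

Lemma cvg_trace n (f : T -> 'M[K]_n) a :
  mcvg f a -> (fun t => \tr (f t)) @ F --> \tr a.
Proof. by move=> fa; apply: cvg_fsum => s _; exact: fa. Qed.

Lemma mcvg_inv n (f : T -> 'M[K]_n) a : a \in unitmx ->
  mcvg f a -> mcvg (fun t => invmx (f t)) (invmx a).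
Proof.
move=> au fa i j.
have da : \det a != 0 by rewrite -unitfE.
have near_unit : \forall t \near F, \det (f t) != 0.
  by apply: cvgr_neq0 da; exact: cvg_det.
rewrite /invmx au mxE.
(* Near the limit f t is invertible, so that [invmx] is given by the adjugate formula there and not
   by its default value. *)
apply: (@cvg_trans _ ((fun t => (\det (f t))^-1 * (\adj (f t)) i j) @ F)).
  apply: near_eq_cvg; near=> t; rewrite /invmx unitmxE unitfE.
  have -> : \det (f t) != 0 by near: t.
  by rewrite [RHS]mxE.
apply: cvgM; first by apply: cvgV => //; exact: cvg_det.
rewrite mxE; under eq_fun do rewrite mxE.
apply: cvgM; first exact: cvg_cst.
apply: cvg_det => k l; rewrite !mxE; under eq_fun do rewrite !mxE.
exact: fa.
Unshelve. all: by end_near. Qed.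
End MatrixCvg.

Section ComplexCvg.
Variable R : realType.
Local Notation C := (cplx R).

Lemma of_real_continuous : continuous (@of_real R : R -> C).
Proof.
move=> x; apply/cvgrPdist_lt => e e0.
have eE : e = of_real (Re_part e).
  by rewrite [LHS]complex_parts (_ : Im_part e = 0) ?rmorph0 ?mulr0 ?addr0//; exact: ger0_Im (ltW e0).
have e0' : 0 < Re_part e by move: e0; rewrite eE (ltcR 0).
near=> t; rewrite -rmorphB norm_cabs cabs_of_real eE (ltcR _ _).
near: t; exact: (@cvgr_dist_lt _ _ _ _ _ id x cvg_id).
Unshelve. all: by end_near. Qed.

Lemma Im_part_continuous : continuous (@Im_part R).
Proof.
move=> z; apply/(@cvgrPdist_lt _ _ _ (nbhs z)) => e e0.
have e0' : 0 < of_real e by rewrite (ltcR 0).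
near=> t; rewrite -Im_partB; apply: le_lt_trans (Im_le_cabs _) _.
rewrite -(ltcR (cabs _)) -[X in X < _]/(`|z - t|).
near: t; exact: (@nbhsx_ballx C C z (of_real e) e0').
Unshelve. all: by end_near. Qed.

Lemma Re_part_continuous : continuous (@Re_part R).
Proof.
move=> z; apply/(@cvgrPdist_lt _ _ _ (nbhs z)) => e e0.
have e0' : 0 < of_real e by rewrite (ltcR 0).
near=> t; rewrite -Re_partB; apply: le_lt_trans (Re_le_cabs _) _.
rewrite -(ltcR (cabs _)) -[X in X < _]/(`|z - t|).
near: t; exact: (@nbhsx_ballx C C z (of_real e) e0').
Unshelve. all: by end_near. Qed.

Lemma is_cvg_series_geom (u : R^nat) (rho : R) : 0 <= rho -> rho < 1 ->
  (forall k, `|u k| <= rho ^+ k) -> cvgn (series u).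
Proof.
move=> r0 r1 h; apply: normed_cvg.
apply: (@series_le_cvg R _ (geometric 1 rho)) => [n|n|n|] //=.
- by rewrite mul1r exprn_ge0.
- by rewrite mul1r.
- by apply: is_cvg_geometric_series; rewrite ger0_norm.
Qed.

Lemma cseries_geom (u : nat -> C) (rho : R) : 0 <= rho -> rho < 1 ->
  (forall k, cabs (u k) <= rho ^+ k) -> exists l : C, series u @ \oo --> l.
Proof.
move=> r0 r1 h.
have /cvg_ex[a ha] : cvgn (series (fun k => Re_part (u k))).
  by apply: (is_cvg_series_geom r0 r1) => k; apply: le_trans (h k); exact: Re_le_cabs.
have /cvg_ex[b hb] : cvgn (series (fun k => Im_part (u k))).
  by apply: (is_cvg_series_geom r0 r1) => k; apply: le_trans (h k); exact: Im_le_cabs.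
exists (of_real a + imag_unit R * of_real b).
have -> : series u = fun n => of_real (series (fun k => Re_part (u k)) n) +
    imag_unit R * of_real (series (fun k => Im_part (u k)) n).
  apply/funext => n; rewrite /series /= !rmorph_sum mulr_sumr -big_split/=.
  by apply: eq_bigr => k _; exact: complex_parts.
apply: cvgD; first by apply: cvg_comp; [exact: ha|exact: of_real_continuous].
apply: cvgM; first exact: cvg_cst.
by apply: cvg_comp; [exact: hb|exact: of_real_continuous].
Qed.

Lemma mxseries_geom m n (f : nat -> 'M[C]_(m, n)) (rho : R) : 0 <= rho -> rho < 1 ->
  (forall k i j, cabs (f k i j) <= rho ^+ k) -> exists l : 'M[C]_(m, n), series f @ \oo --> l.
Proof.
move=> r0 r1 h.
have /choice[l lP] : forall ij : 'I_m * 'I_n, exists l : C,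
    series (fun k => f k ij.1 ij.2) @ \oo --> l.
  by move=> ij; apply: (cseries_geom r0 r1) => k; exact: h.
exists (\matrix_(i, j) l (i, j)); apply: cvg_mx => i j; rewrite mxE.
rewrite (_ : (fun t => _) = series (fun k => f k i j)); first exact: lP (i, j).
by apply/funext => N; rewrite /series /= summxE.
Qed.
End ComplexCvg.

(** * The Berezin cocycle as a sum of principal arguments *)

Section Berezin.
Variables (R : realType) (n : nat).
Local Notation C := (cplx R).
Local Notation "''[' u , v ]" := (dotmx u v) : ring_scope.
Local Notation "''[' u ]" := '[u, u]%R : ring_scope.

Lemma conj_of_real (x : R) : (of_real x : C)^* = of_real x.
Proof. exact: conjc_real. Qed.

Lemma conj_imag_unit : (imag_unit R)^* = - imag_unit R.
Proof. by apply/eqP; rewrite eq_complex /= oppr0 !eqxx. Qed.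

Lemma imag_unit2 : imag_unit R * imag_unit R = -1.
Proof. exact: (sqr_i R). Qed.

Definition Zmx (g1 g2 : 'M[R]_(n + n)) : 'M[C]_n :=
  gen_Z (@of_real R) (imag_unit R) g1 g2.

Definition log_sum (g1 g2 : 'M[R]_(n + n)) (N : nat) : R :=
  \sum_(k < N) (-1) ^+ k / k.+1%:R * Im_part (\tr (Zmx g1 g2 ^+ k.+1 : 'M[C]_n)).

Lemma Phi_unit (g : 'M[R]_(n + n)) : symplectic g -> Phi g \in unitmx.
Proof. exact: (gen_Phi_unit conj_of_real conj_imag_unit imag_unit2). Qed.

Lemma Phi_W (g1 g2 : 'M[R]_(n + n)) : symplectic g1 -> symplectic g2 ->
  invmx (Phi g1) *m Phi (g1 *m g2) *m invmx (Phi g2) = 1%:M + Zmx g1 g2.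
Proof. exact: (gen_W conj_of_real conj_imag_unit imag_unit2). Qed.

(** c(g1, g2) is the sum of the principal arguments of 1 + l_i over the eigenvalues l_i of Z, and
    the product of the 1 + l_i is det (1 + Z). The explicit error of the truncated series, uniform
    for given M, serves the continuity of c. The square root in [rho] appears because
    [gen_Z_contraction] bounds squared norms. *)
Lemma berezin_log_sum (g1 g2 : 'M[R]_(n + n)) (M : R) :
  symplectic g1 -> symplectic g2 -> 1 <= M -> frob2 (Phi g1) <= of_real M ->
  let rho := Num.sqrt (1 - M^-1) in
  (forall N, `|log_sum g1 g2 N - berezin g1 g2| <= n%:R * (rho ^+ N.+1 / (1 - rho))) /\
  argp (\det (1%:M + Zmx g1 g2)) (berezin g1 g2).
Proof.
move=> s1 s2 M1 hM rho.
have M0 : 0 < M by apply: lt_le_trans M1.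
have rr0 : 0 <= 1 - M^-1 by rewrite subr_ge0 invf_le1.
have r0 : 0 <= rho by exact: sqrtr_ge0.
have r1 : rho < 1.
  by rewrite -sqrtr1 ltr_sqrt ?ltr01// ltrBlDr ltrDl invr_gt0.
have rho2 : rho ^+ 2 = 1 - M^-1 by rewrite sqr_sqrtr.
pose r : C := of_real (rho ^+ 2).
have cr0 : 0 <= r by rewrite (lecR 0) sqr_ge0.
set Z := Zmx g1 g2.
have hZ (v : 'rV_n) : '[v *m Z] <= r * '[v].
  rewrite /r rho2 rmorphB rmorph1 fmorphV.
  by apply: (gen_Z_contraction conj_of_real conj_imag_unit imag_unit2) => //; rewrite (lecR 1).
have cabs2 (z : C) k : `|z| ^+ 2 <= r ^+ k -> cabs z <= rho ^+ k.
  rewrite norm_cabs /r -!rmorphXn (lecR _ _) exprAC.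
  by rewrite ler_pXn2r// nnegrE ?cabs_ge0// exprn_ge0.
have hent k i j : cabs ((Z ^+ k : 'M[C]_n) i j) <= rho ^+ k.
  by apply: cabs2; exact: contraction_entry.
have [l [lr ltr ldet]] := schur_eigen cr0 hZ.
have hl i : cabs (l i) <= rho by rewrite -[rho]expr1; apply: cabs2; rewrite expr1.
pose a i := atan (Im_part (l i) / (1 + Re_part (l i))).
have approx N : `|log_sum g1 g2 N - \sum_i a i| <= n%:R * (rho ^+ N.+1 / (1 - rho)).
  have -> : log_sum g1 g2 N - \sum_i a i =
      \sum_i (\sum_(k < N) (-1) ^+ k / k.+1%:R * Im_part (l i ^+ k.+1) - a i).
    rewrite /log_sum sumrB exchange_big/=; congr (_ - _).
    by apply: eq_bigr => k _; rewrite ltr Im_part_sum mulr_sumr.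
  apply: le_trans (ler_norm_sum _ _ _) _.
  apply: (@le_trans _ _ (\sum_(i < n) (rho ^+ N.+1 / (1 - rho)))).
    by apply: ler_sum => i _; exact: log_partial.
  by rewrite sumr_const card_ord mulr_natl.
suff bE : berezin g1 g2 = \sum_i a i.
  rewrite bE; split => //; rewrite ldet; apply: argp_prod => i _.
  by apply: argp_1D; exact: le_lt_trans (hl i) r1.
pose f (k : nat) : 'M[C]_n := ((-1) ^+ k / k.+1%:R) *: (Z ^+ k.+1 : 'M[C]_n).
(* The matrix series has to converge for the [limn] in [mxln] to be its sum and not a default
   value. *)
have [L hL] : exists L : 'M[C]_n, series f @ \oo --> L.
  apply: (mxseries_geom r0 r1) => k i j; rewrite mxE cabsM.
  have -> : (-1) ^+ k / k.+1%:R = of_real ((-1) ^+ k / k.+1%:R) :> C.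
    by rewrite fmorph_div rmorphXn rmorphN1 rmorph_nat.
  rewrite cabs_of_real normrM normrX normrN1 expr1n mul1r.
  rewrite ger0_norm ?invr_ge0// -[leRHS]mul1r; apply: ler_pM; rewrite ?cabs_ge0 ?invr_ge0//.
    by rewrite invf_le1 ?ltr0n// ler1n.
  apply: le_trans (hent _ _ _) _; rewrite exprS ler_piMl ?exprn_ge0//; exact: ltW.
have lnE : mxln (1%:M + Z) = L.
  rewrite /mxln addrAC subrr add0r.
  by apply: (cvg_lim _ hL); exact: norm_hausdorff.
rewrite /berezin Phi_W// -/Z lnE.
have htr : (fun N => \tr (series f N)) @ \oo --> \tr L.
  exact: (@cvg_trace _ _ _ C n (series f) L (cvg_mcvg hL)).
have h1 : (fun N => Im_part (\tr (series f N))) @ \oo --> Im_part (\tr L).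
  by move=> A hA; exact: (htr _ (@Im_part_continuous R (\tr L) A hA)).
have h2 : (fun N => Im_part (\tr (series f N))) @ \oo --> \sum_i a i.
  rewrite (_ : (fun N => _) = log_sum g1 g2); last first.
    apply/funext => N; rewrite /series /log_sum /= raddf_sum/= big_mkord Im_part_sum.
    apply: eq_bigr => k _; rewrite /f mxtraceZ.
    have -> : (-1) ^+ k / k.+1%:R = of_real ((-1) ^+ k / k.+1%:R) :> C.
      by rewrite fmorph_div rmorphXn rmorphN1 rmorph_nat.
    by rewrite Im_part_scale.
  apply: (@cvg_sub0 _ _ _ _ _ _ (fun=> \sum_i a i)); last exact: cvg_cst.
  apply: norm_cvg0.
  have lim0 : (fun N => n%:R * (rho ^+ N.+1 / (1 - rho))) @ \oo --> (0 : R).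
    rewrite -[X in _ --> X](mulr0 n%:R); apply: cvgM; first exact: cvg_cst.
    rewrite -[X in _ --> X](mul0r (1 - rho)^-1); apply: cvgM; last exact: cvg_cst.
    rewrite (cvg_shiftS (fun N => rho ^+ N)).
    by rewrite exprn_geometric; apply: cvg_geometric; rewrite ger0_norm.
  apply: squeeze_cvgr lim0; last exact: (@cvg_cst R).
  by apply: nearW => N; rewrite normr_ge0; exact: approx.
exact: (cvg_unique (@norm_hausdorff R R) h1 h2).
Qed.
End Berezin.

(** The values of X lie in 2 pi Z. If X 1 were not 0, its absolute value would be at least 2 pi, and
    X would pass through pi or - pi, where cos is -1. *)
Lemma const_of_cos (R : realType) (X : R -> R) : continuous X ->
  (forall t, cos (X t) = 1) -> X 0 = 0 -> X 1 = 0.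
Proof.
move=> cX X1 X0; apply: cos_eq1_small => //; rewrite ltNge; apply/negP => h.
have p0 : 0 < pi :> R by exact: pi_gt0.
have cw : {within `[0, 1], continuous X} by exact: continuous_subspaceT.
have bad (v : R) : cos v = -1 -> Num.min (X 0) (X 1) <= v <= Num.max (X 0) (X 1) -> False.
  move=> cv hv; have [c _ cE] := IVT ler01 cw hv.
  by have := X1 c; rewrite cE cv => /eqP; rewrite eqNr oner_eq0.
have [x0|x0] := leP 0 (X 1).
  rewrite ger0_norm// in h; apply: (bad pi (cospi _)).
  by rewrite X0 min_l// max_r// ltW//= (le_trans _ h)// mulr2n lerDl ltW.
rewrite ltr0_norm// in h; apply: (bad (- pi)); first by rewrite cosN cospi.
have x0' := ltW x0; rewrite X0 (min_r x0') (max_l x0') oppr_le0 (ltW p0) andbT.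
by move: h; rewrite mulr2n; lra.
Qed.

(** * Continuity, cocycle identity and local primitive of c *)

Section BerezinContinuity.
Variables (R : realType) (n : nat).
Local Notation C := (cplx R).
Local Notation M := 'M[R]_(n + n).
Implicit Types g : M.

Lemma symplectic1 : symplectic (1%:M : M).
Proof. by rewrite /symplectic trmx1 mul1mx mulmx1. Qed.

Lemma symplecticM g1 g2 : symplectic g1 -> symplectic g2 -> symplectic (g1 *m g2).
Proof.
rewrite /symplectic => s1 s2; rewrite trmx_mul -!mulmxA (mulmxA (symp_form R n)).
by rewrite (mulmxA g1^T) (mulmxA g1^T) s1 mulmxA.
Qed.

Definition rfrob m p (A : 'M[C]_(m, p)) : R := \sum_j \sum_i cabs (A i j) ^+ 2.

Lemma frob2_real m p (A : 'M[C]_(m, p)) : frob2 A = of_real (rfrob A).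
Proof.
rewrite /frob2 /rfrob rmorph_sum; apply: eq_bigr => j _.
by rewrite rmorph_sum; apply: eq_bigr => i _; rewrite rmorphXn norm_cabs.
Qed.

Lemma rfrob_ge0 m p (A : 'M[C]_(m, p)) : 0 <= rfrob A.
Proof. by apply: sumr_ge0 => j _; apply: sumr_ge0 => i _; exact: sqr_ge0. Qed.

Lemma cabs_continuous : continuous (@cabs R).
Proof.
move=> z; apply/(@cvgrPdist_lt _ _ _ (nbhs z)) => e e0.
have e0' : 0 < of_real e by rewrite (ltcR 0).
have dist (a b : C) : cabs a - cabs b <= cabs (a - b).
  by rewrite lerBlDr -{1}(subrK b a); exact: cabsD.
near=> t; apply: (@le_lt_trans _ _ (cabs (z - t))).
  by rewrite ler_norml dist andbT lerNl opprB -(cabsN (z - t)) opprB dist.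
rewrite -(ltcR (cabs _)) -[X in X < _]/(`|z - t|).
near: t; exact: (@nbhsx_ballx C C z (of_real e) e0').
Unshelve. all: by end_near. Qed.

Section Filter.
Context {T : Type} {F : set_system T} {FF : ProperFilter F}.

Lemma mcvg_of_real (A : T -> M) A0 : mcvg A A0 (F := F) ->
  mcvg (fun t => map_mx (@of_real R) (A t) : 'M[C]_(n + n)) (map_mx (@of_real R) A0) (F := F).
Proof.
move=> h i j; rewrite mxE; under eq_fun do rewrite mxE.
by move=> B hB; exact: (h _ _ _ (@of_real_continuous R (A0 i j) B hB)).
Qed.

Local Notation cg := (gen_conj (@of_real R) (imag_unit R)).

Lemma mcvg_conj (A : T -> M) A0 : mcvg A A0 (F := F) ->
  mcvg (fun t => cg (A t)) (cg A0) (F := F).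
Proof.
move=> h; apply: mcvg_mul; last exact: mcvg_cst.
by apply: mcvg_mul; [exact: mcvg_cst|exact: mcvg_of_real].
Qed.

Lemma mcvg_ulsub (f : T -> 'M[C]_(n + n)) a : mcvg f a (F := F) ->
  mcvg (fun t => ulsubmx (f t)) (ulsubmx a) (F := F).
Proof. by move=> h i j; rewrite !mxE; under eq_fun do rewrite !mxE; exact: h. Qed.

Lemma mcvg_ursub (f : T -> 'M[C]_(n + n)) a : mcvg f a (F := F) ->
  mcvg (fun t => ursubmx (f t)) (ursubmx a) (F := F).
Proof. by move=> h i j; rewrite !mxE; under eq_fun do rewrite !mxE; exact: h. Qed.

Lemma mcvg_dlsub (f : T -> 'M[C]_(n + n)) a : mcvg f a (F := F) ->
  mcvg (fun t => dlsubmx (f t)) (dlsubmx a) (F := F).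
Proof. by move=> h i j; rewrite !mxE; under eq_fun do rewrite !mxE; exact: h. Qed.

Lemma mcvg_Phi (A : T -> M) A0 : mcvg A A0 (F := F) ->
  mcvg (fun t => Phi (A t)) (Phi A0) (F := F).
Proof. by move=> /mcvg_conj h; exact: mcvg_ulsub. Qed.

Lemma mcvg_Zmx (A B : T -> M) A0 B0 : symplectic A0 -> symplectic B0 ->
  mcvg A A0 (F := F) -> mcvg B B0 (F := F) ->
  mcvg (fun t => Zmx (A t) (B t)) (Zmx A0 B0) (F := F).
Proof.
move=> sA sB hA hB.
have hPsi : mcvg (fun t => gen_Psi (@of_real R) (imag_unit R) (A t))
    (gen_Psi (@of_real R) (imag_unit R) A0) (F := F).
  exact: (mcvg_ursub (mcvg_conj hA)).
have hOm : mcvg (fun t => gen_Om (@of_real R) (imag_unit R) (B t))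
    (gen_Om (@of_real R) (imag_unit R) B0) (F := F).
  exact: (mcvg_dlsub (mcvg_conj hB)).
have hPA : mcvg (fun t => invmx (gen_Phi (@of_real R) (imag_unit R) (A t)))
    (invmx (gen_Phi (@of_real R) (imag_unit R) A0)) (F := F).
  exact: mcvg_inv (Phi_unit sA) (mcvg_Phi hA).
have hPB : mcvg (fun t => invmx (gen_Phi (@of_real R) (imag_unit R) (B t)))
    (invmx (gen_Phi (@of_real R) (imag_unit R) B0)) (F := F).
  exact: mcvg_inv (Phi_unit sB) (mcvg_Phi hB).
exact (mcvg_mul (mcvg_mul hPA hPsi) (mcvg_mul hOm hPB)).
Qed.

Lemma cvg_log_sum (A B : T -> M) A0 B0 N : symplectic A0 -> symplectic B0 ->
  mcvg A A0 (F := F) -> mcvg B B0 (F := F) ->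
  (fun t => log_sum (A t) (B t) N) @ F --> log_sum A0 B0 N.
Proof.
move=> sA sB hA hB; apply: cvg_fsum => k _; apply: cvgM; first exact: cvg_cst.
have h : (fun t => \tr (Zmx (A t) (B t) ^+ k.+1)) @ F --> \tr (Zmx A0 B0 ^+ k.+1).
  exact (cvg_trace (mcvg_exp (k := k.+1) (mcvg_Zmx sA sB hA hB))).
by move=> D hD; exact: (h _ (@Im_part_continuous R _ D hD)).
Qed.

Lemma cvg_rfrob m p (A : T -> 'M[C]_(m, p)) A0 : mcvg A A0 (F := F) ->
  (fun t => rfrob (A t)) @ F --> rfrob A0.
Proof.
move=> h; apply: cvg_fsum => j _; apply: cvg_fsum => i _.
have hc : (fun t => cabs (A t i j)) @ F --> cabs (A0 i j).
  by move=> D hD; exact: (h _ _ _ (@cabs_continuous _ D hD)).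
by rewrite expr2; under eq_fun do rewrite expr2; exact: cvgM.
Qed.

(** Near the limit the squared Frobenius norm of Phi (A t) is at most K, so c is approximated
    uniformly by [log_sum] for one large N, which is continuous in the matrix entries. *)
Lemma mcvg_berezin (A B : T -> M) A0 B0 :
  (\forall t \near F, symplectic (A t) /\ symplectic (B t)) ->
  symplectic A0 -> symplectic B0 ->
  mcvg A A0 (F := F) -> mcvg B B0 (F := F) ->
  (fun t => berezin (A t) (B t)) @ F --> berezin A0 B0.
Proof.
(* The + 1 provides both K >= 1, as [berezin_log_sum] requires, and room for A t near A0. *)
move=> nearS sA sB hA hB; pose K := rfrob (Phi A0) + 1.
have K1 : 1 <= K by rewrite lerDr rfrob_ge0.
set rho := Num.sqrt (1 - K^-1).
pose err N : R := n%:R * (rho ^+ N.+1 / (1 - rho)).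
have lim0 : err @ \oo --> (0 : R).
  have r1 : rho < 1.
    rewrite -sqrtr1 ltr_sqrt ?ltr01// ltrBlDr ltrDl invr_gt0.
    exact: lt_le_trans K1.
  rewrite -[X in _ --> X](mulr0 n%:R); apply: cvgM; first exact: cvg_cst.
  rewrite -[X in _ --> X](mul0r (1 - rho)^-1); apply: cvgM; last exact: cvg_cst.
  rewrite (cvg_shiftS (fun N => rho ^+ N)).
  by rewrite exprn_geometric; apply: cvg_geometric; rewrite ger0_norm// sqrtr_ge0.
have frob_near : \forall t \near F, rfrob (Phi (A t)) <= K.
  apply: (cvgr_le _ (cvg_rfrob (mcvg_Phi hA))).
  by rewrite ltrDl.
apply/cvgrPdist_lt => e e0.
have e3 : 0 < e / 3 by rewrite divr_gt0.
have [N /= errN] : exists N, err N < e / 3.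
  have /cvgrPdist_lt/(_ _ e3)[N _ /(_ N (leqnn N))] := lim0.
  by rewrite /= sub0r normrN => /(le_lt_trans (ler_norm _)) h; exists N.
have hL : (fun t => log_sum (A t) (B t) N) @ F --> log_sum A0 B0 N.
  exact: cvg_log_sum.
near=> t.
have [sAt sBt] : symplectic (A t) /\ symplectic (B t) by near: t.
have frobA0 : frob2 (Phi A0) <= of_real K.
  by rewrite frob2_real (lecR _ _) lerDl.
have frobA : frob2 (Phi (A t)) <= of_real K.
  by rewrite frob2_real (lecR _ _); near: t.
have [/(_ N) h0 _] := berezin_log_sum sA sB K1 frobA0.
have [/(_ N) ht _] := berezin_log_sum sAt sBt K1 frobA.
have hlog : `|log_sum A0 B0 N - log_sum (A t) (B t) N| < e / 3.
  near: t; move/cvgrPdist_lt : hL; apply; exact: e3.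
have {}h0 := le_lt_trans h0 errN; have {}ht := le_lt_trans ht errN.
move: hlog h0 ht; move: (berezin A0 B0) (berezin (A t) (B t)) => b0 bt.
move: (log_sum A0 B0 N) (log_sum (A t) (B t) N) => l0 lt.
rewrite !ltr_norml => /andP[? ?] /andP[? ?] /andP[? ?].
by apply/andP; split; lra.
Unshelve. all: by end_near. Qed.
End Filter.

Lemma det_conj_quot m (P Q S : 'M[C]_m) :
  \det (invmx P *m Q *m invmx S) = \det Q / (\det P * \det S).
Proof. by rewrite !det_mulmx !det_inv invfM mulrA (mulrC (\det Q)). Qed.

(** Modulo 2 pi, c is therefore the coboundary of an argument of - det Phi up to sign conventions
    only in the exponent: products of these quotients telescope, which yields the cocycle identity
    modulo 2 pi. *)
Lemma berezin_argp g1 g2 : symplectic g1 -> symplectic g2 ->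
  argp (\det (Phi (g1 *m g2)) / (\det (Phi g1) * \det (Phi g2))) (berezin g1 g2).
Proof.
move=> s1 s2; pose K := rfrob (Phi g1) + 1.
have K1 : 1 <= K by rewrite lerDr rfrob_ge0.
have hK : frob2 (Phi g1) <= of_real K by rewrite frob2_real (lecR _ _) lerDl.
have [_] := berezin_log_sum s1 s2 K1 hK.
by rewrite -(Phi_W s1 s2) det_conj_quot.
Qed.

Lemma det_Phi_neq0 g : symplectic g -> \det (Phi g) != 0.
Proof. by move=> /Phi_unit; rewrite unitmxE unitfE. Qed.

Lemma Phi1 : Phi (1%:M : M) = 1%:M.
Proof.
rewrite /Phi map_mx1 mulmx1 mulVmx; last first.
  apply: unitarymx_unit.
  have -> : Jmx R n = gen_J (@of_real R) (imag_unit R) n by [].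
  exact: (@gen_J_unitary R C (@of_real R) _ (@conj_of_real R)
    (@conj_imag_unit R) (@imag_unit2 R) n).
by rewrite scalar_mx_block block_mxKul.
Qed.

Lemma berezin11 : berezin (1%:M : M) (1%:M : M) = 0.
Proof.
rewrite /berezin mulmx1 Phi1 invmx1 !mulmx1 /mxln.
rewrite (_ : series _ = fun=> 0); last first.
  apply/funext => N; rewrite /series /= big1// => k _.
  by rewrite subrr expr0n scaler0.
rewrite (cvg_lim (@norm_hausdorff C _) (cvg_cst 0)).
by rewrite raddf0.
Qed.

Lemma argp_quotients (a b d ab bd abd : C) (x y : R) :
  ab != 0 -> bd != 0 -> a != 0 -> b != 0 -> d != 0 ->
  argp (ab / (a * b) * (abd / (ab * d))) x ->
  argp (abd / (a * bd) * (bd / (b * d))) y -> cos (x - y) = 1.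
Proof.
move=> ab0 bd0 a0 b0 d0 hx hy; apply: (argp_cos hx); move: hy.
by congr argp; field; rewrite ab0 bd0 a0 b0 d0.
Qed.

(* Both sides are arguments of the same complex number; their difference is continuous
   in t, takes values in 2 pi Z and vanishes at t = 0. *)
Lemma berezin_cocycle (A B D : R -> M) :
  continuous A -> continuous B -> continuous D ->
  (forall t, symplectic (A t)) -> (forall t, symplectic (B t)) ->
  (forall t, symplectic (D t)) -> A 0 = 1%:M -> B 0 = 1%:M -> D 0 = 1%:M ->
  berezin (A 1) (B 1) + berezin (A 1 *m B 1) (D 1) =
  berezin (A 1) (B 1 *m D 1) + berezin (B 1) (D 1).
Proof.
move=> cA cB cD sA sB sD A0 B0 D0.
pose X t := (berezin (A t) (B t) + berezin (A t *m B t) (D t)) -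
  (berezin (A t) (B t *m D t) + berezin (B t) (D t)).
suff : X 1 = 0 by move/eqP; rewrite subr_eq0 => /eqP.
apply: const_of_cos.
- move=> t.
  have mA : mcvg A (A t) (F := nbhs t) by apply: cvg_mcvg; exact: cA.
  have mB : mcvg B (B t) (F := nbhs t) by apply: cvg_mcvg; exact: cB.
  have mD : mcvg D (D t) (F := nbhs t) by apply: cvg_mcvg; exact: cD.
  have mAB := mcvg_mul mA mB (FF := _); have mBD := mcvg_mul mB mD (FF := _).
  have sAB s : symplectic (A s *m B s) by exact: symplecticM.
  have sBD s : symplectic (B s *m D s) by exact: symplecticM.
  have nS (E F : R -> M) : (forall s, symplectic (E s)) ->
      (forall s, symplectic (F s)) ->
      \forall s \near nbhs t, symplectic (E s) /\ symplectic (F s).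
    by move=> hE hF; apply: (@filterE _ (nbhs t)) => s; split.
  apply: cvgB; apply: cvgD; apply: (@mcvg_berezin R (nbhs t) _) => //.
  + exact: (nS A B sA sB).
  + exact: (nS _ D sAB sD).
  + exact: mAB.
  + exact: (nS A _ sA sBD).
  + exact: mBD.
  + exact: (nS B D sB sD).
- move=> t; rewrite /X.
  have sAB : symplectic (A t *m B t) by exact: symplecticM.
  have sBD : symplectic (B t *m D t) by exact: symplecticM.
  have h1 := argpM (berezin_argp (sA t) (sB t)) (berezin_argp sAB (sD t)).
  have h2 := argpM (berezin_argp (sA t) sBD) (berezin_argp (sB t) (sD t)).
  rewrite (mulmxA (A t) (B t) (D t)) in h2.
  move: (det_Phi_neq0 sAB) (det_Phi_neq0 sBD) (det_Phi_neq0 (sA t))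
    (det_Phi_neq0 (sB t)) (det_Phi_neq0 (sD t)) h1 h2.
  exact: argp_quotients.
- by rewrite /X A0 B0 D0 !mulmx1 berezin11 !addr0 subrr.
Qed.

(** The principal argument of det Phi(g) where its real part is positive; elsewhere the formula has
    no such meaning. *)
Definition argdet g : R :=
  atan (Im_part (\det (Phi g)) / Re_part (\det (Phi g))).

Lemma cvg_Re_det : (fun g : M => Re_part (\det (Phi g))) @ nbhs (1%:M : M) --> (1 : R).
Proof.
have h : mcvg (fun g : M => g) 1%:M (F := nbhs (1%:M : M)) by apply: cvg_mcvg.
have {}h : (fun g : M => \det (Phi g)) @ nbhs (1%:M : M) --> (1 : C).
  by rewrite -[X in _ --> X](det1 _ n) -Phi1; exact (cvg_det (mcvg_Phi h)).
by move=> B hB; exact: (h _ (@Re_part_continuous R 1 B hB)).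
Qed.

(** Both sides are arguments of the same number. On U each of the four terms is below pi / 2 in
    absolute value, so the two sides differ by less than 2 pi and agree. *)
Lemma local_primitive : exists2 U : set M, nbhs (1%:M : M) U &
  (forall A, U A -> 0 < Re_part (\det (Phi A))) /\
  forall A B, U A -> U B -> U (A *m B) -> symplectic A -> symplectic B ->
    berezin A B = argdet (A *m B) - argdet A - argdet B.
Proof.
(* [mcvg_berezin] needs symplectic arguments, so the limit at (1, 1) is taken within S. *)
pose S := [set z : M * M | symplectic z.1 /\ symplectic z.2].
pose F := within S (nbhs ((1%:M, 1%:M) : M * M)).
have FF : ProperFilter F.
  apply: within_nbhs_proper; rewrite closureE => A [_ SA]; apply: SA.
  by split; exact: symplectic1.
have h1 : mcvg (fun z : M * M => z.1) 1%:M (F := F).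
  apply: cvg_mcvg; apply: cvg_within_filter; exact: cvg_fst.
have h2 : mcvg (fun z : M * M => z.2) 1%:M (F := F).
  apply: cvg_mcvg; apply: cvg_within_filter; exact: cvg_snd.
have hb : (fun z : M * M => berezin z.1 z.2) @ F --> (0 : R).
  rewrite -berezin11; apply: mcvg_berezin => //; try exact: symplectic1.
  exact: withinT.
have p2 : 0 < pi / 2 :> R by rewrite divr_gt0// pi_gt0.
have nb : \forall z \near F, `|berezin z.1 z.2| < pi / 2.
  by move/cvgrPdist_lt : hb => /(_ _ p2); apply: filterS => z; rewrite sub0r normrN.
have [[U1 U2] /= [n1 n2] U12] := nb.
have nR : \forall g \near nbhs (1%:M : M), 0 < Re_part (\det (Phi g)).
  have /(@cvgrPdist_lt _ _ _ (nbhs (1%:M : M)))/(_ 1 ltr01) := cvg_Re_det.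
  apply: filterS => g; rewrite ltr_norml => /andP[_].
  by move: (Re_part _) => r; lra.
exists ([set g | 0 < Re_part (\det (Phi g))] `&` (U1 `&` U2)).
  by apply: filterI => //; exact: filterI.
split=> [A [] //|A B [pA [UA _]] [pB [_ UB]] [pAB _] sA sB].
have hs : `|berezin A B| < pi / 2 by exact: (U12 (A, B)).
have aP g : 0 < Re_part (\det (Phi g)) -> argp (\det (Phi g)) (argdet g).
  exact: argp_atan.
have c1 := argp_cos (berezin_argp sA sB) (argpM (aP _ pAB) (argpV (argpM (aP _ pA) (aP _ pB)))).
have ab g : `|argdet g| < pi / 2.
  by rewrite ltr_norml atan_gtNpi2 atan_ltpi2.
have := ab A; have := ab B; have := ab (A *m B); move: hs c1.
move: (berezin A B) (argdet A) (argdet B) (argdet (A *m B)) => b x y z.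
rewrite !ltr_norml => /andP[? ?] c1 /andP[? ?] /andP[? ?] /andP[? ?].
have : b - (z - (x + y)) = 0.
  by apply: cos_eq1_small => //; rewrite ltr_norml mulr2n; apply/andP; split; lra.
lra.
Qed.
End BerezinContinuity.

Local Close Scope sesquilinear_scope.

(** * Change of variables for volume-preserving maps *)

Lemma mx_norm_ge (K : realDomainType) m n (x : 'M[K]_(m, n)) i j : `|x i j| <= `|x|.
Proof.
have -> : `|x| = mx_norm x by [].
rewrite mx_normrE.
exact: (le_bigmax _ (fun ij : 'I_m * 'I_n => `|x ij.1 ij.2|) (i, j)).
Qed.

Lemma mx_norm_le (K : realDomainType) m n (x : 'M[K]_(m, n)) r : 0 <= r ->
  (forall i j, `|x i j| <= r) -> `|x| <= r.
Proof.
move=> r0 h; have -> : `|x| = mx_norm x by [].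
by rewrite mx_normrE; apply: bigmax_le => // ij _; exact: h.
Qed.

(** * Integrals of continuous functions with bounded support *)

Section TupleMeasure.
Variable R : realType.
Local Notation mR := (measurableTypeR R).
Local Notation vec := (@vec_of_tuple R _).

Definition tup N (v : 'rV[R]_N) : N.-tuple mR := [tuple (v 0 i : mR) | i < N].

Lemma vecK N : cancel (@vec_of_tuple R N) (@tup N).
Proof. by move=> t; apply: eq_from_tnth => i; rewrite tnth_mktuple mxE. Qed.

Lemma tupK N : cancel (@tup N) (@vec_of_tuple R N).
Proof. by move=> v; apply/rowP => i; rewrite mxE tnth_mktuple. Qed.

Lemma measurable_coord N (i : 'I_N) (B : set R) : measurable (B : set mR) ->
  measurable [set t : N.-tuple mR | B (tnth t i)].
Proof.
by move=> mB; rewrite -[X in measurable X]setTI; exact: (measurable_tnth i measurableT mB).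
Qed.

Lemma measurable_boxes N (B : 'I_N -> set R) : (forall i, measurable (B i : set mR)) ->
  measurable [set t : N.-tuple mR | forall i, B i (tnth t i)].
Proof.
move=> mB.
rewrite (_ : [set _ | _] = \bigcap_(i in [set: 'I_N]) [set t : N.-tuple mR | B i (tnth t i)]).
  by apply: fin_bigcap_measurable => // i _; exact: measurable_coord.
by apply/seteqP; split => t /= h i; [move=> _; exact: h|exact: (h i)].
Qed.

(** Tuples carry the product sigma-algebra and row vectors the norm topology; the two are linked by
    writing an open set as the countable union of the rational boxes inside it. *)
Lemma measurable_vec_open N (O : set 'rV[R]_N) : open O ->
  measurable (@vec_of_tuple R N @^-1` O).
Proof.
move=> oO.
pose box (z : N.-tuple rat * nat) := [set t : N.-tuple mR |
  forall i, `]ratr (tnth z.1 i) - z.2.+1%:R^-1, ratr (tnth z.1 i) + z.2.+1%:R^-1[%classic (tnth t i)].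
rewrite (_ : _ @^-1` O =
    \bigcup_z (if `[< box z `<=` @vec_of_tuple R N @^-1` O >] then box z else set0)).
  apply: countable_bigcupT_measurable => [|z]; first exact: countableP.
  case: ifP => _ //.
  apply: (measurable_boxes (B := fun i => `]ratr (tnth z.1 i) - z.2.+1%:R^-1,
    ratr (tnth z.1 i) + z.2.+1%:R^-1[%classic)) => i.
  exact: measurable_itv.
apply/seteqP; split => [t Ot|t [z _]]; last by case: asboolP => // h /h.
have /nbhs_ballP[e /= e0 eO] : nbhs (vec t) O by exact: open_nbhs_nbhs.
have sym (x y d : R) : x - d < y < x + d -> y - d < x < y + d by lra.
have close (a b c d f : R) : c - d < a < c + d -> c - d < b < c + d ->
  d < f / 2 -> `|a - b| < f by rewrite ltr_norml; lra.
(* A box containing t stays in the ball of radius e around t as soon as its half-width 1 / (k + 1)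
   is below e / 2. *)
pose k := Num.truncn (e^-1 *+ 2).
have ke : k.+1%:R^-1 < e / 2.
  rewrite -[e / 2]invrK ltf_pV2 ?posrE ?invr_gt0 ?divr_gt0//.
  by rewrite invf_div mulrC mulr_natr truncnS_gt.
have k0 : 0 < k.+1%:R^-1 :> R by rewrite invr_gt0.
have /choice[q qP] : forall i : 'I_N, exists q : rat,
    ratr q \in `](tnth t i : R) - k.+1%:R^-1, (tnth t i : R) + k.+1%:R^-1[.
  by move=> i; apply: rat_in_itvoo; rewrite ltrD2l; apply: lt_trans k0; rewrite oppr_lt0.
exists ([tuple q i | i < N], k) => //.
have tb : box ([tuple q i | i < N], k) t.
  move=> i; rewrite /= tnth_mktuple in_itv/=; have := qP i; rewrite in_itv/=.
  exact: sym.
case: asboolP => // -[]; move=> s sb; apply: eO; split => // i j.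
rewrite !mxE; have := sb j; have := tb j; rewrite /= tnth_mktuple !in_itv/=.
by move=> h1 h2; exact: close h1 h2 ke.
Qed.

Lemma measurable_vec_continuous N (F : 'rV[R]_N -> R) : continuous F ->
  measurable_fun setT (F \o @vec_of_tuple R N).
Proof.
move=> cF _; apply: (measurability _ (RGenOInfty.measurableE R)) => //.
move=> _ [_ [a ->] <-]; rewrite setTI comp_preimage; apply: measurable_vec_open.
by move/continuousP : cF; apply; exact: interval_open.
Qed.

Definition cube N (r : R) := [set t : N.-tuple mR | forall i, `|tnth t i| <= r].
Arguments cube : clear implicits.

Lemma measurable_cube N r : measurable (cube N r).
Proof.
apply: (measurable_boxes (B := fun=> [set x | `|x| <= r])) => i.
rewrite (_ : [set x | _] = `[-r, r]%classic); first exact: measurable_itv.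
by apply/seteqP; split => x /=; rewrite in_itv/= ler_norml.
Qed.

Lemma lebesgueN_cube N r : (lebesgueN N (cube N r) < +oo)%E.
Proof.
elim: N => [|N IH] /=.
  by rewrite diracE; case: (_ \in _); rewrite ltry.
rewrite /lebesgueS /pushforward.
rewrite (_ : @tcons R N @^-1` _ = `[-r, r]%classic `*` cube N r).
  rewrite product_measure1E//; last exact: measurable_cube.
  apply: lte_mul_pinfty => //.
  suff : lebesgue_measure ([set` `[- r, r]] : set R) \is a fin_num by [].
  by rewrite lebesgue_measure_itv/=; case: ifP => _ //; rewrite fin_numD.
apply/seteqP; split => -[x t] /=.
  move=> h; split; first by have := h ord0; rewrite in_itv/= -ler_norml.
  by move=> i; have := h (lift ord0 i); rewrite tnthS.
rewrite in_itv/= -ler_norml => -[hx ht] i.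
by have [j ->|->] := unliftP ord0 i; rewrite ?tnthS.
Qed.

Lemma cubeE N r (t : N.-tuple mR) : 0 <= r -> cube N r t <-> `|vec t| <= r.
Proof.
move=> r0; split => h.
  by apply: mx_norm_le => // i j; rewrite mxE; exact: h.
by move=> i; apply: le_trans h; have := mx_norm_ge (vec t) 0 i; rewrite mxE.
Qed.

Definition supp_in N (r : R) (F : 'rV[R]_N -> R) := forall x, r < `|x| -> F x = 0.

Lemma bounded_on_cube N r (F : 'rV[R]_N -> R) : continuous F ->
  exists M, forall x, `|x| <= r -> `|F x| <= M.
Proof.
move=> cF; have cK : compact [set x : 'rV[R]_N | `|x| <= r].
  apply: bounded_closed_compact.
    by exists r; split; [exact: num_real|move=> y ry x /= xr; exact: le_trans xr (ltW ry)].
  rewrite (_ : [set _ | _]  = (fun x : 'rV[R]_N => `|x|) @^-1` [set y | y <= r])//.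
  by apply: closed_comp; [move=> x _; exact: norm_continuous|exact: closed_le].
have /compact_bounded[M [_ h]] : compact (F @` [set x : 'rV[R]_N | `|x| <= r]).
  by apply: continuous_compact => //; exact: continuous_subspaceT.
by exists (M + 1) => x xr; apply: (h (M + 1)); [rewrite ltrDl|exists x].
Qed.

Lemma integrable_cube N r (F : 'rV[R]_N -> R) : 0 <= r -> continuous F ->
  (lebesgueN N).-integrable (cube N r) (EFin \o (F \o @vec_of_tuple R N)).
Proof.
move=> r0 cF; apply: measurable_bounded_integrable.
- exact: measurable_cube.
- exact: lebesgueN_cube.
- by apply: measurable_funTS; exact: measurable_vec_continuous.
have [M MP] := bounded_on_cube r cF.
exists M; split; first exact: num_real.
move=> y My t /(cubeE _ r0) tr; apply: le_trans (MP _ tr) _; exact: ltW.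
Qed.

Lemma restrict_cube N r (F : 'rV[R]_N -> R) : 0 <= r -> supp_in r F ->
  EFin \o (F \o @vec_of_tuple R N) = (EFin \o (F \o @vec_of_tuple R N)) \_ (cube N r).
Proof.
move=> r0 sF; apply/funext => t; rewrite patchE; case: ifPn => // /negP tc.
rewrite /= sF// ltNge; apply/negP => h; apply: tc; rewrite inE; exact/cubeE.
Qed.

Lemma integrable_supp N r (F : 'rV[R]_N -> R) : 0 <= r -> continuous F -> supp_in r F ->
  (lebesgueN N).-integrable setT (EFin \o (F \o @vec_of_tuple R N)).
Proof.
move=> r0 cF sF; rewrite (restrict_cube r0 sF).
apply: (iffLR (integrable_mkcond _ (@measurable_cube N r))).
exact: integrable_cube.
Qed.

Definition intN N (F : 'rV[R]_N -> R) : R :=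
  Rintegral (lebesgueN N) setT (F \o @vec_of_tuple R N).

Lemma intND N r (F G : 'rV[R]_N -> R) : 0 <= r -> continuous F -> continuous G ->
  supp_in r F -> supp_in r G -> intN (fun x => F x + G x) = intN F + intN G.
Proof.
by move=> r0 cF cG sF sG; apply: RintegralD => //;
  [exact: (integrable_supp r0 cF sF)|exact: (integrable_supp r0 cG sG)].
Qed.

Lemma intNZ N r c (F : 'rV[R]_N -> R) : 0 <= r -> continuous F ->
  supp_in r F -> intN (fun x => c * F x) = c * intN F.
Proof.
by move=> r0 cF sF; apply: RintegralZl => //; exact: (integrable_supp r0 cF sF).
Qed.

Lemma intN0 N : intN (fun _ : 'rV[R]_N => 0) = 0.
Proof. by rewrite /intN Rintegral_cst// mul0r. Qed.

Lemma intN_sum N r I (s : seq I) (F : I -> 'rV[R]_N -> R) : 0 <= r ->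
  (forall i, continuous (F i)) -> (forall i, supp_in r (F i)) ->
  intN (fun x => \sum_(i <- s) F i x) = \sum_(i <- s) intN (F i).
Proof.
move=> r0 cF sF; elim: s => [|i s IH].
  by rewrite big_nil -[RHS](intN0 N); congr intN; apply/funext => x; rewrite big_nil.
rewrite big_cons -IH -(@intND _ r)//; first last.
- by move=> x rx; rewrite big1// => j _; exact: sF.
- move=> x; apply: (@cvg_fsum _ (nbhs x) _ R _ s xpredT F (fun j => F j x)) => j _.
  exact: cF.
- by congr intN; apply/funext => x; rewrite big_cons.
Qed.

Lemma intN_integral N (F : 'rV[R]_N -> R) :
  (\int[lebesgueN N]_t (F (vec t))%:E)%E = 0%E -> intN F = 0.
Proof. by rewrite /intN /Rintegral => ->. Qed.

Lemma integralN_supp N (D : set 'rV[R]_N) (F : 'rV[R]_N -> R) :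
  (forall x, ~ D x -> F x = 0) -> Defs.integralN D F = intN F.
Proof.
move=> h; rewrite /Defs.integralN Rintegral_mkcond; congr Rintegral.
apply/funext => t; rewrite patchE; case: ifPn => // /negP nD.
by rewrite /= h// => Dt; apply: nD; rewrite inE.
Qed.

End TupleMeasure.

(** * Integrals of partial derivatives vanish *)

Section Divergence.
Variable R : realType.
Local Notation mR := (measurableTypeR R).

Lemma is_derive_line (V W : normedModType R) (X : normedModType R)
    (f : W -> X) (p : V -> W) (a v : V) (w : W) (d : X) :
  (forall h : R, p (h *: v + a) = h *: w + p a) ->
  is_derive (p a) w f d -> is_derive a v (f \o p) d.
Proof.
move=> hp [ed <-].
have e : (fun h : R => h^-1 *: (((f \o p) \o shift a) (h *: v) - (f \o p) a)) =
    (fun h : R => h^-1 *: ((f \o shift (p a)) (h *: w) - f (p a))).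
  by apply/funext => h /=; rewrite hp.
by split; [rewrite /derivable e|rewrite /derive e].
Qed.

Definition vcons N (x : R) (v : 'rV[R]_N) : 'rV[R]_N.+1 :=
  \row_i (if unlift ord0 i is Some j then v 0 j else x).

Lemma vcons0 N x (v : 'rV[R]_N) : vcons x v 0 ord0 = x.
Proof. by rewrite mxE unlift_none. Qed.

Lemma vconsS N x (v : 'rV[R]_N) j : vcons x v 0 (lift ord0 j) = v 0 j.
Proof. by rewrite mxE liftK. Qed.

Lemma vec_tcons N (z : mR * N.-tuple mR) :
  vec_of_tuple (tcons z) = vcons z.1 (vec_of_tuple z.2).
Proof.
apply/rowP => i; have [j ->|->] := unliftP ord0 i.
  by rewrite vconsS !mxE tnthS.
by rewrite vcons0 mxE tnth0.
Qed.

Lemma vcons_norm N x (v : 'rV[R]_N) : `|x| <= `|vcons x v| /\ `|v| <= `|vcons x v|.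
Proof.
split; first by have := mx_norm_ge (vcons x v) 0 ord0; rewrite vcons0.
apply: mx_norm_le => // i j; rewrite ord1.
by have := mx_norm_ge (vcons x v) 0 (lift ord0 j); rewrite vconsS.
Qed.

Lemma vcons_continuous1 N (v : 'rV[R]_N) : continuous (fun x => vcons x v).
Proof.
move=> x; apply: cvg_mx => i j; rewrite ord1.
have [k ->|->] := unliftP ord0 j.
  by under eq_fun do rewrite vconsS; rewrite vconsS; exact: cvg_cst.
by under eq_fun do rewrite vcons0; rewrite vcons0; exact: cvg_id.
Qed.

Lemma vcons_continuous2 N x : continuous (fun v : 'rV[R]_N => vcons x v).
Proof.
move=> v; apply: (@cvg_mx _ (nbhs v)) => i j; rewrite ord1.
have [k ->|->] := unliftP ord0 j.
  by under eq_fun do rewrite vconsS; rewrite vconsS; exact: coord_continuous.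
by under eq_fun do rewrite vcons0; rewrite vcons0; exact: cvg_cst.
Qed.

Lemma integral_deriv_supp (f df : R -> R) (r : R) : 0 <= r -> continuous df ->
  (forall x : R, is_derive x 1 f (df x)) -> (forall x, r < `|x| -> f x = 0) ->
  (forall x, r < `|x| -> df x = 0) ->
  (\int[@lebesgue_measure R]_x (df x)%:E = 0)%E.
Proof.
(* The + 1 puts both endpoints strictly outside the support, where f vanishes. *)
move=> r0 cdf dfP f0 df0; set a := - (r + 1); set b := r + 1.
have ab : a < b by rewrite /a /b; lra.
have -> : (\int[@lebesgue_measure R]_x (df x)%:E =
    \int[@lebesgue_measure R]_(x in `[a, b]) (df x)%:E)%E.
  rewrite [RHS]integral_mkcond; apply: eq_integral => x _.
  rewrite patchE; case: ifPn => // /negP nx; rewrite df0// ltNge; apply/negP => h.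
  apply: nx; rewrite inE/= in_itv/= -ler_norml; apply: le_trans h _.
  by rewrite /b lerDl.
have cf : continuous f.
  by move=> x; apply: differentiable_continuous; apply/derivable1_diffP; have [] := dfP x.
rewrite (@continuous_FTC2 _ df f a b ab).
- have b0 : r < `|b| by rewrite ger0_norm /b; lra.
  have a0 : r < `|a| by rewrite /a normrN.
  by rewrite (f0 b b0) (f0 a a0) -EFinB subrr.
- exact: continuous_subspaceT.
- split.
  + by move=> x _; have [] := dfP x.
  + by apply: cvg_at_right_filter; exact: cf.
  + by apply: cvg_at_left_filter; exact: cf.
- by move=> x _; rewrite derive1E; have [_ ->] := dfP x.
Qed.

(** [lebesgueN N.+1] is the image of a product measure under [tcons]; moving the integral to the
    product makes Fubini available. *)
Lemma integral_lebesgueS N (F : 'rV[R]_N.+1 -> R) r : 0 <= r -> continuous F ->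
  supp_in r F ->
  (\int[lebesgueN N.+1]_t (F (vec_of_tuple t))%:E =
   \int[lebesgue_measure \x lebesgueN N]_z (F (vcons z.1 (vec_of_tuple z.2)))%:E)%E /\
  (lebesgue_measure \x lebesgueN N)%E.-integrable setT
    (fun z : mR * N.-tuple mR => (F (vcons z.1 (vec_of_tuple z.2)))%:E).
Proof.
move=> r0 cF sF.
have mF : measurable_fun setT (fun t : N.+1.-tuple mR => (F (vec_of_tuple t))%:E).
  by apply/measurable_EFinP; exact: measurable_vec_continuous.
have FE : (fun z : mR * N.-tuple mR => (F (vcons z.1 (vec_of_tuple z.2)))%:E) =
    (fun t => (F (vec_of_tuple t))%:E) \o @tcons R N.
  by apply/funext => z /=; rewrite vec_tcons.
have intF : (lebesgue_measure \x lebesgueN N)%E.-integrable setT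
    (fun z : mR * N.-tuple mR => (F (vcons z.1 (vec_of_tuple z.2)))%:E).
  rewrite FE.
  have /integrableP[_ h] := integrable_supp r0 cF sF.
  apply/integrableP; split.
    by apply: measurableT_comp => //; exact: measurable_tcons.
  apply: le_lt_trans h.
  have := @ge0_integral_pushforward _ _ _ _ _ _ (@measurable_tcons R N)
    (lebesgue_measure \x lebesgueN N)%E setT
    (fun t => `|(F (vec_of_tuple t))%:E|%E) measurableT.
  rewrite preimage_setT => <- //.
  exact: measurableT_comp.
split=> //.
have := @integral_pushforward _ _ _ _ _ _ (@measurable_tcons R N)
  (lebesgue_measure \x lebesgueN N)%E setT (fun t => (F (vec_of_tuple t))%:E) mF.
by rewrite preimage_setT -FE => <-.
Qed.

(** By Fubini the inner integral is taken over the variables that include direction j: the first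
    coordinate alone, by the fundamental theorem of calculus, or the remaining ones, by
    induction. *)
Lemma integral_partial N (j : 'I_N) (f df : 'rV[R]_N -> R) r : 0 <= r ->
  continuous df -> (forall x, is_derive x (delta_mx 0 j : 'rV[R]_N) f (df x)) ->
  supp_in r f -> supp_in r df ->
  (\int[lebesgueN N]_t (df (vec_of_tuple t))%:E = 0)%E.
Proof.
elim: N j f df => [[]//|N IH] j f df r0 cdf fdf sf sdf.
have [-> intF] := integral_lebesgueS r0 cdf sdf.
have [k jk|j0] := unliftP ord0 j.
- rewrite -(integral12_prod_meas1 intF); apply: integral0_eq => x _; rewrite /fubini_F/=.
  apply: (IH k (f \o vcons x) (df \o vcons x)) => //.
  + by move=> v; apply: cvg_comp; [exact: vcons_continuous2|exact: cdf].
  + move=> v; apply: is_derive_line (fdf _) => h; rewrite jk.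
    apply/rowP => i; have [l ->|->] := unliftP ord0 i.
      by rewrite vconsS !mxE liftK/= !(inj_eq (@lift_inj _ _)).
    by rewrite vcons0 !mxE unlift_none -!val_eqE/= mulr0 add0r.
  + by move=> v rv; apply: sf; have [_] := vcons_norm x v; exact: lt_le_trans.
  + by move=> v rv; apply: sdf; have [_] := vcons_norm x v; exact: lt_le_trans.
- rewrite -(integral21_prod_meas1 intF); apply: integral0_eq => t _; rewrite /fubini_G/=.
  move: (vec_of_tuple t) => v.
  apply: (@integral_deriv_supp (fun x => f (vcons x v)) (fun x => df (vcons x v)) r) => //.
  + by move=> x; apply: cvg_comp; [exact: vcons_continuous1|exact: cdf].
  + move=> x; apply: (@is_derive_line R 'rV[R]_N.+1 R f (fun x => vcons x v)) (fdf _) => h; rewrite j0.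
    apply/rowP => i; have [l ->|->] := unliftP ord0 i.
      by rewrite vconsS !mxE liftK/= mulr0 add0r.
    rewrite vcons0 !mxE unlift_none/= ?eqxx/= mulr1; congr (_ + _); exact: mulr1.
  + by move=> x rx; apply: sf; have [+ _] := vcons_norm x v; exact: lt_le_trans.
  + by move=> x rx; apply: sdf; have [+ _] := vcons_norm x v; exact: lt_le_trans.
Qed.

Lemma intN_partial N (j : 'I_N) (f df : 'rV[R]_N -> R) r : 0 <= r ->
  continuous df -> (forall x, is_derive x (delta_mx 0 j : 'rV[R]_N) f (df x)) ->
  supp_in r f -> supp_in r df -> intN df = 0.
Proof.
move=> r0 cdf h sf sdf; apply: intN_integral; exact: integral_partial h sf sdf.
Qed.

End Divergence.

(** * Symmetry of second derivatives and the product rule *)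

Section Schwarz.
Variable R : realType.
Variable V : normedModType R.

Lemma is_derive_ray (f : V -> R) (a u : V) (s d : R) :
  is_derive (s *: u + a) u f d -> is_derive s 1 (fun s : R => f (s *: u + a)) d.
Proof.
apply: (@is_derive_line R R V R f (fun s => s *: u + a)) => h.
have -> : h *: (1 : R) = h by exact: mulr1.
by rewrite scalerDl addrA.
Qed.

Lemma mvt_ray (f df : V -> R) (a u : V) (h : R) : 0 < h ->
  (forall x, is_derive x u f (df x)) ->
  exists2 s, 0 <= s <= h & f (h *: u + a) - f a = h * df (s *: u + a).
Proof.
move=> h0 dfP.
have dg (s : R) : is_derive s 1 (fun s : R => f (s *: u + a)) (df (s *: u + a)).
  exact: is_derive_ray.
have [|s sI sE] := @MVT_segment R (fun s => f (s *: u + a)) (fun s => df (s *: u + a)) 0 h (ltW h0).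
  by apply: derivable_within_continuous => s _; have [] := dg s.
exists s; first by move: sI; rewrite in_itv.
by move: sE; rewrite scale0r add0r subr0 mulrC.
Qed.

(** The mean value theorem is used twice: along u for g(x) = f(h v + x) - f(x), then along v for
    fu. *)
Lemma mvt_square (f fu fuv : V -> R) (a u v : V) (h : R) : 0 < h ->
  (forall x, is_derive x u f (fu x)) -> (forall x, is_derive x v fu (fuv x)) ->
  exists p, `|p - a| <= h * (`|u| + `|v|) /\
    f (h *: u + (h *: v + a)) - f (h *: u + a) - f (h *: v + a) + f a = h * h * fuv p.
Proof.
move=> h0 hu huv; pose g x := f (h *: v + x) - f x; pose dg x := fu (h *: v + x) - fu x.
have hg x : is_derive x u g (dg x).
  apply: is_deriveB; apply: is_derive_line (hu _) => k.
  by rewrite addrCA.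
have [s /andP[s0 sh] sE] := mvt_ray a h0 hg.
have [t /andP[t0 th] tE] := mvt_ray (s *: u + a) h0 huv.
exists (t *: v + (s *: u + a)); split.
  rewrite addrA addrK (le_trans (ler_normD _ _))// !normrZ !ger0_norm// mulrDr addrC.
  by rewrite lerD// ler_wpM2r.
have -> : f (h *: u + (h *: v + a)) - f (h *: u + a) - f (h *: v + a) + f a =
    g (h *: u + a) - g a.
  by rewrite /g [h *: v + (h *: u + a)]addrCA; ring.
by rewrite sE /dg tE mulrA.
Qed.

(** The second difference is symmetric in u and v, so by [mvt_square] the functions fuv and fvu take
    a common value at two points arbitrarily close to a. *)
Lemma schwarz (f fu fv fuv fvu : V -> R) (u v : V) :
  (forall x, is_derive x u f (fu x)) -> (forall x, is_derive x v f (fv x)) ->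
  (forall x, is_derive x v fu (fuv x)) -> (forall x, is_derive x u fv (fvu x)) ->
  continuous fuv -> continuous fvu -> fuv = fvu.
Proof.
move=> hu hv huv hvu cuv cvu; apply/funext => a; apply/eqP; rewrite -subr_eq0.
apply/negPn/negP => ne; set e := `|fuv a - fvu a|.
have e0 : 0 < e by rewrite normr_gt0.
have e2 : 0 < e / 2 by rewrite divr_gt0.
have /nbhs_ballP[d /= d0 dP] : nbhs a (fun x => `|fuv a - fuv x| < e / 2 /\ `|fvu a - fvu x| < e / 2).
  apply: filterI.
    by move/cvgrPdist_lt : (cuv a) => /(_ _ e2).
  by move/cvgrPdist_lt : (cvu a) => /(_ _ e2).
(* The + 1 keeps c positive even if u and v vanish, and makes the distance bound strict. *)
pose c := `|u| + `|v| + 1.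
have c0 : 0 < c by rewrite ltr_wpDl// addr_ge0.
pose h := d / c.
have h0 : 0 < h by rewrite divr_gt0.
have hc : h * (`|u| + `|v|) < d.
  by rewrite /h mulrAC ltr_pdivrMr// ltr_pM2l// /c ltrDl.
have [p [pa pE]] := mvt_square a h0 hu huv.
have [q [qa qE]] := mvt_square a h0 hv hvu.
have pq : fuv p = fvu q.
  apply: (@mulfI _ (h * h)); first by rewrite mulf_neq0// gt_eqF.
  by rewrite -pE -qE [h *: v + (_ + _)]addrCA; ring.
have [|hp _] := dP p; first by rewrite -ball_normE /= distrC; exact: le_lt_trans hc.
have [|_ hq] := dP q.
  by rewrite -ball_normE /= distrC; apply: le_lt_trans hc; rewrite (addrC `|u|).
suff : e < e by rewrite ltxx.
rewrite {2}(splitr e) {1}/e; apply: le_lt_trans (ltrD hp hq).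
by rewrite pq (distrC (fvu a)); apply: le_trans (ler_normD _ _); rewrite addrA subrK.
Qed.

Lemma is_derive_prod (I : eqType) (s : seq I) (f : I -> V -> R) (df : I -> R) (x v : V) :
  uniq s -> (forall i, is_derive x v (f i) (df i)) ->
  is_derive x v (fun y => \prod_(i <- s) f i y)
    (\sum_(k <- s) \prod_(i <- s) (if i == k then df i else f i x)).
Proof.
move=> us hf; elim: s us => [_|a s IH /= /andP[as_ us]].
  rewrite big_nil (_ : (fun y => _) = cst 1); last first.
    by apply/funext => y; rewrite big_nil.
  exact: is_derive_cst.
have -> : (fun y => \prod_(i <- a :: s) f i y) = f a * (fun y => \prod_(i <- s) f i y).
  by apply/funext => y; rewrite big_cons mulrfctE.
have h := IH us; have ha := hf a.
apply: is_derive_eq.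
rewrite big_cons big_cons eqxx /GRing.scale/= addrC; congr (_ + _).
  rewrite mulrC; congr (_ * _); apply: eq_big_seq => i si.
  by case: eqP => // ia; rewrite -ia si in as_.
rewrite mulr_sumr; apply: eq_big_seq => k sk.
by rewrite big_cons; case: eqP => // ak; rewrite ak sk in as_.
Qed.

End Schwarz.

(** * The Jacobian determinant as a divergence *)

Section NullLagrangian.
Variables (R : realType) (m : nat).
Local Notation n := m.+1.
Local Notation V := 'rV[R]_n.
Local Notation e_ j := (delta_mx 0 j : V).

(** The derivatives are carried as explicit functions so that those of a composition can be given by
    formulas, as in [comp_data]. *)
Record C2_data (psi : 'I_n -> V -> R) (d1 : 'I_n -> 'I_n -> V -> R)
    (d2 : 'I_n -> 'I_n -> 'I_n -> V -> R) : Prop := C2Data {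
  C2_d1 : forall i j x, is_derive x (e_ j) (psi i) (d1 i j x);
  C2_d2 : forall i j k x, is_derive x (e_ k) (d1 i j) (d2 i j k x);
  C2_c0 : forall i, continuous (psi i);
  C2_c1 : forall i j, continuous (d1 i j);
  C2_c2 : forall i j k, continuous (d2 i j k);
  C2_sym : forall i j k x, d2 i j k x = d2 i k j x }.

Section Terms.
Variables (psi : 'I_n -> V -> R) (d1 : 'I_n -> 'I_n -> V -> R)
    (d2 : 'I_n -> 'I_n -> 'I_n -> V -> R).
Hypothesis H : C2_data psi d1 d2.

(** Factors of psi_0 times the product over i <> 0 of the derivatives of psi_i in direction s(i);
    [Eterm] differentiates this product in direction s(0). Grouped by s(0), the signed products are
    psi_0 times the cofactors of row 0, the vector field whose divergence is the determinant. *)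
Definition Tfac (s : {perm 'I_n}) (i : 'I_n) : V -> R :=
  if i == ord0 then psi ord0 else d1 i (s i).
Definition dTfac (s : {perm 'I_n}) (i : 'I_n) : V -> R :=
  if i == ord0 then d1 ord0 (s ord0) else d2 i (s i) (s ord0).
Definition Tterm (s : {perm 'I_n}) (x : V) : R := \prod_i Tfac s i x.
Definition Eterm (s : {perm 'I_n}) (x : V) : R :=
  \sum_k \prod_i (if i == k then dTfac s i x else Tfac s i x).

Lemma Tterm_derive (s : {perm 'I_n}) x : is_derive x (e_ (s ord0)) (Tterm s) (Eterm s x).
Proof.
apply: is_derive_prod; first exact: index_enum_uniq.
move=> i; rewrite /Tfac /dTfac; case: eqP => _; first exact: (C2_d1 H).
exact: (C2_d2 H).
Qed.

Lemma Tfac_continuous s i : continuous (Tfac s i).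
Proof. by rewrite /Tfac; case: eqP => _; [exact: (C2_c0 H)|exact: (C2_c1 H)]. Qed.

Lemma dTfac_continuous s i : continuous (dTfac s i).
Proof. by rewrite /dTfac; case: eqP => _; [exact: (C2_c1 H)|exact: (C2_c2 H)]. Qed.

Lemma Eterm_continuous s : continuous (Eterm s).
Proof.
move=> x; apply: (@cvg_fsum _ (nbhs x) _ R _ _ xpredT
  (fun k x => \prod_i (if i == k then dTfac s i x else Tfac s i x))) => k _.
apply: (@cvg_fprod _ (nbhs x) _ R _ _ xpredT
  (fun i x => if i == k then dTfac s i x else Tfac s i x)) => i _.
by case: eqP => _; [exact: dTfac_continuous|exact: Tfac_continuous].
Qed.

(* In the k-th summand with k <> 0 the permutations s and (0 k) s contribute the
   same value with opposite signs, by symmetry of second derivatives. *)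
Lemma sum_Eterm x :
  \sum_(s : {perm 'I_n}) (-1) ^+ s * Eterm s x = \det (\matrix_(i, j) d1 i j x).
Proof.
rewrite /Eterm; under eq_bigr do rewrite mulr_sumr.
rewrite exchange_big/= (bigD1 ord0)//= [X in _ + X]big1 ?addr0.
  apply: eq_bigr => s _; congr (_ * _); apply: eq_bigr => i _.
  by rewrite mxE /dTfac /Tfac; case: eqP => // ->.
move=> k k0; set S := \sum_(s : {perm 'I_n}) _.
suff : S = - S by lra.
rewrite {1}/S (reindex_inj (mulgI (tperm ord0 k)))/= -sumrN.
apply: eq_bigr => s _; rewrite odd_mul_tperm eq_sym k0/= signrN mulNr.
congr (- (_ * _)); apply: eq_bigr => i _.
rewrite /dTfac /Tfac !permM tpermL.
case: (i =P k) => [->|ik]; first by rewrite (negbTE k0) tpermR (C2_sym H).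
by case: (i =P ord0) => // i0; rewrite tpermD// eq_sym; apply/eqP.
Qed.

End Terms.

(* By [sum_Eterm] the determinant is a divergence, so its integral only depends on the
   values near the boundary. *)
Lemma null_lagrangian psi d1 d2 psi' d1' d2' r : 0 <= r ->
  C2_data psi d1 d2 -> C2_data psi' d1' d2' ->
  (forall x, r < `|x| -> [/\ forall i, psi i x = psi' i x,
     forall i j, d1 i j x = d1' i j x & forall i j k, d2 i j k x = d2' i j k x]) ->
  intN (fun x => \det (\matrix_(i, j) d1 i j x) - \det (\matrix_(i, j) d1' i j x)) = 0.
Proof.
move=> r0 H H' agree.
have -> : (fun x => \det (\matrix_(i, j) d1 i j x) - \det (\matrix_(i, j) d1' i j x)) =
    (fun x => \sum_(s : {perm 'I_n}) (-1) ^+ s *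
      (Eterm psi d1 d2 s x - Eterm psi' d1' d2' s x)).
  apply/funext => x; rewrite -(sum_Eterm H) -(sum_Eterm H') -sumrB.
  by apply: eq_bigr => s _; rewrite mulrBr.
have facE s x i : r < `|x| -> dTfac d1 d2 s i x = dTfac d1' d2' s i x /\
    Tfac psi d1 s i x = Tfac psi' d1' s i x.
  by move=> /agree[h0 h1 h2]; rewrite /dTfac /Tfac; case: eqP.
have sE s : supp_in r (fun x => Eterm psi d1 d2 s x - Eterm psi' d1' d2' s x).
  move=> x rx; apply/eqP; rewrite subr_eq0; apply/eqP.
  apply: eq_bigr => k _; apply: eq_bigr => i _.
  by have [-> ->] := facE s x i rx.
have sT s : supp_in r (fun x => Tterm psi d1 s x - Tterm psi' d1' s x).
  move=> x rx; apply/eqP; rewrite subr_eq0; apply/eqP; apply: eq_bigr => i _.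
  by have [_ ->] := facE s x i rx.
have cE s : continuous (fun x => Eterm psi d1 d2 s x - Eterm psi' d1' d2' s x).
  move=> x; apply: (@cvgB _ _ _ (nbhs x)).
    exact: (@Eterm_continuous _ _ _ H s x).
  exact: (@Eterm_continuous _ _ _ H' s x).
rewrite (intN_sum (r := r))//; first last.
- by move=> s x rx; rewrite sE ?mulr0.
- by move=> s x; apply: (@cvgM _ _ (nbhs x)); [exact: cvg_cst|exact: cE].
rewrite big1// => s _; rewrite (intNZ (r := r))//.
suff -> : intN (fun x => Eterm psi d1 d2 s x - Eterm psi' d1' d2' s x) = 0.
  by rewrite mulr0.
apply: (intN_partial (j := s ord0) r0 (@cE s) _ (sT s) (sE s)) => x.
have h := Tterm_derive H s x; have h' := Tterm_derive H' s x.
exact: is_deriveB.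
Qed.

End NullLagrangian.

(** * Chain rule along rays and logistic functions *)

Section Chain.
Variable R : realType.

Lemma is_derive_of_ray (V : normedModType R) (f : V -> R) (a v : V) (d : R) :
  is_derive (0 : R) 1 (fun s : R => f (s *: v + a)) d -> is_derive a v f d.
Proof.
move=> [ed <-].
have e : (fun h : R => h^-1 *: ((f \o shift a) (h *: v) - f a)) =
    (fun h : R => h^-1 *: (((fun s : R => f (s *: v + a)) \o shift 0) (h *: 1) -
      (fun s : R => f (s *: v + a)) 0)).
  apply/funext => h /=; rewrite scale0r add0r addr0.
  by have -> : h *: (1 : R) = h by exact: mulr1.
by split; [rewrite /derivable e|rewrite /derive e].
Qed.

Lemma is_derive_compR (V : normedModType R) (f : V -> R) (B : R -> R) (a v : V) (b d : R) :
  is_derive (f a) 1 B b -> is_derive a v f d -> is_derive a v (B \o f) (b * d).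
Proof.
move=> hB hf; apply: is_derive_of_ray.
apply: (@is_derive1_comp R B (fun s => f (s *: v + a))).
  by rewrite scale0r add0r.
by apply: is_derive_ray; rewrite scale0r add0r.
Qed.

Lemma is_derive_near_uniq (V : normedModType R) (f g : V -> R) (a v : V) (d d' : R) :
  (\near a, f a = g a) -> is_derive a v f d -> is_derive a v g d' -> d = d'.
Proof. by move=> e [_ <-] [_ <-]; exact: near_eq_derive. Qed.

(** The logistic function of c y + d. [intN_prod_comp] calls for a function with a primitive and a
    continuous derivative, which are the next two definitions. *)
Definition sigm (c d y : R) : R := 1 - (1 + expR (c * y + d))^-1.
Definition sigm_prim (c d y : R) : R := c^-1 * ln (1 + expR (c * y + d)).
Definition sigm' (c d y : R) : R :=
  c * expR (c * y + d) * (1 + expR (c * y + d)) ^- 2.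

Lemma expp (x : R) : 0 < 1 + expR x.
Proof. by rewrite addr_gt0// expR_gt0. Qed.

Lemma is_derive_expaff (c d y : R) :
  is_derive y 1 (fun y : R => 1 + expR (c * y + d)) (c * expR (c * y + d)).
Proof.
have h : is_derive y 1 (fun y : R => c * y + d) c.
  have -> : (fun y : R => c * y + d) = c \*: id + cst d by apply/funext.
  by apply: is_derive_eq; rewrite addr0; exact: mulr1.
have h2 := @is_derive1_comp R expR (fun y => c * y + d) y _ _ (is_derive_expR _) h.
have -> : (fun y : R => 1 + expR (c * y + d)) = cst 1 + (expR \o (fun y : R => c * y + d)).
  by apply/funext.
by apply: is_derive_eq; rewrite add0r mulrC.
Qed.

Lemma is_derive_sigm_prim c d (y : R) : c != 0 -> is_derive y 1 (sigm_prim c d) (sigm c d y).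
Proof.
move=> c0.
have h := @is_derive1_comp R (@ln R) (fun y => 1 + expR (c * y + d)) y _ _
  (is_derive1_ln (expp _)) (is_derive_expaff c d y).
have -> : sigm_prim c d = c^-1 \*: (@ln R \o (fun y : R => 1 + expR (c * y + d))).
  by apply/funext.
apply: is_derive_eq; rewrite /sigm /GRing.scale/=.
by have := expp (c * y + d); move: (expR _) => E E0; field; rewrite c0 gt_eqF.
Qed.

Lemma is_derive_sigm c d (y : R) : is_derive y 1 (sigm c d) (sigm' c d y).
Proof.
have h := is_derive_expaff c d y.
have h2 := @is_deriveV R (fun y => 1 + expR (c * y + d)) y _ 1 (lt0r_neq0 (expp _)) h.
have -> : sigm c d = cst 1 - (fun y : R => (1 + expR (c * y + d))^-1) by apply/funext.
by apply: is_derive_eq; rewrite /sigm' /GRing.scale/=; ring.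
Qed.

Lemma is_derive_continuous (f df : R -> R) :
  (forall x : R, is_derive x 1 f (df x)) -> continuous f.
Proof.
by move=> h x; apply: differentiable_continuous; apply/derivable1_diffP; have [] := h x.
Qed.

Lemma sigm_continuous c d : continuous (sigm c d).
Proof. by apply: is_derive_continuous => x; exact: is_derive_sigm. Qed.

Lemma sigm'_continuous c d : continuous (sigm' c d).
Proof.
move=> y; have ce : continuous (fun y : R => 1 + expR (c * y + d)).
  by apply: is_derive_continuous => x; exact: is_derive_expaff.
have ce' : continuous (fun y : R => expR (c * y + d)).
  have -> : (fun y : R => expR (c * y + d)) = (fun y => (1 + expR (c * y + d)) - 1).
    by apply/funext => x; rewrite addrAC subrr add0r.
  by move=> x; apply: cvgB; [exact: ce|exact: cvg_cst].
apply: cvgM; first by apply: cvgM; [exact: cvg_cst|exact: ce'].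
apply: cvgV; first by rewrite expf_neq0// lt0r_neq0// expp.
under eq_fun do rewrite expr2.
by rewrite expr2; apply: cvgM; exact: ce.
Qed.

Lemma sigm01 c d y : 0 <= sigm c d y <= 1.
Proof.
have h := expp (c * y + d); rewrite /sigm subr_ge0 gerBl invr_ge0 (ltW h) andbT.
by rewrite invf_le1// lerDl expR_ge0.
Qed.

(* the steepness k^2 and the shift k make the limit exactly the indicator of
   ]a, +oo[, including at the endpoint a *)
Lemma sigm_lim (a y : R) :
  (fun k : nat => sigm (k.+1%:R ^+ 2) (- (k.+1%:R ^+ 2 * a) - k.+1%:R) y) @ \oo -->
  ((a < y)%R%:R : R).
Proof.
have inv0 : (fun k : nat => (1 + k.+1%:R)^-1) @ \oo --> (0 : R).
  have := @cvg_harmonic R => h.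
  apply: (@squeeze_cvgr _ _ _ _ (fun=> 0) (fun k : nat => k.+1%:R^-1)).
  - apply: nearW => k; rewrite invr_ge0 addr_ge0//=.
    by rewrite lef_pV2 ?posrE ?addr_gt0// lerDr.
  - exact: cvg_cst.
  - exact: h.
have uE k : k.+1%:R ^+ 2 * y + (- (k.+1%:R ^+ 2 * a) - k.+1%:R) =
    k.+1%:R * (k.+1%:R * (y - a) - 1) :> R by ring.
have [ay|ya] := ltP a y.
  have -> : (true%:R : R) = 1 - 0 by rewrite subr0.
  apply: cvgB; first exact: cvg_cst.
  have ya0 : 0 < y - a by rewrite subr_gt0.
  apply: (@squeeze_cvgr _ _ _ _ (fun=> 0) (fun k : nat => (1 + k.+1%:R)^-1)) => //.
  - near=> k; rewrite uE invr_ge0 ltW ?expp//=.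
    rewrite lef_pV2 ?posrE ?expp ?addr_gt0// lerD2l.
    apply: le_trans (le_trans _ (expR_ge1Dx _)) => //.
    apply: (@le_trans _ _ (k.+1%:R * (k.+1%:R * (y - a) - 1))); last by rewrite lerDr.
    rewrite ler_peMr// lerBrDr.
    rewrite -ler_pdivrMr//; apply: ltW.
    apply: lt_le_trans (truncnS_gt _) _; rewrite ler_nat ltnS.
    by near: k; exact: nbhs_infty_ge.
  - exact: cvg_cst.
apply: (@squeeze_cvgr _ _ _ _ (fun=> 0) (fun k : nat => (1 + k.+1%:R)^-1)) => //.
- apply: nearW => k; have /andP[-> _] /= := sigm01 (k.+1%:R ^+ 2) (- (k.+1%:R ^+ 2 * a) - k.+1%:R) y.
  rewrite /sigm uE; set u := _ * _.
  have uk : u <= - k.+1%:R.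
    rewrite /u -[leRHS]mulr1 mulNr -mulrN ler_pM2l// lerBlDr addNr.
    by rewrite mulr_ge0_le0// subr_le0.
  have -> : 1 - (1 + expR u)^-1 = (1 + expR (- u))^-1.
    have := expp u; have := expR_gt0 u; rewrite expRN; move: (expR u) => E E0 E1.
    by field; rewrite !gt_eqF// addr_gt0.
  rewrite lef_pV2 ?posrE ?expp ?addr_gt0// lerD2l.
  apply: le_trans (expR_ge1Dx _); rewrite -[leLHS]add0r; apply: lerD => //.
  by rewrite lerNr.
- exact: cvg_cst.
Unshelve. all: by end_near. Qed.
End Chain.

(** * Orthants as a generating system stable under intersection *)

Section Orthants.
Variables (R : realType) (N : nat).
Local Notation mR := (measurableTypeR R).

Definition orthant (a : 'I_N -> R) := [set t : N.-tuple mR | forall i, a i < tnth t i].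

Lemma measurable_orthant a : measurable (orthant a).
Proof.
apply: (measurable_boxes (B := fun i => [set x | a i < x])) => i.
rewrite (_ : [set x | _] = `]a i, +oo[%classic); first exact: measurable_itv.
by apply/seteqP; split => x /=; rewrite in_itv/= andbT.
Qed.

Lemma orthantI a b : orthant a `&` orthant b = orthant (fun i => Num.max (a i) (b i)).
Proof.
apply/seteqP; split => t /=; first by move=> [ha hb] i; rewrite gt_max ha hb.
by move=> h; split => i; have := h i; rewrite gt_max => /andP[].
Qed.

Lemma orthant_cover : \bigcup_k orthant (fun=> - k%:R) = setT.
Proof.
apply/seteqP; split => // t _; pose M := \sum_i `|tnth t i : R|.
exists (Num.truncn M).+1 => // i; rewrite ltrNl.
apply: (@le_lt_trans _ _ M); last exact: truncnS_gt.
apply: (@le_trans _ _ `|tnth t i : R|); first by rewrite -normrN ler_norm.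
by rewrite /M (bigD1 i)//= lerDl sumr_ge0.
Qed.

(** It is enough to generate the half-spaces a < t_i, and each of them is the union over k of the
    orthants with bound a in place i and - k elsewhere. *)
Lemma tuple_sigma_orthant (A : set (N.-tuple mR)) : measurable A ->
  <<s range orthant >> A.
Proof.
move=> mA; pose T' := g_sigma_algebraType (range orthant).
have mid : measurable_fun setT (id : T' -> N.-tuple mR).
  apply/measurable_fun_tnthP => i _.
  apply: (measurability _ (RGenOInfty.measurableE R)) => //.
  move=> _ [_ [a ->] <-]; rewrite setTI.
  rewrite (_ : _ @^-1` _ =
      \bigcup_k (orthant (fun j => if j == i then a else - k%:R) : set T')).
    apply: bigcup_measurable => k _; apply: sub_sigma_algebra.
    by exists (fun j => if j == i then a else - k%:R).
  apply/seteqP; split => [t|t [k _ /(_ i)]] /=; rewrite in_itv/= andbT; last first.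
    by rewrite eqxx.
  move=> ta; have : [set: N.-tuple mR] t by [].
  rewrite -orthant_cover => -[k _ tk]; exists k => // j.
  by case: eqP => [->//|_]; exact: tk.
have := mid measurableT _ mA; rewrite setTI.
exact.
Qed.
End Orthants.

(** * Maps of Jacobian 1 that are the identity far away preserve the measure *)

Section Cov.
Variables (R : realType) (m : nat).
Local Notation n := m.+1.
Local Notation V := 'rV[R]_n.
Local Notation mR := (measurableTypeR R).
Local Notation e_ j := (delta_mx 0 j : V).

Lemma id_data : C2_data (fun (i : 'I_n) (x : V) => x 0 i) (fun i j _ => (i == j)%:R)
  (fun _ _ _ _ => 0).
Proof.
split.
- move=> i j x; apply: is_derive_of_ray.
  rewrite (_ : (fun s => _) = (fun s : R => x 0 i + s * (i == j)%:R)); last first.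
    by apply/funext => s; rewrite !mxE eqxx addrC.
  exact: is_derive_aff.
- by move=> i j k x; exact: is_derive_cst.
- by move=> i x; exact: coord_continuous.
- by move=> i j; exact: (@cst_continuous V R).
- by move=> i j k; exact: (@cst_continuous V R).
- by [].
Qed.

Lemma comp_data (phi : 'I_n -> V -> R) p1 p2 (B b b' : 'I_n -> R -> R) :
  C2_data phi p1 p2 ->
  (forall i (y : R), is_derive y 1 (B i) (b i y)) ->
  (forall i (y : R), is_derive y 1 (b i) (b' i y)) ->
  (forall i, continuous (b' i)) ->
  C2_data (fun i x => B i (phi i x)) (fun i j x => b i (phi i x) * p1 i j x)
    (fun i j k x => b' i (phi i x) * p1 i k x * p1 i j x + b i (phi i x) * p2 i j k x).
Proof.
move=> H hB hb cb'.
have cB i : continuous (B i) by apply: is_derive_continuous => x; exact: hB.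
have cb i : continuous (b i) by apply: is_derive_continuous => x; exact: hb.
have comp (g : R -> R) i : continuous g -> continuous (fun x => g (phi i x)).
  by move=> cg x; apply: continuous_comp; [exact: (C2_c0 H)|exact: cg].
split.
- by move=> i j x; apply: (is_derive_compR (hB i (phi i x)) (C2_d1 H i j x)).
- move=> i j k x.
  have h1 : is_derive x (e_ k) (b i \o phi i) (b' i (phi i x) * p1 i k x).
    exact: (is_derive_compR (hb i (phi i x)) (C2_d1 H i k x)).
  have h2 := C2_d2 H i j k x.
  rewrite (_ : (fun x => _) = (b i \o phi i) * p1 i j); last by apply/funext.
  apply: is_derive_eq; rewrite /GRing.scale/= addrC; congr (_ + _).
  by rewrite mulrC.
- by move=> i; exact: comp.
- move=> i j x; apply: (@cvgM _ _ (nbhs x)); [exact: (comp _ i (cb i))|exact: (C2_c1 H)].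
- move=> i j k x; apply: (@cvgD _ _ _ (nbhs x)); apply: (@cvgM _ _ (nbhs x)).
  + by apply: (@cvgM _ _ (nbhs x)); [exact: (comp _ i (cb' i))|exact: (C2_c1 H)].
  + exact: (C2_c1 H).
  + exact: (comp _ i (cb i)).
  + exact: (C2_c2 H).
- by move=> i j k x; rewrite (C2_sym H) mulrAC.
Qed.

Lemma det_scale_rows (b : 'I_n -> R) (M : 'I_n -> 'I_n -> R) :
  \det (\matrix_(i, j) (b i * M i j)) = \prod_i b i * \det (\matrix_(i, j) M i j).
Proof.
rewrite (_ : \matrix_(i, j) (b i * M i j) = diag_mx (\row_i b i) *m \matrix_(i, j) M i j).
  by rewrite det_mulmx det_diag; congr (_ * _); apply: eq_bigr => i _; rewrite mxE.
by apply/matrixP => i j; rewrite mul_diag_mx !mxE.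
Qed.

Variables (phi : V -> V) (p1 : 'I_n -> 'I_n -> V -> R)
  (p2 : 'I_n -> 'I_n -> 'I_n -> V -> R) (r : R).
Hypothesis r0 : 0 <= r.
Hypothesis H : C2_data (fun i x => phi x 0 i) p1 p2.
Hypothesis phi_out : forall x, r < `|x| -> phi x = x.
Hypothesis det1P : forall x, \det (\matrix_(i, j) p1 i j x) = 1.

Lemma near_out (x : V) : r < `|x| -> \near x, phi x = x.
Proof.
move=> rx; have : nbhs x [set y : V | r < `|y|] by exact: (@norm_continuous R V x _ (lt_nbhsr rx)).
by apply: filterS => y; exact: phi_out.
Qed.

Lemma p1_out x i j : r < `|x| -> p1 i j x = (i == j)%:R.
Proof.
move=> rx; apply: is_derive_near_uniq (C2_d1 H i j x) (C2_d1 id_data i j x).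
by apply: filterS (near_out rx) => y /= ->.
Qed.

Lemma p2_out x i j k : r < `|x| -> p2 i j k x = 0.
Proof.
move=> rx; apply: is_derive_near_uniq (C2_d2 H i j k x) (C2_d2 id_data i j k x).
have : nbhs x [set y : V | r < `|y|] by exact: (@norm_continuous R V x _ (lt_nbhsr rx)).
by apply: filterS => y /= ry; exact: p1_out.
Qed.

(* [null_lagrangian] for the maps [B i (phi_i)] and [B i (x_i)]. *)
Lemma intN_prod_comp (B b b' : 'I_n -> R -> R) :
  (forall i (y : R), is_derive y 1 (B i) (b i y)) ->
  (forall i (y : R), is_derive y 1 (b i) (b' i y)) ->
  (forall i, continuous (b' i)) ->
  intN (fun x : V => \prod_i b i (phi x 0 i) - \prod_i b i (x 0 i)) = 0.
Proof.
move=> hB hb cb'.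
have := null_lagrangian r0 (comp_data H hB hb cb') (comp_data id_data hB hb cb').
move=> <-.
  congr intN; apply/funext => x; rewrite !det_scale_rows det1P mulr1; congr (_ - _).
  rewrite (_ : \matrix_(i, j) _ = 1%:M) ?det1 ?mulr1//.
  by apply/matrixP => i j; rewrite !mxE.
move=> x rx; split.
- by move=> i; rewrite phi_out.
- by move=> i j; rewrite phi_out// p1_out.
- by move=> i j k; rewrite phi_out// !p1_out// p2_out.
Qed.

Definition tuple_map (t : n.-tuple mR) : n.-tuple mR := tup (phi (vec_of_tuple t)).

Lemma vec_tuple_map t : vec_of_tuple (tuple_map t) = phi (vec_of_tuple t).
Proof. exact: tupK. Qed.

Lemma tnth_tuple_map t i : tnth (tuple_map t) i = phi (vec_of_tuple t) 0 i.
Proof. by rewrite /tuple_map tnth_mktuple. Qed.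

Lemma measurable_tuple_map : measurable_fun setT tuple_map.
Proof.
apply/measurable_fun_tnthP => i.
rewrite (_ : _ \o _ = (fun x => phi x 0 i) \o @vec_of_tuple R n); last first.
  by apply/funext => t /=; rewrite tnth_tuple_map.
by apply: measurable_vec_continuous; exact: (C2_c0 H).
Qed.

Lemma measurable_tuple_map_preimage A : measurable A -> measurable (tuple_map @^-1` A).
Proof. by move=> mA; rewrite -[X in measurable X]setTI; exact: measurable_tuple_map. Qed.

Lemma tuple_map_out t : ~ @cube R n r t -> tuple_map t = t.
Proof.
move=> ht; rewrite /tuple_map phi_out ?vecK// ltNge; apply/negP => h.
by apply: ht; exact/cubeE.
Qed.

Local Notation mu := (lebesgueN n).

(** Products of logistic functions converge to the indicator of the orthant, and [intN_prod_comp]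
    gives the equality before the limit. On the cube, which has finite measure, the constant 1
    dominates; outside of it the difference F k vanishes. *)
Lemma comp_orthant_cube a : mu (tuple_map @^-1` (orthant a) `&` @cube R n r) = mu (orthant a `&` @cube R n r).
Proof.
pose c (k : nat) : R := k.+1%:R ^+ 2.
pose d (k : nat) i : R := - (k.+1%:R ^+ 2 * a i) - k.+1%:R.
pose P k (x : V) := \prod_i sigm (c k) (d k i) (x 0 i).
pose F k (x : V) := P k (phi x) - P k x.
have cP k : continuous (P k).
  move=> x; apply: (@cvg_fprod _ (nbhs x) _ R _ _ xpredT (fun i x => sigm (c k) (d k i) (x 0 i))) => i _.
  apply: (continuous_comp (f := fun x : V => x 0 i)); first exact: coord_continuous.
  exact: sigm_continuous.
have cphi : continuous phi.
  by move=> x; apply: (@cvg_mx _ (nbhs x)) => i j; rewrite ord1; exact: (C2_c0 H).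
have cF k : continuous (F k).
  move=> x; apply: (@cvgB _ _ _ (nbhs x)); last exact: cP.
  by apply: continuous_comp; [exact: cphi|exact: cP].
have sF k : supp_in r (F k) by move=> x rx; rewrite /F phi_out// subrr.
have intF k : (\int[mu]_(t in @cube R n r) (F k (vec_of_tuple t))%:E = 0)%E.
  have c0 : c k != 0 by rewrite /c expf_neq0// pnatr_eq0.
  have := @intN_prod_comp (fun i => sigm_prim (c k) (d k i)) (fun i => sigm (c k) (d k i))
    (fun i => sigm' (c k) (d k i)) (fun i y => is_derive_sigm_prim (d k i) y c0)
    (fun i y => is_derive_sigm (c k) (d k i) y) (fun i => @sigm'_continuous R (c k) (d k i)).
  rewrite -/(F k) /intN /Rintegral => h.
  have fin := integrable_fin_num measurableT (integrable_supp r0 (cF k) (sF k)).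
  rewrite integral_mkcond.
  have -> : ((fun t => (F k (vec_of_tuple t))%:E) \_ (@cube R n r)) =
      EFin \o (F k \o @vec_of_tuple R n) by rewrite (restrict_cube r0 (sF k)).
  by rewrite -(fineK fin) h.
have P01 k x : 0 <= P k x <= 1.
  rewrite /P prodr_ge0 ?prodr_ile1// => i _; first exact: sigm01.
  by have /andP[] := sigm01 (c k) (d k i) (x 0 i).
have F1 k x : `|F k x| <= 1.
  by rewrite ler_norml /F; have := P01 k x; have := P01 k (phi x); lra.
have ind t : \prod_i (a i < vec_of_tuple t 0 i)%R%:R = \1_(orthant a) t :> R.
  rewrite indicE; case: (boolP (t \in _)) => [|/negP h].
    by rewrite inE => h; rewrite big1// => i _; rewrite mxE h.
  have [i hi] : exists i, ~ (a i < tnth t i).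
    by apply/existsNP => hh; apply: h; rewrite inE.
  by rewrite (bigD1 i)//= mxE; move/negP/negbTE : hi => ->; rewrite mul0r.
have limP x : P ^~ x @ \oo --> (\prod_i (a i < x 0 i)%R%:R : R).
  by apply: cvg_fprod => i _; exact: sigm_lim.
have mO := measurable_orthant a.
have mhO := measurable_tuple_map_preimage mO.
have mC := @measurable_cube R n r.
pose f t : \bar R := (\1_(tuple_map @^-1` orthant a) t - \1_(orthant a) t)%:E.
pose fk k t : \bar R := (F k (vec_of_tuple t))%:E.
have [|||||_ _] := @dominated_convergence _ _ _ mu (@cube R n r) mC fk f (cst 1%:E).
- by move=> k; apply: measurable_funTS; apply/measurable_EFinP; exact: measurable_vec_continuous.
- by apply/measurable_EFinP; apply: measurable_funB; exact: measurable_indic.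
- apply: aeW => t _; rewrite /fk /f; apply: cvg_EFin; first exact: nearW.
  rewrite /comp/= (_ : \1_(tuple_map @^-1` orthant a) t = \1_(orthant a) (tuple_map t))// -!ind vec_tuple_map.
  by apply: cvgB; exact: limP.
- have mc : measurable_fun (@cube R n r) (cst 1%R : n.-tuple mR -> R) by exact: measurable_cst.
  apply: (measurable_bounded_integrable mC (lebesgueN_cube n r) mc).
  by exists 1; split => // y y1 t _ /=; rewrite normr1 ltW.
- by apply: aeW => t k _; rewrite lee_fin F1.
rewrite (_ : [sequence _]_k = cst 0%E); last by apply/funext => k; exact: intF.
move=> h0.
have {h0} h0 : (\int[mu]_(t in @cube R n r) f t = 0)%E.
  exact: (cvg_unique (@ereal_hausdorff R) h0 (@cvg_cst _ _ _ _ _)).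
have int1 A : measurable A -> mu.-integrable (@cube R n r) (EFin \o (\1_A : n.-tuple mR -> R)).
  move=> mA; apply: (measurable_bounded_integrable mC (lebesgueN_cube n r)).
    by apply: measurable_funTS; exact: measurable_indic.
  exists 1; split => // y y1 t _ /=; rewrite indicE ger0_norm//.
  by apply: le_trans (ltW y1); case: (_ \in _).
move: h0; rewrite integralB_EFin//; [|exact: int1|exact: int1].
rewrite !integral_indic//.
have fin A : measurable A -> mu (A `&` @cube R n r) \is a fin_num.
  move=> mA; rewrite ge0_fin_numE//.
  apply: le_lt_trans (lebesgueN_cube n r); apply: le_measure => //.
  - by rewrite inE; exact: measurableI.
  - by rewrite inE.
have := fin _ mO; have := fin _ mhO.
move=> fx fy /eqP; rewrite sube_eq ?add0e ?fin_num_adde_defl//.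
by move/eqP.
Qed.

(** The restriction of the measure to the cube and its image under [tuple_map] are finite on
    orthants and agree there, so uniqueness of measures applies. *)
Lemma comp_borel_cube A : measurable A ->
  mu (tuple_map @^-1` A `&` @cube R n r) = mu (A `&` @cube R n r).
Proof.
move=> mA; have mC := @measurable_cube R n r.
pose m2 := [the measure _ _ of mrestr mu mC].
pose m1 : {measure set _ -> \bar R} :=
  measure_function_pushforward__canonical__measure_function_Measure [the {measure set _ -> \bar R} of mrestr mu mC] measurable_tuple_map.
have finA B : measurable B -> (mu (tuple_map @^-1` B `&` @cube R n r) < +oo)%E.
  move=> /measurable_tuple_map_preimage mB.
  apply: le_lt_trans (lebesgueN_cube n r); apply: le_measure => //.
  - by rewrite inE; exact: measurableI.
  - by rewrite inE.
have h : forall E, <<s range (@orthant R n) >> E -> m1 E = m2 E.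
  apply: (@g_sigma_algebra_measure_unique _ R _ (range (@orthant R n)) _ (fun k => orthant (fun=> - k%:R))).
  - by move=> _ [a _ <-]; exact: measurable_orthant.
  - by move=> k; exists (fun=> - k%:R).
  - exact: orthant_cover.
  - by move=> _ _ [a _ <-] [b _ <-]; rewrite orthantI; exists (fun i => Num.max (a i) (b i)).
  - by move=> _ [a _ <-]; exact: comp_orthant_cube.
  - by move=> k; exact: (finA _ (measurable_orthant _)).
exact: (h A (tuple_sigma_orthant mA)).
Qed.

(** Outside the cube [tuple_map] is the identity, so a set and its preimage have the same part
    there. *)
Lemma comp_measure A : measurable A -> mu (tuple_map @^-1` A) = mu A.
Proof.
move=> mA; have mC := @measurable_cube R n r.
have mhA := measurable_tuple_map_preimage mA.
have h B : measurable B -> mu B = (mu (B `\` @cube R n r) + mu (B `&` @cube R n r))%E.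
  by move=> mB; exact: measureDI.
rewrite (h _ mhA) (h _ mA) comp_borel_cube//; congr (mu _ + _)%E.
by apply/seteqP; split => t [h1 h2]; split => //; move: h1; rewrite /= tuple_map_out.
Qed.

Lemma intN_comp_C2 (F : V -> R) : continuous F -> supp_in r F -> intN (F \o phi) = intN F.
Proof.
move=> cF sF; have mC := @measurable_cube R n r.
have mF := measurable_vec_continuous cF.
rewrite /intN /Rintegral; congr fine.
rewrite -[RHS](@eq_measure_integral _ _ _ _ mu (measure_function_pushforward__canonical__measure_function_Measure mu measurable_tuple_map)); last first.
  by move=> A mA _; exact: comp_measure.
pose G t : \bar R := (F (vec_of_tuple t))%:E.
have Ghat : G \o tuple_map = EFin \o ((F \o phi) \o @vec_of_tuple R n).
  by apply/funext => t; rewrite /G /= vec_tuple_map.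
have cphi : continuous phi.
  by move=> x; apply: (@cvg_mx _ (nbhs x)) => i j; rewrite ord1; exact: (C2_c0 H).
have cFp : continuous (F \o phi).
  by move=> x; apply: continuous_comp; [exact: cphi|exact: cF].
have sFp : supp_in r (F \o phi) by move=> x rx; rewrite /= phi_out// sF.
have mG : measurable_fun setT G by exact/measurable_EFinP.
have iG : mu.-integrable (tuple_map @^-1` setT) (G \o tuple_map).
  by rewrite Ghat preimage_setT; exact: (integrable_supp r0 cFp sFp).
have e := integral_pushforward measurable_tuple_map mG iG measurableT.
rewrite [RHS](_ : _ = (\int[mu]_(x in tuple_map @^-1` setT) (G \o tuple_map) x)%E).
  by rewrite preimage_setT Ghat.
exact: e.
Qed.
End Cov.

(** * Symplectomorphisms *)

Section Smooth.
Variable R : realType.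

Lemma near_diff (V W : normedModType R) (f g : V -> W) (x : V) :
  (\near x, f x = g x) -> differentiable g x ->
  differentiable f x /\ 'd f x = 'd g x :> (V -> W).
Proof.
move=> fg dg; have [cg hg] := (diff_locallyP x g).1 dg.
have fgx : f x = g x by exact: nbhs_singleton fg.
have hf : f \o shift x = cst (f x) + 'd g x +o_ (0 : V) id.
  apply/eqaddoP => e e0; move/eqaddoP : hg => /(_ _ e0) hg.
  have sh : \forall h \near (0 : V), f (h + x) = g (h + x).
    have h : (fun h : V => h + x) @ nbhs (0 : V) --> (0 + x : V).
      by apply: (@cvgD _ _ _ (nbhs 0)); [exact: cvg_id|exact: cvg_cst].
    by rewrite add0r in h; exact: (h _ fg).
  apply: filterS2 sh hg => h hfg; rewrite fgx /=.
  by rewrite !fctE /= hfg.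
have e := diff_unique cg hf.
split; last exact: e.
apply: (iffRL (diff_locallyP x f)); rewrite e; split; [exact: cg|exact: hf].
Qed.

Lemma partials_near N (V : normedModType R) (f g : 'rV[R]_N -> V) (s : seq 'I_N) (x : 'rV[R]_N) :
  nbhs x [set y | f y = g y] -> nbhs x [set y | partials s f y = partials s g y].
Proof.
move=> fg; elim: s => //= i s /nbhs_interior; apply: filterS => y /=.
exact: near_eq_derive.
Qed.

Lemma smooth_near N (V : normedModType R) (f g : 'rV[R]_N -> V) (x : 'rV[R]_N) s :
  nbhs x [set y | f y = g y] -> differentiable (partials s g) x ->
  differentiable (partials s f) x.
Proof. by move=> /(partials_near s)/near_diff + dg => /(_ dg)[]. Qed.

Section Data.
Variables (N : nat) (f : 'rV[R]_N -> 'rV[R]_N).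
Hypothesis sf : smooth_on setT f.

Lemma is_derive_partials s i k x :
  is_derive x (delta_mx 0 k) (fun x => partials s f x 0 i) (partials (k :: s) f x 0 i).
Proof.
have d := diff_derivable (v := delta_mx 0 k) (sf s (I : setT x)).
split; first exact: ((derivable_mxP _ _ _).1 d 0 i).
by rewrite /= (derive_mx d) mxE.
Qed.

Lemma partials_continuous s i : continuous (fun x => partials s f x 0 i).
Proof.
move=> x; apply: (@continuous_comp _ _ _ (partials s f) (fun M : 'rV[R]_N => M 0 i)).
  exact: differentiable_continuous (sf s (I : setT x)).
exact: coord_continuous.
Qed.

Lemma jacobi_mxE x i j : jacobi_mx f x i j = partials [:: j] f x 0 i.
Proof.
rewrite mxE /= deriveEjacobian; last exact: (sf [::] (I : setT x)).
by rewrite -(rowE j (jacobian f x)) [RHS]mxE.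
Qed.

End Data.

Lemma smooth_C2_data m (f : 'rV[R]_m.+1 -> 'rV[R]_m.+1) : smooth_on setT f ->
  C2_data (fun i x => f x 0 i) (fun i j x => partials [:: j] f x 0 i)
    (fun i j k x => partials [:: k; j] f x 0 i).
Proof.
move=> sf; have d s i k x := @is_derive_partials _ f sf s i k x.
have c s i := @partials_continuous _ f sf s i.
split.
- by move=> i j x; exact: (d [::]).
- by move=> i j k x; exact: (d [:: j]).
- by move=> i; exact: (c [::]).
- by move=> i j; exact: (c [:: j]).
- by move=> i j k; exact: (c [:: k; j]).
move=> i j k x.
have := @schwarz R _ (fun x => f x 0 i) (fun x => partials [:: j] f x 0 i)
  (fun x => partials [:: k] f x 0 i) (fun x => partials [:: k; j] f x 0 i)
  (fun x => partials [:: j; k] f x 0 i) (delta_mx 0 j) (delta_mx 0 k)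
  (fun x => d [::] i j x) (fun x => d [::] i k x) (fun x => d [:: j] i k x)
  (fun x => d [:: k] i j x) (c [:: k; j] i) (c [:: j; k] i).
by move/(congr1 (fun h => h x)).
Qed.

Lemma intN_comp N (phi : 'rV[R]_N -> 'rV[R]_N) (r : R) (F : 'rV[R]_N -> R) :
  0 <= r -> smooth_on setT phi -> (forall x, r < `|x| -> phi x = x) ->
  (forall x, \det (jacobi_mx phi x) = 1) -> continuous F -> supp_in r F ->
  intN (F \o phi) = intN F.
Proof.
(* The divergence formula singles out a component psi_0, so dimension 0 is treated apart; there any
   two vectors are equal. *)
move=> r0; case: N phi F => [|m] phi F sphi out dphi cF sF.
  by congr intN; apply/funext => x /=; congr F; apply/rowP => -[].
apply: (intN_comp_C2 r0 (smooth_C2_data sphi) out _ cF sF) => x.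
by rewrite -(dphi x); congr (\det _); apply/matrixP => i j; rewrite mxE jacobi_mxE.
Qed.

Lemma mul_jacobian N (f : 'rV[R]_N -> 'rV[R]_N) x v : v *m jacobian f x = 'd f x v.
Proof. exact: mul_rV_lin1. Qed.

Lemma jacobi_mx_comp N (f g : 'rV[R]_N -> 'rV[R]_N) x :
  differentiable g x -> differentiable f (g x) ->
  jacobi_mx (f \o g) x = jacobi_mx f (g x) *m jacobi_mx g x.
Proof.
move=> dg df; rewrite /jacobi_mx -trmx_mul; congr trmx.
apply/row_matrixP => i; rewrite !rowE mulmxA.
have d := congr1 (fun h : 'rV[R]_N -> 'rV[R]_N => h (delta_mx 0 i)) (diff_comp dg df).
refine (etrans (mul_jacobian (f \o g) x (delta_mx 0 i)) (etrans (etrans d _) (esym (mul_jacobian f (g x) _)))).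
exact: (congr1 (fun v => 'd f (g x) v) (esym (mul_jacobian g x (delta_mx 0 i)))).
Qed.

End Smooth.

(** * Global regularity of symplectomorphisms extended by the identity *)

Section Symplectomorphism.
Variables (R : realType) (n : nat) (Xi : set 'rV[R]_(n + n)).
Local Notation V := 'rV[R]_(n + n).
Implicit Type q : symp Xi.

(** The compact support is closed and lies in Xi, so q is the identity around every point outside
    Xi, boundary points included. Hence q is smooth on the whole space. *)
Lemma symp_near_id q (x : V) : ~ Xi x -> nbhs x [set y | q y = y].
Proof.
have [K [cK KX idK]] := symp_supp (symp_funP q) => nx.
have : nbhs x (~` K).
  apply: open_nbhs_nbhs; split; last by move=> /KX.
  by apply: closed_openC; apply: compact_closed => //; exact: norm_hausdorff.
by apply: filterS => y; exact: idK.
Qed.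

Lemma symp_out q x : ~ Xi x -> q x = x.
Proof. by move=> /(symp_near_id q)/nbhs_singleton. Qed.

Lemma symp_radius q : exists2 r : R, 0 <= r & forall x, r < `|x| -> q x = x.
Proof.
have [K [/compact_bounded[M [_ hM]] _ idK]] := symp_supp (symp_funP q).
exists (Num.max 0 (M + 1)); first by rewrite le_max lexx.
move=> x; rewrite gt_max => /andP[_ rx]; apply: idK => Kx.
have M1 : M < M + 1 by rewrite ltrDl.
by have /= := hM _ M1 x Kx; rewrite leNgt rx.
Qed.

Lemma symp_smooth q : smooth_on setT q.
Proof.
move=> s x _; have [Xx|nx] := pselect (Xi x).
  by have [? [_ _ _ _ [h _]]] := symp_diffeo (symp_funP q); exact: h.
apply: smooth_near (symp_near_id q nx) _.
exact: (@smooth_id _ _ setT).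
Qed.

Lemma symp_diff q x : differentiable q x.
Proof. exact: (symp_smooth q [::] (I : setT x)). Qed.

Lemma jacobi_near_id q x : nbhs x [set y | q y = y] -> jacobi_mx q x = 1%:M.
Proof.
move=> qid; have di : differentiable (@id V) x by exact: ex_diff.
have [_ e] := near_diff qid di.
have Ed i : (delta_mx 0 i : V) *m jacobian q x = delta_mx 0 i *m jacobian id x.
  refine (etrans (mul_jacobian q x _) (etrans _ (esym (mul_jacobian id x _)))).
  exact: (congr1 (fun h : V -> V => h (delta_mx 0 i)) e).
refine (etrans (congr1 trmx _) (jacobi_id x)).
apply/row_matrixP => i.
exact: (etrans (rowE i (jacobian q x)) (etrans (Ed i) (esym (rowE i (jacobian id x))))).
Qed.

Lemma jacobi_out q x : ~ Xi x -> jacobi_mx q x = 1%:M.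
Proof. by move=> nx; apply: jacobi_near_id; exact: symp_near_id. Qed.

Lemma jacobi_large q (r : R) x : (forall y, r < `|y| -> q y = y) -> r < `|x| ->
  jacobi_mx q x = 1%:M.
Proof.
move=> out rx; apply: jacobi_near_id.
have : nbhs x [set y : V | r < `|y|] by exact: (@norm_continuous R V x _ (lt_nbhsr rx)).
by apply: filterS => y; exact: out.
Qed.

Lemma symp_symplectic q x : symplectic (jacobi_mx q x).
Proof.
have [Xx|nx] := pselect (Xi x); first exact: (symp_preserves (symp_funP q)).
by rewrite jacobi_out//; exact: symplectic1.
Qed.

Lemma symp_continuous q : continuous q.
Proof. by move=> x; exact: differentiable_continuous (symp_diff q x). Qed.

Lemma jacobi_continuous q : continuous (jacobi_mx q).
Proof.
move=> x; apply: (@cvg_mx _ (nbhs x)) => i j.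
rewrite (_ : (fun x => _) = fun x => partials [:: j] q x 0 i).
  rewrite jacobi_mxE; last exact: symp_smooth.
  exact: (partials_continuous (symp_smooth q)).
by apply/funext => y; rewrite jacobi_mxE//; exact: symp_smooth.
Qed.

Lemma det_symplectic (A : 'M[R]_(n + n)) : symplectic A -> \det A ^+ 2 = 1.
Proof.
move=> /(congr1 determinant); rewrite !det_mulmx det_tr => h.
have d0 : \det (symp_form R n) != 0.
  rewrite -unitfE -unitmxE.
  case: (mulmx1_unit (_ : symp_form R n *m (- symp_form R n) = 1%:M)) => //.
  rewrite /symp_form opp_block_mx mulmx_block !oppr0 !mulmx0 !mul0mx !addr0 !add0r.
  by rewrite mulNmx !opprK mulmx1 mulmxN mulmx1 opprK -scalar_mx_block.
apply: (mulIf d0); rewrite mul1r -[RHS]h; ring.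
Qed.
End Symplectomorphism.

Lemma entrywise_continuous (R : realType) (G S : topologicalType) N
    (J : G -> 'M[R]_N) (f : S -> G) :
  (forall g (e : R), 0 < e -> nbhs g [set h | forall i j, `|J h i j - J g i j| < e]) ->
  continuous f -> continuous (fun t => J (f t)).
Proof.
move=> hJ cf t; apply: (@cvg_mx _ (nbhs t) _ R _ _ (fun t => J (f t)) (J (f t))) => i j.
apply/(@cvgrPdist_lt _ _ _ (nbhs t)) => e e0.
have h := cf t _ (hJ (f t) e e0).
by apply: (@filterS _ (nbhs t) _ _ _ _ h) => s hs; rewrite distrC; exact: hs.
Qed.

Lemma const_of_sqr1 (R : realType) (D : R -> R) : continuous D ->
  (forall t, D t ^+ 2 = 1) -> D 0 = 1 -> D 1 = 1.
Proof.
move=> cD D2 D0; have cw : {within `[0, 1], continuous D} by exact: continuous_subspaceT.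
have := D2 1; rewrite -[in RHS](expr1n _ 2) => /eqP.
rewrite eqf_sqr => /orP[/eqP//|/eqP D1].
have [|c _ cE] := @IVT R D 0 1 0 ler01 cw.
  by rewrite D0 D1 min_r ?max_l ?lerN10 ?ler01// lerN10 ler01.
by have /eqP := D2 c; rewrite cE expr0n eq_sym oner_eq0.
Qed.

Lemma continuous_berezin (R : realType) n (S : topologicalType)
    (A B : S -> 'M[R]_(n + n)) : continuous A -> continuous B ->
  (forall t, symplectic (A t)) -> (forall t, symplectic (B t)) ->
  continuous (fun t => berezin (A t) (B t)).
Proof.
move=> cA cB sA sB t; apply: (@mcvg_berezin R n S (nbhs t) _ A B (A t) (B t)) => //.
- by apply: (@filterE _ (nbhs t)) => y; split.
- by apply: cvg_mcvg; exact: cA.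
- by apply: cvg_mcvg; exact: cB.
Qed.

Lemma continuous_argdet (R : realType) n (S : topologicalType) (A : S -> 'M[R]_(n + n)) :
  continuous A -> (forall t, 0 < Re_part (\det (Phi (A t)))) ->
  continuous (fun t => argdet (A t)).
Proof.
move=> cA pos t.
have h : mcvg A (A t) (F := nbhs t) by apply: cvg_mcvg; exact: cA.
have hd : (fun y => \det (Phi (A y))) @ nbhs t --> \det (Phi (A t)).
  exact: (cvg_det (mcvg_Phi h)).
have hI : (fun y => Im_part (\det (Phi (A y)))) @ nbhs t --> Im_part (\det (Phi (A t))).
  by move=> B hB; exact: (hd _ (@Im_part_continuous R _ B hB)).
have hR : (fun y => Re_part (\det (Phi (A y)))) @ nbhs t --> Re_part (\det (Phi (A t))).
  by move=> B hB; exact: (hd _ (@Re_part_continuous R _ B hB)).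
apply: (@continuous_comp _ _ _ (fun y => Im_part (\det (Phi (A y))) / Re_part (\det (Phi (A y)))) (@atan R)).
  apply: (@cvgM _ _ (nbhs t)); first exact: hI.
  by apply: (@cvgV _ _ (nbhs t)); [rewrite gt_eqF//|exact: hR].
exact: continuous_atan.
Qed.

Lemma intN_balance (R : realType) N r (F G H K : 'rV[R]_N -> R) (a : R) : 0 <= r ->
  continuous F -> continuous G -> continuous H -> continuous K ->
  supp_in r F -> supp_in r G -> supp_in r H -> supp_in r K ->
  (forall x, F x + G x = H x + K x) -> intN F = a -> a + intN G = intN H + intN K.
Proof.
move=> r0 cF cG cH cK sF sG sH sK e <-.
rewrite -(intND r0 cF cG sF sG) -(intND r0 cH cK sH sK); congr intN.
exact/funext.
Qed.

Lemma intN_coboundary (R : realType) N r (F G H K : 'rV[R]_N -> R) (a : R) : 0 <= r ->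
  continuous F -> continuous G -> continuous H -> continuous K ->
  supp_in r F -> supp_in r G -> supp_in r H -> supp_in r K ->
  (forall x, G x = H x - F x - K x) -> intN F = a ->
  intN G = - a + - intN K - - intN H.
Proof.
move=> r0 cF cG cH cK sF sG sH sK e <-.
have cKG : continuous (fun x => K x + G x).
  by move=> x; apply: (@cvgD _ _ _ (nbhs x)); [exact: cK|exact: cG].
have sKG : supp_in r (fun x => K x + G x) by move=> x rx; rewrite sK// sG// addr0.
have : intN F + intN (fun x => K x + G x) = intN H.
  rewrite -(intND r0 cF cKG sF sKG); congr intN; apply/funext => x; rewrite e; ring.
by rewrite (intND r0 cK cG sK sG); lra.
Qed.

(** * The cocycle on the universal covering group *)

Section Lifted.
Variables (R : realType) (n : nat) (Xi : set 'rV[R]_(n + n)).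
Variables (G : topologicalGroupType) (p : G -> SSymp Xi).
Hypothesis Gp : universal_covering_group p.
Local Notation V := 'rV[R]_(n + n).
Local Notation M := 'M[R]_(n + n).
Implicit Types (g h k : G) (x m : V).

Definition lift_symp g : symp Xi := set_val (p g).
Local Notation T := lift_symp.

Lemma lift_sympM g h x : T (g * h)%g x = T g (T h x).
Proof. by have [_ _ pM] := Gp; rewrite /T pM. Qed.

(** T 1 is idempotent by multiplicativity of p, and it has a left inverse on Xi. *)
Lemma lift_symp1 x : T 1%g x = x.
Proof.
have [Xx|nx] := pselect (Xi x); last exact: symp_out.
have [r [qX rX rq _ _]] := symp_diffeo (symp_funP (T 1%g)).
by rewrite -[RHS](rq _ Xx) -[in RHS](mulg1 1%g) lift_sympM rq//; exact: qX.
Qed.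

Definition jac g x : M := jacobi_mx (T g) x.

Lemma jacM g h x : jac (g * h)%g x = jac g (T h x) *m jac h x.
Proof.
have e : T (g * h)%g = T g \o T h :> (V -> V) by apply/funext => y; exact: lift_sympM.
by rewrite /jac e; apply: jacobi_mx_comp; exact: symp_diff.
Qed.

Lemma jac1 x : jac 1%g x = 1%:M.
Proof. by apply: jacobi_near_id; apply: filterE => y; exact: lift_symp1. Qed.

Lemma jac_symplectic g x : symplectic (jac g x).
Proof. exact: symp_symplectic. Qed.

(** The constant gauge of order 1 and tolerance e controls first derivatives uniformly on Xi;
    outside Xi all Jacobi matrices are 1. Uniformity in x is what makes W a neighbourhood in
    [lifted_cocycle_trivial]. *)
Lemma near_jacobi (q : symp Xi) (e : R) : 0 < e ->
  nbhs q [set q' : symp Xi | forall x i j, `|jacobi_mx q' x i j - jacobi_mx q x i j| < e].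
Proof.
move=> e0; exists (fun=> 1%N), (fun=> e); split; first by move=> K _ _; exists 1%N, e.
move=> q' qq' x i j; have [Xx|nx] := pselect (Xi x); last first.
  by rewrite !jacobi_out// subrr normr0.
have E (s : symp Xi) := jacobi_mxE (symp_smooth s) x i j.
have sub (a b c d : R) : a = c -> b = d -> `|c - d| < e -> `|a - b| < e by move=> -> ->.
apply: (sub _ _ _ _ (E q') (E q)); apply: le_lt_trans (qq' x Xx [:: j] isT).
by have := mx_norm_ge (partials [:: j] q' x - partials [:: j] q x) 0 i; rewrite !mxE.
Qed.

Lemma lift_symp_continuous : continuous T.
Proof.
have [_ [cp _ _] _] := Gp.
move=> g; apply: (@continuous_comp _ _ _ p set_val); first exact: cp.
exact: initial_continuous.
Qed.

Lemma lift_symp_near g (A : set (symp Xi)) : nbhs (T g) A -> nbhs g (T @^-1` A).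
Proof. by move=> h; exact: (lift_symp_continuous h). Qed.

Lemma near_jac g (e : R) : 0 < e ->
  nbhs g [set h | forall x i j, `|jac h x i j - jac g x i j| < e].
Proof.
move=> e0; apply: (@filterS _ (nbhs g) _ _ _ _ (lift_symp_near (near_jacobi (T g) e0))).
by move=> k hk x i j; have := hk x i j.
Qed.

Lemma jac_path (f : R -> G) x : continuous f -> continuous (fun t => jac (f t) x).
Proof.
move=> cf; apply: (entrywise_continuous (J := fun g => jac g x) _ cf) => g e e0.
by apply: (@filterS _ (nbhs g) _ _ _ _ (near_jac g e0)) => h hh i j; have := hh x i j.
Qed.

Lemma path_to g : exists f : R -> G, [/\ continuous f, f 0 = 1%g & f 1 = g].
Proof.
have [[conn _] _ _] := Gp; have [f /is_path_clamp hf] := conn 1%g g.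
by exists (f \o @clamp R).
Qed.

(** The symplectic relation leaves the values 1 and -1; along a path from 1 to g the determinant is
    continuous and starts at 1. *)
Lemma det_jac g x : \det (jac g x) = 1.
Proof.
have [f [cf f0 f1]] := path_to g.
rewrite -f1; apply: (@const_of_sqr1 R (fun t => \det (jac (f t) x))).
- move=> t; apply: (@cvg_det _ (nbhs t)).
  by apply: cvg_mcvg; exact: jac_path.
- by move=> t; exact: det_symplectic (jac_symplectic _ _).
- by rewrite f0 jac1 det1.
Qed.

Definition pair_berezin g h m : R := berezin (jac g (T h m)) (jac h m).

Lemma ber_continuous g h : continuous (pair_berezin g h).
Proof.
have cj (s : symp Xi) : continuous (jacobi_mx s) := @jacobi_continuous _ _ _ s.
apply: (@continuous_berezin R n V (fun m => jac g (T h m)) (jac h)); last 2 first.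
- by move=> m; exact: jac_symplectic.
- by move=> m; exact: jac_symplectic.
- move=> m; apply: (@continuous_comp _ _ _ (T h) (jacobi_mx (T g))).
    exact: symp_continuous.
  exact: cj.
- exact: cj.
Qed.

Definition fixes_outside (r : R) g := forall x, r < `|x| -> T g x = x.

Lemma fixes_outside_ex g : exists r, forall s, r <= s -> fixes_outside s g.
Proof.
have [r _ hr] := symp_radius (T g).
by exists r => s rs x sx; apply: hr; exact: le_lt_trans sx.
Qed.

Lemma fixes_outside3 g h k : exists r : R,
  [/\ 0 <= r, fixes_outside r g, fixes_outside r h & fixes_outside r k].
Proof.
have [a ha] := fixes_outside_ex g; have [b hb] := fixes_outside_ex h.
have [c hc] := fixes_outside_ex k.
exists (Num.max 0 (Num.max a (Num.max b c))); split.
- by rewrite le_max lexx.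
- by apply: ha; rewrite !le_max lexx !orbT.
- by apply: hb; rewrite !le_max lexx !orbT.
- by apply: hc; rewrite !le_max lexx !orbT.
Qed.

Lemma jac_fixed r g x : fixes_outside r g -> r < `|x| -> jac g x = 1%:M.
Proof. exact: jacobi_large. Qed.

Lemma fixes_outsideM r g h : fixes_outside r g -> fixes_outside r h ->
  fixes_outside r (g * h)%g.
Proof. by move=> hg hh x rx; rewrite lift_sympM hh// hg. Qed.

Lemma ber_supp r g h : fixes_outside r g -> fixes_outside r h -> supp_in r (pair_berezin g h).
Proof.
move=> hg hh x rx; rewrite /pair_berezin hh// (jac_fixed hg rx) (jac_fixed hh rx).
exact: berezin11.
Qed.

Lemma symp_cocycleE g h : symp_cocycle (T g) (T h) = intN (pair_berezin g h).
Proof.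
apply: integralN_supp => x nx.
rewrite [T h x]symp_out// jacobi_out// jacobi_out//; exact: berezin11.
Qed.

Lemma intN_lift g r (F : V -> R) : 0 <= r -> fixes_outside r g ->
  continuous F -> supp_in r F -> intN (fun x => F (T g x)) = intN F.
Proof.
move=> r0 hg cF sF; apply: (intN_comp r0) => //; first exact: symp_smooth.
by move=> x; exact: det_jac.
Qed.

(** The base points T h (T k m), T k m and m stay fixed while the group elements run along paths
    from 1 to g, h and k. The three matrix paths satisfy the hypotheses of [berezin_cocycle], and
    the chain rule is applied only at their ends. *)
Lemma ber_cocycle g h k m :
  pair_berezin g h (T k m) + pair_berezin (g * h)%g k m = pair_berezin g (h * k)%g m + pair_berezin h k m.
Proof.
have [a [ca a0 a1]] := path_to g; have [b [cb b0 b1]] := path_to h.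
have [c [cc c0 c1]] := path_to k.
have := @berezin_cocycle R n (fun t => jac (a t) (T h (T k m)))
  (fun t => jac (b t) (T k m)) (fun t => jac (c t) m).
rewrite a0 b0 c0 a1 b1 c1 => H.
rewrite /pair_berezin !jacM lift_sympM; apply: H; try exact: jac_path; try exact: jac1.
- by move=> t; exact: jac_symplectic.
- by move=> t; exact: jac_symplectic.
- by move=> t; exact: jac_symplectic.
Qed.

(** The first term of [ber_cocycle] is taken at T k m; after integration this shift disappears
    because T k preserves volume. *)
Lemma intN_ber_cocycle g h k :
  intN (pair_berezin g h) + intN (pair_berezin (g * h)%g k) = intN (pair_berezin g (h * k)%g) + intN (pair_berezin h k).
Proof.
have [r [r0 hg hh hk]] := fixes_outside3 g h k.
have hgh := fixes_outsideM hg hh; have hhk := fixes_outsideM hh hk.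
have c := ber_continuous.
have e := intN_lift r0 hk (c g h) (ber_supp hg hh).
have cgh : continuous (fun m => pair_berezin g h (T k m)).
  move=> m; apply: (@continuous_comp _ _ _ (T k) (pair_berezin g h)); [exact: symp_continuous|exact: c].
have sgh : supp_in r (fun m => pair_berezin g h (T k m)).
  by move=> x rx; rewrite (hk x rx); exact: (ber_supp hg hh).
exact: (intN_balance r0 cgh (c _ _) (c _ _) (c _ _) sgh (ber_supp hgh hk)
  (ber_supp hg hhk) (ber_supp hh hk) (ber_cocycle g h k) e).
Qed.

Lemma argdet1 : argdet (1%:M : M) = 0.
Proof.
rewrite /argdet Phi1 det1.
by have -> : Im_part (1 : cplx R) = 0 by []; rewrite mul0r atan0.
Qed.

Lemma argdet_jac_continuous g : (forall x, 0 < Re_part (\det (Phi (jac g x)))) ->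
  continuous (fun x => argdet (jac g x)).
Proof. by move=> pos; apply: continuous_argdet pos; exact: jacobi_continuous. Qed.

Theorem lifted_cocycle_trivial :
  trivial_extension (fun g h => symp_cocycle (T g) (T h)).
Proof.
have [scG _ _] := Gp.
have -> : (fun g h => symp_cocycle (T g) (T h)) = (fun g h => intN (pair_berezin g h)).
  by apply/funext => g; apply/funext => h; exact: symp_cocycleE.
have [U U1 [posU locU]] := @local_primitive R n.
(* The local primitive of c is to be integrated over m, so U must contain the Jacobi matrices at all
   points at once. *)
pose W : set G := [set g | forall x, U (jac g x)].
have W1 : nbhs 1%g W.
  have /nbhs_ballP[e /= e0 eU] := U1.
  apply: filterS (near_jac 1%g e0) => g hg x; apply: eU; split => // i j.
  by have := hg x i j; rewrite jac1 -ball_normE /= distrC.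
apply: (@trivial_of_local R G _ W (fun g => - intN (fun m => argdet (jac g m)))).
- exact: scG.
- exact: W1.
- by move=> g h k; exact: intN_ber_cocycle.
move=> u v Wu Wv Wuv.
have [r [r0 hu hv _]] := fixes_outside3 u v v.
have huv := fixes_outsideM hu hv.
have pos g : W g -> forall x, 0 < Re_part (\det (Phi (jac g x))).
  by move=> Wg x; exact: posU.
have cu := argdet_jac_continuous (pos _ Wu).
have cv := argdet_jac_continuous (pos _ Wv).
have cuv := argdet_jac_continuous (pos _ Wuv).
have s g : fixes_outside r g -> supp_in r (fun x => argdet (jac g x)).
  by move=> hg x rx; rewrite (jac_fixed hg rx) argdet1.
have cuv' : continuous (fun m => argdet (jac u (T v m))).
  move=> m; apply: (@continuous_comp _ _ _ (T v) (fun x => argdet (jac u x))).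
    exact: symp_continuous.
  exact: cu.
have suv' : supp_in r (fun m => argdet (jac u (T v m))).
  by move=> x rx; rewrite (hv x rx); exact: (s u hu).
have loc m : pair_berezin u v m = argdet (jac (u * v)%g m) - argdet (jac u (T v m)) - argdet (jac v m).
  rewrite /pair_berezin jacM; apply: locU; rewrite -?jacM.
  - exact: Wu.
  - exact: Wv.
  - exact: Wuv.
  - exact: jac_symplectic.
  - exact: jac_symplectic.
(* The chain rule produces u' at T v m, and volume preservation by T v turns its integral into that
   of argdet (u'). *)
have e := intN_lift r0 hv cu (s u hu).
exact: (intN_coboundary r0 cuv' (@ber_continuous u v) cuv cv suv' (ber_supp hu hv) (s _ huv)
  (s v hv) loc e).
Qed.

End Lifted.

Theorem proposition1p2 (R : realType) (n : nat) (Xi : set 'rV[R]_(n + n))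
    (Xi_open : open Xi) (G : topologicalGroupType) (p : G -> SSymp Xi)
    (Gp : universal_covering_group p) :
  trivial_extension
    (fun g1 g2 : G => symp_cocycle (set_val (p g1)) (set_val (p g2))).
Proof. exact: lifted_cocycle_trivial. Qed.
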